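(* In the setting of the context (a cylindrical end, $\varphi=0$), for all $g\in G$ and all $a'>a$, $$\eta^{0}_g(D_N^+,a')=\eta_g(D_N^+),$$ where $\eta^0_g(D_N^+,a')$ is the $g$-delocalised $\varphi$-cusp contribution for $\varphi=0$ and $$\eta_g(D_N^+)=\frac{1}{\sqrt\pi}\int_0^\infty\operatorname{Tr}\big(g\,D_N^+e^{-s(D_N^+)^2}\big)\frac{1}{\sqrt s}\,ds$$ is the $g$-delocalised $\eta$-invariant of $D_N^+$.
   Context: Let $M$ be a complete Riemannian manifold of even dimension $p$ with an isometric action by a compact Lie group $G$, and a $\mathbb{Z}/2$-graded, Hermitian, $G$-equivariant Clifford module $S=S^+\oplus S^-\to M$ with a $G$-equivariant Dirac operator $D$. Suppose there are a $G$-invariant compact subset $Z\subset M$ with smooth boundary $N$ and $a\ge0$ such that $M\setminus Z$ is $G$-equivariantly isometric to the cylinder $N\times(a,\infty)$ with the metric $B_N+dx^2$ (the case $\varphi=0$), with $B_N$ the restricted metric on $N$, the isometry extending continuously to the boundary $N\leftrightarrow N\times\{a\}$, and $S|_{M\setminus Z}\cong S|_N\times(a,\infty)$. Suppose $D|_{M\setminus Z}=\sigma(\frac{\partial}{\partial x}+D_N)$, where $D_N$ is a grading-preserving $G$-equivariant Dirac operator on $S|_N$ and $\sigma$ is a grading-reversing $G$-equivariant isometric endomorphism of $S|_N$ anticommuting with $D_N$. $D_N$ is assumed invertible. $D_N^+$ is its restriction to sections of $S^+|_N$. For general $\varphi$ the cusp contribution is defined as follows. Let $\xi(x)=\int_a^xe^{\varphi(x')}\,dx'$,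 $q_\lambda^+=\lambda((\lambda+\varphi')e^{-2\varphi})\circ\xi^{-1}$, $\Delta_\lambda^+=-\frac{d^2}{dy^2}+q_\lambda^+$ on $[0,\infty)$; let $\theta_\nu^{\lambda,+}$ be the solution of $\Delta_\lambda^+\theta=\nu\theta$ with $\theta(0)=0$, $\theta'(0)=1$; let $\rho^{\lambda,+}\colon\mathbb{R}\to\mathbb{R}$ be the increasing function such that $f\mapsto(\nu\mapsto\int_0^\infty f(y)\theta_\nu^{\lambda,+}(y)\,dy)$ extends to a unitary isomorphism $L^2([0,\infty))\to L^2(\mathbb{R},d\rho^{\lambda,+})$ (with inverse given by integrating against $\theta_\nu^{\lambda,+}(y)\,d\rho^{\lambda,+}(\nu)$). Then $$\eta^{\varphi}_g(D_N^+,a')=2e^{-p\varphi(a')}\int_0^\infty\sum_{\lambda\in\operatorname{spec}(D_N^+)}\operatorname{sgn}(\lambda)\operatorname{tr}(g|_{\ker(D_N^+-\lambda)})\int_{\mathbb{R}}e^{-s\nu}\theta_\nu^{|\lambda|,+}(\xi(a'))\Big((\theta_\nu^{|\lambda|,+})'(\xi(a'))+|\lambda|e^{-\varphi(a')}\theta_\nu^{|\lambda|,+}(\xi(a'))\Big)d\rho^{|\lambda|,+}(\nu)\,ds.$$ For $\varphi=0$ this gives $\xi(x)=x-a$ and $q_\lambda^+=\lambda^2$. *)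

(* Defs.v *)
From HB Require Import structures.
From mathcomp Require Import all_boot all_order all_algebra.
From mathcomp Require Import complex.
From mathcomp Require Import all_classical all_reals all_analysis.

Set Implicit Arguments.
Unset Strict Implicit.
Unset Printing Implicit Defensive.

Import Order.TTheory GRing.Theory Num.Theory.
Import numFieldNormedType.Exports.

Local Open Scope classical_set_scope.
Local Open Scope ring_scope.
Local Open Scope complex_scope.

Local Notation lebR R := (@lebesgue_measure R).

Definition partial (R : realType) n (f : 'rV[R]_n -> R) (i : 'I_n)
    (x : 'rV[R]_n) : R :=
  derive1 (fun t : R => f (x + t *: delta_mx 0 i)) 0.

Fixpoint Ck_on (R : realType) n (k : nat) (U : set 'rV[R]_n)
    (f : 'rV[R]_n -> R) : Prop :=
  (forall x, U x -> {for x, continuous f}) /\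
  if k is k'.+1 then
    forall i : 'I_n,
      (forall x, U x -> derivable (fun t : R => f (x + t *: delta_mx 0 i)) 0 1)
      /\ Ck_on k' U (partial f i)
  else True.

(* C^infinity; only used for open U. *)
Definition smooth_on (R : realType) n (U : set 'rV[R]_n)
    (f : 'rV[R]_n -> R) : Prop := forall k, Ck_on k U f.

(* Iterated Lebesgue integral; only used for f whose support is compact and
   which is continuous. *)
Fixpoint lebint (R : realType) n : ('rV[R]_n -> R) -> R :=
  match n with
  | 0 => fun f => f 0
  | n'.+1 => fun f =>
      Rintegral (lebR R) setT
        (fun t : R => @lebint R n' (fun v => f (row_mx (const_mx t : 'rV_1) v)))
  end.

Record chart (R : realType) n (X : Type) := Chart {
  cdom : set X;
  cmap : X -> 'rV[R]_n;
  cinv : 'rV[R]_n -> X }.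

Definition cimg (R : realType) n X (c : chart R n X) : set 'rV[R]_n :=
  cmap c @` cdom c.

Definition is_chart (R : realType) n (X : topologicalType)
    (c : chart R n X) : Prop :=
  [/\ open (cdom c), open (cimg c),
      (forall x, cdom c x -> cinv c (cmap c x) = x),
      (forall x, cdom c x -> {for x, continuous (cmap c)})
    & (forall z, cimg c z -> {for z, continuous (cinv c)})].

(* [chart_at x] is a preferred chart around x: tangent vectors at x are
   represented by their coordinates (row vectors) in that chart. *)
Record manifold (R : realType) (n : nat) := Manifold {
  mcar :> topologicalType;
  atlas : set (chart R n mcar);
  chart_at : mcar -> chart R n mcar;
  mfd_hausdorff : hausdorff_space mcar;
  mfd_second_countable : @second_countable mcar;
  atlas_chart : forall c, atlas c -> is_chart c;
  chart_at_atlas : forall x, atlas (chart_at x);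
  chart_at_dom : forall x, cdom (chart_at x) x;
  atlas_compat : forall c c', atlas c -> atlas c' -> forall j,
    smooth_on (cmap c @` (cdom c `&` cdom c'))
      (fun z => cmap c' (cinv c z) 0 j) }.

Definition smooth_fun (R : realType) n (X : manifold R n) (U : set X)
    (f : X -> R) : Prop :=
  forall c, atlas c ->
    smooth_on (cmap c @` (cdom c `&` U)) (f \o cinv c).

Definition csmooth_fun (R : realType) n (X : manifold R n) (U : set X)
    (f : X -> R[i]) : Prop :=
  smooth_fun U (fun x => complex.Re (f x)) /\
  smooth_fun U (fun x => complex.Im (f x)).

Definition smooth_map (R : realType) n m (X : manifold R n)
    (Y : manifold R m) (F : X -> Y) : Prop :=
  continuous F /\
  forall c c', atlas c -> atlas c' -> forall j,
    smooth_on (cmap c @` (cdom c `&` (F @^-1` cdom c')))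
      (fun z => cmap c' (F (cinv c z)) 0 j).

Definition smooth_fun2 (R : realType) n m (X : manifold R n)
    (Y : manifold R m) (U : set (X * Y)) (f : X -> Y -> R) : Prop :=
  forall c c', atlas c -> atlas c' ->
    smooth_on
      [set z : 'rV[R]_(n + m) | exists x y,
         [/\ cdom c x, cdom c' y, U (x, y) & z = row_mx (cmap c x) (cmap c' y)]]
      (fun z => f (cinv c (lsubmx z)) (cinv c' (rsubmx z))).

Definition smooth_map2 (R : realType) n m l (X : manifold R n)
    (Y : manifold R m) (W : manifold R l) (F : X -> Y -> W) : Prop :=
  continuous (fun xy : X * Y => F xy.1 xy.2) /\
  forall c, atlas c -> forall j,
    smooth_fun2 [set xy | cdom c (F xy.1 xy.2)]
      (fun x y => cmap c (F x y) 0 j).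

Definition smooth_cyl (R : realType) n (X : manifold R n) (a : R)
    (U : set (X * R)) (f : X -> R -> R) : Prop :=
  forall c, atlas c ->
    smooth_on
      [set z : 'rV[R]_(n + 1) | exists x t,
         [/\ cdom c x, a < t, U (x, t)
           & z = row_mx (cmap c x) (const_mx t : 'rV_1)]]
      (fun z => f (cinv c (lsubmx z)) ((rsubmx z : 'rV_1) 0 0)).

Definition smooth_cyl_map (R : realType) n m (X : manifold R n) (a : R)
    (Y : manifold R m) (F : X -> R -> Y) : Prop :=
  forall c, atlas c -> forall j,
    smooth_cyl a [set xt | cdom c (F xt.1 xt.2)]
      (fun x t => cmap c (F x t) 0 j).

(* Differential of a function at x, as a covector in the chart [chart_at x]. *)
Definition dfun (R : realType) n (X : manifold R n) (f : X -> R) (x : X) :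
    'rV[R]_n :=
  \row_i partial (f \o cinv (chart_at x)) i (cmap (chart_at x) x).

(* Jacobian of F at x; tangent vectors are rows, so dF(v) = v *m jac F x. *)
Definition jac (R : realType) n m (X : manifold R n) (Y : manifold R m)
    (F : X -> Y) (x : X) : 'M[R]_(n, m) :=
  \matrix_(i, j) partial
    (fun z => cmap (chart_at (F x)) (F (cinv (chart_at x) z)) 0 j) i
    (cmap (chart_at x) x).

Definition velocity (R : realType) n (X : manifold R n) (gam : R -> X)
    (t : R) : 'rV[R]_n :=
  \row_j derive1 (fun s => cmap (chart_at (gam t)) (gam s) 0 j) t.

(* The metric at x is the Gram matrix in the chart [chart_at x]; [metric_in]
   is the Gram matrix at x in an arbitrary chart c. *)
Definition metric_in (R : realType) n (X : manifold R n)
    (B : X -> 'M[R]_n) (c : chart R n X) (x : X) : 'M[R]_n :=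
  let J := \matrix_(i, j) partial
    (fun z => cmap (chart_at x) (cinv c z) 0 j) i (cmap c x) in
  J *m B x *m J^T.

Definition is_metric (R : realType) n (X : manifold R n)
    (B : X -> 'M[R]_n) : Prop :=
  [/\ (forall x, (B x)^T = B x),
      (forall x (v : 'rV[R]_n), v != 0 -> 0 < (v *m B x *m v^T) 0 0)
    & (forall c, atlas c -> forall i j,
        smooth_on (cimg c) (fun z => metric_in B c (cinv c z) i j))].

Definition grad (R : realType) n (X : manifold R n) (B : X -> 'M[R]_n)
    (f : X -> R) (x : X) : 'rV[R]_n := dfun f x *m invmx (B x).

Definition is_isometric (R : realType) n m (X : manifold R n)
    (Y : manifold R m) (BX : X -> 'M[R]_n) (BY : Y -> 'M[R]_m)
    (F : X -> Y) : Prop :=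
  forall x, jac F x *m BY (F x) *m (jac F x)^T = BX x.

Definition C1_curve (R : realType) n (X : manifold R n) (gam : R -> X) : Prop :=
  continuous gam /\
  forall c, atlas c -> forall t, cdom c (gam t) -> forall j,
    derivable (fun s => cmap c (gam s) 0 j) t 1 /\
    {for t, continuous (derive1 (fun s => cmap c (gam s) 0 j))}.

Definition curve_length (R : realType) n (X : manifold R n)
    (B : X -> 'M[R]_n) (gam : R -> X) : R :=
  Rintegral (lebR R) `[0, 1]
    (fun t => let v := velocity gam t in
       Num.sqrt ((v *m B (gam t) *m v^T) 0 0)).

(* Completeness for the Riemannian distance: "d(x, y) < e" is the existence of
   a curve from x to y of length < e. *)
Definition complete_metric (R : realType) n (X : manifold R n)
    (B : X -> 'M[R]_n) : Prop :=
  forall u : nat -> X,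
    (forall e : R, 0 < e -> exists N, forall j k, (N <= j)%N -> (N <= k)%N ->
       exists gam, [/\ C1_curve gam, gam 0 = u j, gam 1 = u k
                     & curve_length B gam < e]) ->
    exists x : X, u @ \oo --> x.

Definition outside_compact (X : topologicalType) (A : set X) : Prop :=
  exists K : set X, compact K /\ forall x, ~ K x -> A x.

(* The Riemannian density, as the strictly positive linear functional on C_c(X)
   which is sqrt(det B) dx in charts (unique by partitions of unity). *)
Definition is_volume (R : realType) n (X : manifold R n)
    (B : X -> 'M[R]_n) (vol : (X -> R) -> R) : Prop :=
  (forall (a : R) (f g : X -> R),
     continuous f -> outside_compact [set x | f x = 0] ->
     continuous g -> outside_compact [set x | g x = 0] ->
     vol (fun x => a * f x + g x) = a * vol f + vol g) /\
  (forall f : X -> R, continuous f -> outside_compact [set x | f x = 0] ->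
     (forall x, 0 <= f x) -> (exists x, f x != 0) -> 0 < vol f) /\
  (forall c (f : X -> R) (K : set X), atlas c -> continuous f ->
     compact K -> K `<=` cdom c -> (forall x, ~ K x -> f x = 0) ->
     vol f = lebint (fun z =>
       if `[< cimg c z >]
       then f (cinv c z) * Num.sqrt (\det (metric_in B c (cinv c z)))
       else 0)).

Definition cvol (R : realType) (X : Type) (vol : (X -> R) -> R)
    (f : X -> R[i]) : R[i] :=
  (vol (fun x => complex.Re (f x)) +i* vol (fun x => complex.Im (f x)))%C.

Record frame (R : realType) (X : Type) (E : X -> lmodType R[i]) := Frame {
  fdom : set X;
  frk : nat;
  fvec : 'I_frk -> forall x, E x }.
Arguments fvec {R X E} f k x.

(* A bundle is given by its fibres and its smooth local frames. *)
Record bundle (R : realType) (X : Type) := Bundle {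
  fib :> X -> lmodType R[i];
  frames : set (frame fib) }.
Arguments frames {R X} b.

Definition sec (R : realType) (X : Type) (E : bundle R X) := forall x, E x.

Definition frame_comb (R : realType) X (E : bundle R X) (F : frame E)
    (a : 'rV[R[i]]_(frk F)) (x : X) : E x :=
  \sum_k a 0 k *: fvec F k x.
Arguments frame_comb {R X E} F a x.

Definition smooth_sec_on (R : realType) n (X : manifold R n)
    (E : bundle R X) (U : set X) (u : sec E) : Prop :=
  forall F, frames E F -> exists a : X -> 'rV[R[i]]_(frk F),
    (forall x, U x -> fdom F x -> u x = frame_comb F (a x) x) /\
    (forall k, csmooth_fun (U `&` fdom F) (fun x => a x 0 k)).

Definition smooth_sec (R : realType) n (X : manifold R n) (E : bundle R X)
    (u : sec E) : Prop := smooth_sec_on setT u.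

Definition is_bundle (R : realType) n (X : manifold R n) (E : bundle R X) :
    Prop :=
  [/\ (forall F, frames E F -> open (fdom F)),
      (forall x : X, exists2 F, frames E F & fdom F x),
      (forall F x, frames E F -> fdom F x ->
         forall v : E x, exists! a, v = frame_comb F a x)
    & (forall F k, frames E F -> smooth_sec_on (fdom F) (fvec F k))].

Definition pullback (R : realType) (X Y : Type) (i : Y -> X)
    (E : bundle R X) : bundle R Y :=
  Bundle [set F' | exists2 F, frames E F &
    F' = @Frame R Y (fun y => E (i y)) (i @^-1` fdom F) (frk F)
           (fun k y => fvec F k (i y))].

Definition linear_op (R : realType) (V W : lmodType R[i]) (f : V -> W) : Prop :=
  forall (a : R[i]) u v, f (a *: u + v) = a *: f u + f v.

Definition is_hermitian (R : realType) n (X : manifold R n)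
    (E : bundle R X) (h : forall x, E x -> E x -> R[i]) : Prop :=
  [/\ (forall x (a : R[i]) (u v w : E x),
         h x (a *: u + v) w = a * h x u w + h x v w),
      (forall x (u v : E x), h x v u = (h x u v)^*%C),
      (forall x (u : E x), u != 0 -> 0 < h x u u)
    & (forall u v : sec E, smooth_sec u -> smooth_sec v ->
         csmooth_fun setT (fun x => h x (u x) (v x)))].

Definition bundle_map (R : realType) n (X : manifold R n) (E : bundle R X)
    (T : forall x, E x -> E x) : Prop :=
  (forall x, linear_op (T x)) /\
  (forall u : sec E, smooth_sec u -> smooth_sec (fun x => T x (u x))).

(* The grading operator: +1 on E^+ and -1 on E^-, which are orthogonal. *)
Definition is_grading (R : realType) n (X : manifold R n) (E : bundle R X)
    (h : forall x, E x -> E x -> R[i]) (eps : forall x, E x -> E x) : Prop :=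
  [/\ bundle_map eps, (forall x u, eps x (eps x u) = u)
    & (forall x u v, h x (eps x u) v = h x u (eps x v))].

(* Clifford action, with c(v)^2 = -|v|^2 and c(v) skew-adjoint. *)
Definition is_clifford (R : realType) n (X : manifold R n)
    (B : X -> 'M[R]_n) (E : bundle R X) (h : forall x, E x -> E x -> R[i])
    (cl : forall x, 'rV[R]_n -> E x -> E x) : Prop :=
  [/\ (forall x v, linear_op (cl x v)),
      (forall x (t : R) v w u,
         cl x (t *: v + w) u = t%:C *: cl x v u + cl x w u),
      (forall x v u, cl x v (cl x v u) = - ((v *m B x *m v^T) 0 0)%:C *: u),
      (forall x v u w, h x (cl x v u) w = - h x u (cl x v w))
    & (forall f (u : sec E), smooth_fun setT f -> smooth_sec u ->
         smooth_sec (fun x => cl x (grad B f x) (u x)))].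

(* Dirac operator for the Clifford action cl: formally self-adjoint first-order
   operator on smooth sections with [D, f] = c(grad f). *)
Definition is_dirac (R : realType) n (X : manifold R n)
    (B : X -> 'M[R]_n) (vol : (X -> R) -> R) (E : bundle R X)
    (h : forall x, E x -> E x -> R[i])
    (cl : forall x, 'rV[R]_n -> E x -> E x) (D : sec E -> sec E) : Prop :=
  [/\ (forall u, smooth_sec u -> smooth_sec (D u)),
      (forall (a : R[i]) u v, smooth_sec u -> smooth_sec v -> forall x,
         D (fun y => a *: u y + v y) x = a *: D u x + D v x),
      (forall f u, smooth_fun setT f -> smooth_sec u -> forall x,
         D (fun y => (f y)%:C *: u y) x
         = cl x (grad B f x) (u x) + (f x)%:C *: D u x)
    & (forall u v, smooth_sec u -> smooth_sec v ->
         outside_compact [set x | u x = 0] ->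
         outside_compact [set x | v x = 0] ->
         cvol vol (fun x => h x (D u x) (v x))
         = cvol vol (fun x => h x (u x) (D v x)))].

Record lie_group (R : realType) := LieGroup {
  lie_dim : nat;
  lie_mfd :> manifold R lie_dim;
  lmul : lie_mfd -> lie_mfd -> lie_mfd;
  lone : lie_mfd;
  linv : lie_mfd -> lie_mfd;
  lmulA : forall g h k, lmul g (lmul h k) = lmul (lmul g h) k;
  lmul1 : forall g, lmul lone g = g;
  lmulV : forall g, lmul (linv g) g = lone;
  lmul_smooth : smooth_map2 lmul;
  linv_smooth : smooth_map linv }.

Definition is_action (R : realType) (G : lie_group R) n (X : manifold R n)
    (act : G -> X -> X) : Prop :=
  [/\ smooth_map2 act, (forall x, act (lone G) x = x)
    & (forall g h x, act (lmul g h) x = act g (act h x))].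

(* The lift of an action to E is a family [actE g x y : E x -> E y]; only the
   values with y = act g x are meaningful. *)
Definition is_bundle_action (R : realType) (G : lie_group R) n
    (X : manifold R n) (act : G -> X -> X) (E : bundle R X)
    (actE : G -> forall x y : X, E x -> E y)
    (h : forall x, E x -> E x -> R[i]) : Prop :=
  [/\ (forall g x, linear_op (actE g x (act g x))),
      (forall x v, actE (lone G) x x v = v),
      (forall g k x v,
         actE (lmul g k) x (act g (act k x)) v
         = actE g (act k x) (act g (act k x)) (actE k x (act k x) v)),
      (forall g x u v,
         h (act g x) (actE g x (act g x) u) (actE g x (act g x) v) = h x u v)
    & (forall u v : sec E, smooth_sec u -> smooth_sec v ->
         let f g x := h (act g x) (actE g x (act g x) (u x)) (v (act g x)) in
         smooth_fun2 setT (fun g x => complex.Re (f g x)) /\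
         smooth_fun2 setT (fun g x => complex.Im (f g x)))].

Definition act_sec (R : realType) (G : lie_group R) (X : Type)
    (act : G -> X -> X) (E : bundle R X)
    (actE : G -> forall x y : X, E x -> E y) (g : G) (u : sec E) : sec E :=
  fun x => actE g (act (linv g) x) x (u (act (linv g) x)).

Definition map_equivariant (R : realType) (G : lie_group R) (X : Type)
    (act : G -> X -> X) (E : bundle R X)
    (actE : G -> forall x y : X, E x -> E y) (T : forall x, E x -> E x) :
    Prop :=
  forall g x u,
    actE g x (act g x) (T x u) = T (act g x) (actE g x (act g x) u).

Definition clifford_equivariant (R : realType) (G : lie_group R) n
    (X : manifold R n) (act : G -> X -> X) (E : bundle R X)
    (actE : G -> forall x y : X, E x -> E y)
    (cl : forall x, 'rV[R]_n -> E x -> E x) : Prop :=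
  forall g x v u,
    actE g x (act g x) (cl x v u)
    = cl (act g x) (v *m jac (act g) x) (actE g x (act g x) u).

Definition op_equivariant (R : realType) (G : lie_group R) n
    (X : manifold R n) (act : G -> X -> X) (E : bundle R X)
    (actE : G -> forall x y : X, E x -> E y) (D : sec E -> sec E) : Prop :=
  forall g u, smooth_sec u ->
    smooth_sec (act_sec act actE g u) /\
    forall x, D (act_sec act actE g u) x = act_sec act actE g (D u) x.

(* [P] is the space of smooth sections on which D acts (all smooth sections, or
   the even ones); it is dense in the Hilbert space of L^2-sections, with inner
   product <u, v> = [inner u v]. *)

Definition nrm2 (R : realType) (V : Type) (inner : V -> V -> R[i]) (u : V) : R :=
  complex.Re (inner u u).

Definition sec_eq (R : realType) X (E : bundle R X) (u v : sec E) : Prop :=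
  forall x, u x = v x.

(* D - l is invertible, with L^2-bounded inverse. *)
Definition resolvent (R : realType) X (E : bundle R X)
    (inner : sec E -> sec E -> R[i]) (P : set (sec E)) (D : sec E -> sec E)
    (l : R) : Prop :=
  (forall v, P v -> exists u, [/\ P u, sec_eq (fun x => D u x - l%:C *: u x) v
     & forall u', P u' -> sec_eq (fun x => D u' x - l%:C *: u' x) v ->
         sec_eq u' u]) /\
  (exists2 K : R, 0 < K & forall u, P u ->
     nrm2 inner u <= K * nrm2 inner (fun x => D u x - l%:C *: u x)).

(* D is self-adjoint, so only real spectral parameters are considered. *)
Definition spec (R : realType) X (E : bundle R X)
    (inner : sec E -> sec E -> R[i]) (P : set (sec E)) (D : sec E -> sec E) :
    set R := [set l | ~ resolvent inner P D l].

Definition eigenspace (R : realType) X (E : bundle R X) (P : set (sec E))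
    (D : sec E -> sec E) (l : R) : set (sec E) :=
  [set u | P u /\ sec_eq (D u) (fun x => l%:C *: u x)].

(* Trace of T on a finite-dimensional T-invariant space V of sections
   (0 if V is not such a space). *)
Definition fin_trace (R : realType) X (E : bundle R X) (V : set (sec E))
    (T : sec E -> sec E) : R[i] :=
  xget 0 [set t | exists m (b : 'I_m -> sec E) (A : 'M[R[i]]_m),
    [/\ (forall k, V (b k)),
        (forall u, V u -> exists! a : 'rV[R[i]]_m,
           sec_eq u (fun x => \sum_k a 0 k *: b k x)),
        (forall j, sec_eq (T (b j)) (fun x => \sum_k A j k *: b k x))
      & t = \tr A]].

(* Orthonormal basis of L^2, by elements of P. Zero entries are allowed, so that
   finite-dimensional (e.g. zero) spaces are covered as well. *)
Definition onb (R : realType) X (E : bundle R X)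
    (inner : sec E -> sec E -> R[i]) (P : set (sec E)) (e : nat -> sec E) :
    Prop :=
  [/\ (forall j, P (e j)),
      (forall j k, j != k -> inner (e j) (e k) = 0),
      (forall j, inner (e j) (e j) = 1 \/ sec_eq (e j) (fun=> 0))
    & (forall u, P u ->
         (\sum_(0 <= k <oo) (complex.Re (`|inner u (e k)| ^+ 2))%:E
          = (nrm2 inner u)%:E)%E)].

(* Q is the (bounded) operator f(D), where D has an orthonormal basis of
   eigensections: f(D) u = f(l) u for D u = l u. *)
Definition fcalc (R : realType) X (E : bundle R X)
    (inner : sec E -> sec E -> R[i]) (P : set (sec E)) (D : sec E -> sec E)
    (f : R -> R) (Q : sec E -> sec E) : Prop :=
  [/\ (exists e (lam : nat -> R), onb inner P e /\
         forall k, eigenspace P D (lam k) (e k)),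
      (forall u, P u -> P (Q u)),
      (forall (a : R[i]) u v, P u -> P v ->
         sec_eq (Q (fun x => a *: u x + v x)) (fun x => a *: Q u x + Q v x)),
      (exists K : R, forall u, P u -> nrm2 inner (Q u) <= K * nrm2 inner u)
    & (forall l u, eigenspace P D l u -> sec_eq (Q u) (fun x => (f l)%:C *: u x))].

(* Trace class: sum_k |<T e_k, f_k>| < oo for all orthonormal bases. *)
Definition trace_class (R : realType) X (E : bundle R X)
    (inner : sec E -> sec E -> R[i]) (P : set (sec E)) (T : sec E -> sec E) :
    Prop :=
  forall e f, onb inner P e -> onb inner P f ->
    (\sum_(0 <= k <oo) (complex.Re `|inner (T (e k)) (f k)|)%:E < +oo)%E.

Definition has_trace (R : realType) X (E : bundle R X)
    (inner : sec E -> sec E -> R[i]) (P : set (sec E)) (T : sec E -> sec E)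
    (z : R[i]) : Prop :=
  trace_class inner P T /\
  forall e, onb inner P e ->
    series (fun k => complex.Re (inner (T (e k)) (e k))) @ \oo
      --> complex.Re z /\
    series (fun k => complex.Im (inner (T (e k)) (e k))) @ \oo
      --> complex.Im z.

Definition Cintegral (R : realType) (A : set R) (f : R -> R[i]) : R[i] :=
  (Rintegral (lebR R) A (fun s => complex.Re (f s)) +i*
   Rintegral (lebR R) A (fun s => complex.Im (f s)))%C.

Definition Cintegrable (R : realType) (A : set R) (f : R -> R[i]) : Prop :=
  (lebR R).-integrable A (fun s => (complex.Re (f s))%:E) /\
  (lebR R).-integrable A (fun s => (complex.Im (f s))%:E).

Definition Rsum (R : realType) (A : set R) (f : R -> R) : R :=
  fine (\esum_(l in A) (Num.max (f l) 0)%:E) -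
  fine (\esum_(l in A) (Num.max (- f l) 0)%:E).

Definition Csum (R : realType) (A : set R) (f : R -> R[i]) : R[i] :=
  (Rsum A (fun l => complex.Re (f l)) +i*
   Rsum A (fun l => complex.Im (f l)))%C.

Definition Csummable (R : realType) (A : set R) (f : R -> R[i]) : Prop :=
  summable A (fun l => (complex.Re (f l))%:E) /\
  summable A (fun l => (complex.Im (f l))%:E).

(* z = Tr (g D e^{-s D^2}), where T is the action of g on sections. *)
Definition is_heat_trace (R : realType) X (E : bundle R X)
    (inner : sec E -> sec E -> R[i]) (P : set (sec E)) (D T : sec E -> sec E)
    (s : R) (z : R[i]) : Prop :=
  exists Q, [/\ fcalc inner P D (fun l => l * expR (- s * l ^+ 2)) Q,
                trace_class inner P Q & has_trace inner P (T \o Q) z].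

Definition heat_trace (R : realType) X (E : bundle R X)
    (inner : sec E -> sec E -> R[i]) (P : set (sec E)) (D T : sec E -> sec E)
    (s : R) : R[i] :=
  xget 0 [set z | is_heat_trace inner P D T s z].

Definition eta_integrand (R : realType) X (E : bundle R X)
    (inner : sec E -> sec E -> R[i]) (P : set (sec E)) (D T : sec E -> sec E)
    (s : R) : R[i] :=
  heat_trace inner P D T s * ((Num.sqrt s)^-1)%:C.

(* The expression defining the eta-invariant makes sense: the traces exist and
   the integral converges. *)
Definition eta_defined (R : realType) X (E : bundle R X)
    (inner : sec E -> sec E -> R[i]) (P : set (sec E)) (D T : sec E -> sec E) :
    Prop :=
  (forall s : R, 0 < s -> exists z, is_heat_trace inner P D T s z) /\
  Cintegrable `]0, +oo[ (eta_integrand inner P D T).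

Definition eta_invariant (R : realType) X (E : bundle R X)
    (inner : sec E -> sec E -> R[i]) (P : set (sec E)) (D T : sec E -> sec E) :
    R[i] :=
  ((Num.sqrt pi)^-1)%:C * Cintegral `]0, +oo[ (eta_integrand inner P D T).

Definition xi (R : realType) (phi : R -> R) (a x : R) : R :=
  Rintegral (lebR R) `[a, x] (fun x' => expR (phi x')).

(* The inverse of xi : [a, +oo[ -> [0, +oo[. *)
Definition xi_inv (R : realType) (phi : R -> R) (a y : R) : R :=
  xget a [set x | a <= x /\ xi phi a x = y].

Definition qplus (R : realType) (phi : R -> R) (a l y : R) : R :=
  let x := xi_inv phi a y in l * (l + derive1 phi x) * expR (- 2 * phi x).

(* th solves - th'' + q th = nu th on [0, +oo[ with th(0) = 0, th'(0) = 1. *)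
Definition is_theta (R : realType) (q : R -> R) (nu : R) (th : R -> R) : Prop :=
  [/\ {within `[0, +oo[, continuous th},
      (forall y, 0 < y ->
         [/\ derivable th y 1, derivable (derive1 th) y 1
           & - derive1 (derive1 th) y + q y * th y = nu * th y]),
      th 0 = 0
    & derive1 th y @[y --> 0^'+] --> (1 : R)].

Definition L2fun d (T : measurableType d) (R : realType)
    (mu : {measure set T -> \bar R}) (A : set T) (f : T -> R) : Prop :=
  measurable_fun A f /\ (\int[mu]_(x in A) ((f x) ^+ 2)%:E < +oo)%E.

(* rho (taken right-continuous, which does not change d rho) is the spectral
   function: f |-> (nu |-> int_0^oo f th_nu), defined for f of bounded support,
   extends to a unitary isomorphism U : L^2([0, +oo[) -> L^2(R, d rho), whose
   inverse V is integration against th_nu(y) d rho(nu). *)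
Definition is_spectral_function (R : realType) (th : R -> R -> R)
    (rho : cumulative R R) : Prop :=
  let mu : {measure set (measurableTypeR R) -> \bar R} := lebR R in
  let mr : {measure set (measurableTypeR R) -> \bar R} :=
    lebesgue_stieltjes_measure rho in
  let Rp : set R := `[0, +oo[%classic in
  exists (U V : (R -> R) -> R -> R),
    [/\ (forall f, L2fun mu Rp f -> L2fun mr setT (U f) /\
           (\int[mr]_nu ((U f nu) ^+ 2)%:E
            = \int[mu]_(y in Rp) ((f y) ^+ 2)%:E)%E),
        (forall (c : R) f g, L2fun mu Rp f -> L2fun mu Rp g ->
           {ae mr, forall nu, U (fun y => c * f y + g y) nu
                              = c * U f nu + U g nu}),
        (forall f, L2fun mu Rp f -> (exists b, forall y, b < y -> f y = 0) ->
           {ae mr, forall nu,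
              U f nu = Rintegral mu Rp (fun y => f y * th nu y)}),
        (forall k, L2fun mr setT k -> L2fun mu Rp (V k) /\
           {ae mr, forall nu, U (V k) nu = k nu})
      & (forall k, L2fun mr setT k ->
           (exists b, forall nu, b < `|nu| -> k nu = 0) ->
           {ae mu, forall y, Rp y ->
              V k y = Rintegral mr setT (fun nu => k nu * th nu y)})].

Definition cusp_integrand (R : realType) (phi : R -> R) (a a' l s : R)
    (th : R -> R -> R) (nu : R) : R :=
  let y := xi phi a a' in
  expR (- s * nu) * th nu y *
  (derive1 (th nu) y + l * expR (- phi a') * th nu y).

Definition cusp_term (R : realType) X (E : bundle R X) (P : set (sec E))
    (D T : sec E -> sec E) (phi : R -> R) (a a' : R)
    (theta : R -> R -> R -> R) (rho : R -> cumulative R R) (s l : R) : R[i] :=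
  (Num.sg l)%:C * fin_trace (eigenspace P D l) T *
  (Rintegral (lebesgue_stieltjes_measure (rho `|l|)) setT
     (cusp_integrand phi a a' `|l| s (theta `|l|)))%:C.

Definition cusp_sum (R : realType) X (E : bundle R X)
    (inner : sec E -> sec E -> R[i]) (P : set (sec E)) (D T : sec E -> sec E)
    (phi : R -> R) (a a' : R) (theta : R -> R -> R -> R)
    (rho : R -> cumulative R R) (s : R) : R[i] :=
  Csum (spec inner P D) (cusp_term P D T phi a a' theta rho s).

Definition cusp_contribution (R : realType) X (E : bundle R X)
    (inner : sec E -> sec E -> R[i]) (P : set (sec E)) (D T : sec E -> sec E)
    (p : nat) (phi : R -> R) (a a' : R) (theta : R -> R -> R -> R)
    (rho : R -> cumulative R R) : R[i] :=
  (2 * expR (- (p%:R * phi a')))%:C *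
  Cintegral `]0, +oo[ (cusp_sum inner P D T phi a a' theta rho).

Definition cusp_defined (R : realType) X (E : bundle R X)
    (inner : sec E -> sec E -> R[i]) (P : set (sec E)) (D T : sec E -> sec E)
    (phi : R -> R) (a a' : R) (theta : R -> R -> R -> R)
    (rho : R -> cumulative R R) : Prop :=
  (forall s : R, 0 < s ->
     (forall l, spec inner P D l ->
        (lebesgue_stieltjes_measure (rho `|l|)).-integrable setT
          (fun nu => (cusp_integrand phi a a' `|l| s (theta `|l|) nu)%:E)) /\
     Csummable (spec inner P D) (cusp_term P D T phi a a' theta rho s)) /\
  Cintegrable `]0, +oo[ (cusp_sum inner P D T phi a a' theta rho).

(* w is the derivative at x of a curve u in the Hermitian space (V, h). *)
Definition is_vderive (R : realType) (V : lmodType R[i]) (h : V -> V -> R[i])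
    (u : R -> V) (x : R) (w : V) : Prop :=
  forall v, is_derive x 1 (fun t => complex.Re (h (u t) v)) (complex.Re (h w v))
         /\ is_derive x 1 (fun t => complex.Im (h (u t) v)) (complex.Im (h w v)).

(* Z has smooth boundary: locally Z = {f <= 0} with df <> 0. *)
Definition smooth_boundary (R : realType) n (X : manifold R n) (Z : set X) :
    Prop :=
  forall z, (Z `\` Z°) z -> exists (U : set X) (f : X -> R),
    [/\ open U, U z, smooth_fun U f, dfun f z != 0
      & U `&` Z = U `&` [set x | f x <= 0]].

Definition is_embedding (R : realType) n m (Y : manifold R n)
    (X : manifold R m) (i : Y -> X) : Prop :=
  [/\ smooth_map i, injective i, (forall y, row_free (jac i y))
    & (forall V : set Y, open V -> exists2 W : set X, open W & V = i @^-1` W)].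

(* M = ceM with metric ceB, G = ceG acting by ce_act, S = ceS with Hermitian
   metric ce_h, grading ce_eps, Clifford action ce_cl and G-action ce_actS.
   N = ceN is the boundary of Z = ceZ, embedded by ce_i.
   ce_Psi n x, for x > a = ce_a, is the point of M \ Z at (n, x) in N x ]a, +oo[
   (its values for x < a are junk), and ce_tau n x : S_(Psi n x) -> S_(i n) is
   the isomorphism from S on M \ Z to S|_N x ]a, +oo[.
   The fields from ceSN to ce_actSN are S|_N with the structures restricted
   from S; ceSN_bundle, ce_hNP, ce_epsNP are consequences of the previous
   fields, stated for convenience. In ceD_cyl, w is the x-derivative at (n, x)
   of the section of S|_N x ]a, +oo[ corresponding to U. *)
Record cylindrical_end (R : realType) (p : nat) := CylindricalEnd {
  ceM : manifold R p;
  ceB : ceM -> 'M[R]_p;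
  ceB_metric : is_metric ceB;
  ceB_complete : complete_metric ceB;
  ce_vol : (ceM -> R) -> R;
  ce_volP : is_volume ceB ce_vol;
  ceG : lie_group R;
  ceG_compact : compact [set: ceG];
  ce_act : ceG -> ceM -> ceM;
  ce_actP : is_action ce_act;
  ce_act_isom : forall g, is_isometric ceB ceB (ce_act g);
  ceS : bundle R ceM;
  ceS_bundle : is_bundle ceS;
  ce_h : forall x, ceS x -> ceS x -> R[i];
  ce_hP : is_hermitian ce_h;
  ce_eps : forall x, ceS x -> ceS x;
  ce_epsP : is_grading ce_h ce_eps;
  ce_cl : forall x, 'rV[R]_p -> ceS x -> ceS x;
  ce_clP : is_clifford ceB ce_h ce_cl;
  ce_cl_odd : forall x v u, ce_cl v (ce_eps u) = - @ce_eps x (ce_cl v u);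
  ce_actS : ceG -> forall x y, ceS x -> ceS y;
  ce_actSP : is_bundle_action ce_act ce_actS ce_h;
  ce_eps_equiv : map_equivariant ce_act ce_actS ce_eps;
  ce_cl_equiv : clifford_equivariant ce_act ce_actS ce_cl;
  ceD : sec ceS -> sec ceS;
  ceD_dirac : is_dirac ceB ce_vol ce_h ce_cl ceD;
  ceD_odd : forall u : sec ceS, smooth_sec u -> forall x,
    ceD (fun y => ce_eps (u y)) x = - ce_eps (ceD u x);
  ceD_equiv : op_equivariant ce_act ce_actS ceD;
  ceZ : set ceM;
  ceZ_compact : compact ceZ;
  ceZ_inv : forall g x, ceZ x -> ceZ (ce_act g x);
  ceZ_smooth : smooth_boundary ceZ;
  ceN : manifold R p.-1;
  ce_i : ceN -> ceM;
  ce_i_embedding : is_embedding ce_i;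
  ce_i_boundary : range ce_i = ceZ `\` ceZ°;
  ceBN : ceN -> 'M[R]_p.-1;
  ceBN_metric : is_metric ceBN;
  ceBN_restr : is_isometric ceBN ceB ce_i;
  ce_volN : (ceN -> R) -> R;
  ce_volNP : is_volume ceBN ce_volN;
  ce_actN : ceG -> ceN -> ceN;
  ce_actNP : forall g n, ce_i (ce_actN g n) = ce_act g (ce_i n);
  ce_a : R;
  ce_a_ge0 : 0 <= ce_a;
  ce_Psi : ceN -> R -> ceM;
  ce_Psi_smooth : smooth_cyl_map ce_a ce_Psi;
  ce_Psi_inj : forall n x n' x', ce_a < x -> ce_a < x' ->
    ce_Psi n x = ce_Psi n' x' -> n = n' /\ x = x';
  ce_Psi_range : forall m, ~ ceZ m <-> exists n x, ce_a < x /\ ce_Psi n x = m;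
  ce_Psi_isom : forall n x, ce_a < x ->
    let J := col_mx (jac (ce_Psi^~ x) n) (velocity (ce_Psi n) x) in
    J *m ceB (ce_Psi n x) *m J^T = block_mx (ceBN n) 0 0 (1%:M : 'M[R]_1);
  ce_Psi_equiv : forall g n x, ce_a < x ->
    ce_Psi (ce_actN g n) x = ce_act g (ce_Psi n x);
  ce_Psi_cont : {within [set nx : ceN * R | ce_a <= nx.2],
    continuous (fun nx => ce_Psi nx.1 nx.2)};
  ce_Psi_boundary : forall n, ce_Psi n ce_a = ce_i n;
  ce_tau : forall n x, ceS (ce_Psi n x) -> ceS (ce_i n);
  ce_tau_linear : forall n x, ce_a < x -> linear_op (@ce_tau n x);
  ce_tau_bij : forall n x, ce_a < x -> bijective (@ce_tau n x);
  ce_tau_isom : forall n x u v, ce_a < x ->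
    ce_h (@ce_tau n x u) (@ce_tau n x v) = ce_h u v;
  ce_tau_eps : forall n x u, ce_a < x ->
    @ce_tau n x (ce_eps u) = ce_eps (@ce_tau n x u);
  ce_tau_equiv : forall g n x u, ce_a < x ->
    ce_tau (@ce_actS g (ce_Psi n x) (ce_Psi (ce_actN g n) x) u)
    = @ce_actS g (ce_i n) (ce_i (ce_actN g n)) (@ce_tau n x u);
  ce_tau_smooth : forall (U : sec ceS) (u : sec (pullback ce_i ceS)),
    smooth_sec U -> smooth_sec u ->
    let f n x := ce_h (@ce_tau n x (U (ce_Psi n x))) (u n) in
    smooth_cyl ce_a setT (fun n x => complex.Re (f n x)) /\
    smooth_cyl ce_a setT (fun n x => complex.Im (f n x));
  ceSN := pullback ce_i ceS;
  ce_hN : forall n, ceSN n -> ceSN n -> R[i] := fun n => @ce_h (ce_i n);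
  ce_epsN : forall n, ceSN n -> ceSN n := fun n => @ce_eps (ce_i n);
  ce_actSN : ceG -> forall n n', ceSN n -> ceSN n' :=
    fun g n n' => @ce_actS g (ce_i n) (ce_i n');
  ceSN_bundle : is_bundle ceSN;
  ce_hNP : is_hermitian ce_hN;
  ce_epsNP : is_grading ce_hN ce_epsN;
  ce_clN : forall n, 'rV[R]_p.-1 -> ceSN n -> ceSN n;
  ce_clNP : is_clifford ceBN ce_hN ce_clN;
  ceDN : sec ceSN -> sec ceSN;
  ceDN_dirac : is_dirac ceBN ce_volN ce_hN ce_clN ceDN;
  ceDN_even : forall u : sec ceSN, smooth_sec u -> forall n,
    ceDN (fun n' => ce_epsN (u n')) n = ce_epsN (ceDN u n);
  ceDN_equiv : op_equivariant ce_actN ce_actSN ceDN;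
  ce_sigma : forall n, ceSN n -> ceSN n;
  ce_sigma_map : bundle_map ce_sigma;
  ce_sigma_isom : forall n u v,
    ce_hN (@ce_sigma n u) (@ce_sigma n v) = ce_hN u v;
  ce_sigma_odd : forall n u,
    @ce_sigma n (ce_epsN u) = - ce_epsN (@ce_sigma n u);
  ce_sigma_equiv : map_equivariant ce_actN ce_actSN ce_sigma;
  ce_sigma_anti : forall u : sec ceSN, smooth_sec u -> forall n,
    ceDN (fun n' => ce_sigma (u n')) n = - ce_sigma (ceDN u n);
  ceD_cyl : forall U : sec ceS, smooth_sec U -> forall n x, ce_a < x ->
    exists w : ceSN n,
      is_vderive (@ce_hN n) (fun t => @ce_tau n t (U (ce_Psi n t))) x w /\
      ce_tau (ceD U (ce_Psi n x))
      = ce_sigma (w + ceDN (fun n' => @ce_tau n' x (U (ce_Psi n' x))) n);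
  ce_inner : sec ceSN -> sec ceSN -> R[i] :=
    fun u v => cvol ce_volN (fun n => ce_hN (u n) (v n));
  ceDN_inv : resolvent ce_inner (@smooth_sec R _ ceN ceSN) ceDN 0
}.

(* Smooth sections of S^+|_N, on which D_N^+ acts. *)
Definition even_sec (R : realType) p (X : cylindrical_end R p) :
    set (sec (ceSN X)) :=
  [set u | smooth_sec u /\ forall n, ce_epsN (u n) = u n].

Definition g_act (R : realType) p (X : cylindrical_end R p) (g : ceG X) :
    sec (ceSN X) -> sec (ceSN X) := act_sec (@ce_actN R p X) (@ce_actSN R p X) g.

Definition specDNp (R : realType) p (X : cylindrical_end R p) : set R :=
  spec (@ce_inner R p X) (@even_sec R p X) (@ceDN R p X).

Definition eta_DNp (R : realType) p (X : cylindrical_end R p) (g : ceG X) :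
    R[i] :=
  eta_invariant (@ce_inner R p X) (@even_sec R p X) (@ceDN R p X) (g_act g).

Definition eta_DNp_defined (R : realType) p (X : cylindrical_end R p)
    (g : ceG X) : Prop :=
  eta_defined (@ce_inner R p X) (@even_sec R p X) (@ceDN R p X) (g_act g).

Definition cusp_DNp (R : realType) p (X : cylindrical_end R p) (phi : R -> R)
    (theta : R -> R -> R -> R) (rho : R -> cumulative R R) (g : ceG X)
    (a' : R) : R[i] :=
  cusp_contribution (@ce_inner R p X) (@even_sec R p X) (@ceDN R p X)
    (g_act g) p phi (ce_a X) a' theta rho.

Definition cusp_DNp_defined (R : realType) p (X : cylindrical_end R p)
    (phi : R -> R) (theta : R -> R -> R -> R) (rho : R -> cumulative R R)
    (g : ceG X) (a' : R) : Prop :=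
  cusp_defined (@ce_inner R p X) (@even_sec R p X) (@ceDN R p X)
    (g_act g) phi (ce_a X) a' theta rho.

(* Main.v *)
(* The eigenvalues of D_N^+ are bounded away from 0 because D_N is invertible.  For
   phi = 0 and a fixed eigenvalue, theta_nu(y) and its derivative are
   sinh(sqrt c y) / sqrt c and cosh(sqrt c y) with c = l^2 - nu.  Up to a factor
   depending only on nu, they are the spectral transforms of odd reflections of
   Gaussians, so the rho-integral follows from the Parseval identity:
     e^(-s l^2) / (2 sqrt(pi s)) *
       (l (1 - e^(-y^2/s)) + (y/s) e^(-y^2/s)),  where y = a' - a.
   Summing over an orthonormal eigenbasis, with H(s) = Tr(g D e^(-s D^2)) and
   A(s) = Tr(g sgn(D) e^(-s D^2)), the integrand of the cusp contribution is
     (H(s) (1 - e^(-y^2/s)) + (y/s) e^(-y^2/s) A(s)) / (2 sqrt(pi s)).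
   The terms with e^(-y^2/s) cancel after integration: by subordination,
   sqrt(pi) A(s) = int_s^oo H(r) (r - s)^(-1/2) dr, and Fubini's theorem together
   with the integral over ]0, r[ of y s^(-3/2) e^(-y^2/s) (r - s)^(-1/2), which is
   sqrt(pi / r) e^(-y^2/r), gives
     int y s^(-3/2) e^(-y^2/s) A(s) ds = int H(r) r^(-1/2) e^(-y^2/r) dr. *)
Require Import Defs.
From HB Require Import structures.
From mathcomp Require Import all_boot all_order all_algebra.
From mathcomp Require Import complex ring lra.
From mathcomp Require Import all_classical all_reals all_analysis.
From mathcomp Require Import measurable_realfun.

Set Implicit Arguments.
Unset Strict Implicit.
Unset Printing Implicit Defensive.

Import Order.TTheory GRing.Theory Num.Theory.
Import numFieldNormedType.Exports.

Local Open Scope classical_set_scope.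
Local Open Scope ring_scope.

(** For a single eigenvalue l, both invariants equal sgn(l) times the trace of g on its eigenspace,
    and these numbers need not be summable over the spectrum. Only the integral of the summed trace
    H is assumed to converge, so the cancellation cannot be carried out eigenvalue by eigenvalue: it
    takes place between functions of s, and integrability of H(r) r^(-1/2) has to suffice. It does,
    because the kernel of the double integral is nonnegative and its s-integral is at most sqrt(pi /
    r). The trace A(s) is not part of the data either; its series converges absolutely because |l|
    >= c trades the missing factor |l| for 1/c. The measure d rho is never computed. It enters
    through the isometry, the linearity and the integral formula of the transform, and these
    determine the pairing of any two transforms. Since the formula is given only for functions of
    bounded support, it has to be extended to Gaussians before Parseval applies. The existence of an
    orthonormal eigenbasis comes from the assumption that the heat traces exist. *)

Section integrable_real.
Context d (T : measurableType d) (R : realType) (m : {measure set T -> \bar R}).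
Context (A : set T) (mA : measurable A).
Implicit Types f g : T -> R.

Lemma integrable_addr f g : m.-integrable A (EFin \o f) ->
  m.-integrable A (EFin \o g) ->
  m.-integrable A (EFin \o (fun x => f x + g x)).
Proof. by move=> i1 i2; have := integrableD mA i1 i2. Qed.

Lemma integrable_subr f g : m.-integrable A (EFin \o f) ->
  m.-integrable A (EFin \o g) ->
  m.-integrable A (EFin \o (fun x => f x - g x)).
Proof. by move=> i1 i2; have := integrableB mA i1 i2. Qed.

Lemma integrable_mulr k f : m.-integrable A (EFin \o f) ->
  m.-integrable A (EFin \o (fun x => k * f x)).
Proof. by move=> i1; have := integrableZl mA k i1. Qed.

End integrable_real.

(** Meant for p, q, r the squares of f + g, f, g, where the combination is f g. *)
Lemma Rintegral_polarization d (T : measurableType d) (R : realType)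
    (m : {measure set T -> \bar R}) (A : set T) (p q r : T -> R) :
  measurable A -> m.-integrable A (EFin \o p) ->
  m.-integrable A (EFin \o q) -> m.-integrable A (EFin \o r) ->
  m.-integrable A (EFin \o (fun x => 2^-1 * (p x - q x - r x))) /\
  Rintegral m A (fun x => 2^-1 * (p x - q x - r x)) =
  2^-1 * (Rintegral m A p - Rintegral m A q - Rintegral m A r).
Proof.
move=> mA ip iq ir.
have ipq := integrable_subr mA ip iq.
have ipqr := integrable_subr mA ipq ir.
split; first exact: integrable_mulr.
by rewrite RintegralZl// RintegralB// RintegralB.
Qed.

Lemma measurable_invr {R : realType} : measurable_fun setT (fun x : R => x^-1).
Proof.
(* Squaring makes the base of the real power nonnegative; at 0 both sides are 0 by convention. *)
have -> : (fun x : R => x^-1) = (fun x => x * (x ^+ 2) `^ (- 1)).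
  apply/funext => x; rewrite powR_inv1 ?sqr_ge0//.
  by have [->|x0] := eqVneq x 0; [rewrite mul0r invr0|field].
apply: measurable_funM => //.
by apply: (measurableT_comp (measurable_powR (- 1))); exact: measurable_funX.
Qed.

(** * Solutions of f'' = c f *)

Section fundamental_solutions.
Context {R : realType}.
Implicit Types c x y u : R.

(* cosh (sqrt c x) and sinh (sqrt c x) / sqrt c, continued to c <= 0. *)
Definition fsol_cos c x : R :=
  if 0 < c then (expR (Num.sqrt c * x) + expR (- (Num.sqrt c * x))) / 2
  else cos (Num.sqrt (- c) * x).

Definition fsol_sin c x : R :=
  if 0 < c
  then (expR (Num.sqrt c * x) - expR (- (Num.sqrt c * x))) / (2 * Num.sqrt c)
  else if c < 0 then sin (Num.sqrt (- c) * x) / Num.sqrt (- c) else x.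

Lemma fsol_cos0 c : fsol_cos c 0 = 1.
Proof.
rewrite /fsol_cos !mulr0 oppr0 expR0 cos0; case: ifP => // _.
by field.
Qed.

Lemma fsol_sin0 c : fsol_sin c 0 = 0.
Proof.
by rewrite /fsol_sin !mulr0 oppr0 expR0 subrr sin0 !mul0r; do 2?case: ifP.
Qed.

Lemma fsol_cosN c x : fsol_cos c (- x) = fsol_cos c x.
Proof. by rewrite /fsol_cos !mulrN opprK cosN addrC. Qed.

Lemma fsol_sinN c x : fsol_sin c (- x) = - fsol_sin c x.
Proof.
rewrite /fsol_sin !mulrN opprK sinN; case: ifP => _; first by rewrite -opprB mulNr.
by case: ifP => // _; rewrite mulNr.
Qed.

Lemma is_derive_fsol_sin c x : is_derive x 1 (fsol_sin c) (fsol_cos c x).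
Proof.
rewrite /fsol_sin /fsol_cos; case: ifPn => [c0|c0].
  have s0 : Num.sqrt c != 0 by rewrite sqrtr_eq0 -ltNge.
  apply: is_derive_eq; rewrite /GRing.scale /=; field.
  by rewrite s0.
have [c0'|c0'] := ltP c 0.
  have s0 : Num.sqrt (- c) != 0 by rewrite sqrtr_eq0 -ltNge oppr_gt0.
  apply: is_derive_eq; rewrite /GRing.scale /=; field.
  by rewrite s0.
have -> : c = 0 by apply/eqP; rewrite eq_le leNgt c0 c0'.
by rewrite oppr0 sqrtr0 mul0r cos0; exact: is_derive_id.
Qed.

Lemma is_derive_fsol_cos c x : is_derive x 1 (fsol_cos c) (c * fsol_sin c x).
Proof.
rewrite /fsol_sin /fsol_cos; case: ifPn => [c0|c0].
  have s0 : Num.sqrt c != 0 by rewrite sqrtr_eq0 -ltNge.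
  have ss : c = Num.sqrt c ^+ 2 by rewrite sqr_sqrtr// ltW.
  move: (Num.sqrt c) s0 ss => s s0 ->.
  by apply: is_derive_eq; rewrite /GRing.scale /=; field.
have [c0'|c0'] := ltP c 0.
  have s0 : Num.sqrt (- c) != 0 by rewrite sqrtr_eq0 -ltNge oppr_gt0.
  have ss : c = - Num.sqrt (- c) ^+ 2 by rewrite sqr_sqrtr ?opprK// oppr_ge0 ltW.
  move: (Num.sqrt (- c)) s0 ss => s s0 ->.
  by apply: is_derive_eq; rewrite /GRing.scale /=; field.
have -> : c = 0 by apply/eqP; rewrite eq_le leNgt c0 c0'.
rewrite oppr0 sqrtr0 mul0r.
have -> : (fun x : R => cos (0 * x)) = cst 1.
  by apply/funext => z; rewrite mul0r cos0.
exact: is_derive_cst.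
Qed.

(** The addition law separates the source point y from the integration variable once a shifted
    Gaussian has been recentred. *)
Lemma fsol_sinB c y u :
  fsol_sin c (y - u) = fsol_sin c y * fsol_cos c u - fsol_cos c y * fsol_sin c u.
Proof.
rewrite /fsol_sin /fsol_cos; case: ifPn => [c0|c0].
  have s0 : Num.sqrt c != 0 by rewrite sqrtr_eq0 -ltNge.
  rewrite mulrBr opprB [_ - Num.sqrt c * y]addrC !expRD; field.
  by rewrite s0.
have [c0'|c0'] := ltP c 0.
  have s0 : Num.sqrt (- c) != 0 by rewrite sqrtr_eq0 -ltNge oppr_gt0.
  rewrite mulrBr sinB; field.
  by rewrite s0.
have -> : c = 0 by apply/eqP; rewrite eq_le leNgt c0 c0'.
by rewrite oppr0 sqrtr0 !mul0r cos0 mulr1 mul1r.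
Qed.

(** The Wronskian of the fundamental pair, which is constant and equals 1 at 0. *)
Lemma fsol_cos2Bsin2 c x : fsol_cos c x ^+ 2 - c * fsol_sin c x ^+ 2 = 1.
Proof.
rewrite /fsol_sin /fsol_cos; case: ifPn => [c0|c0].
  have s0 : Num.sqrt c != 0 by rewrite sqrtr_eq0 -ltNge.
  have ss : c = Num.sqrt c ^+ 2 by rewrite sqr_sqrtr// ltW.
  move: (Num.sqrt c) s0 ss => s s0 ->.
  by rewrite -[RHS](expRxMexpNx_1 (s * x)); field.
have [c0'|c0'] := ltP c 0.
  have s0 : Num.sqrt (- c) != 0 by rewrite sqrtr_eq0 -ltNge oppr_gt0.
  have ss : c = - Num.sqrt (- c) ^+ 2 by rewrite sqr_sqrtr ?opprK// oppr_ge0 ltW.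
  move: (Num.sqrt (- c)) s0 ss => s s0 ->.
  by rewrite -[RHS](cos2Dsin2 (s * x)); field.
have -> : c = 0 by apply/eqP; rewrite eq_le leNgt c0 c0'.
by rewrite oppr0 sqrtr0 !mul0r cos0 subr0 expr1n.
Qed.

Lemma continuous_fsol_sin c : continuous (fsol_sin c).
Proof.
move=> x; apply/differentiable_continuous/derivable1_diffP.
by have [] := is_derive_fsol_sin c x.
Qed.

Lemma continuous_fsol_cos c : continuous (fsol_cos c).
Proof.
move=> x; apply/differentiable_continuous/derivable1_diffP.
by have [] := is_derive_fsol_cos c x.
Qed.

Let measurable_sqrtM x : measurable_fun setT (fun c : R => Num.sqrt c * x).
Proof.
apply: measurable_funM => //.
by apply: continuous_measurable_fun; exact: sqrt_continuous.
Qed.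

Let measurable_sqrtNM x : measurable_fun setT (fun c : R => Num.sqrt (- c) * x).
Proof.
by apply: (measurableT_comp (measurable_sqrtM x)).
Qed.

(** Measurability is in the parameter, because c = l^2 - nu carries the spectral variable. *)
Lemma measurable_fsol_cos x : measurable_fun setT (fsol_cos^~ x).
Proof.
have mlt : measurable_fun setT (fun c : R => 0 < c) by exact: measurable_fun_ltr.
apply: measurable_fun_ifT => //.
- apply: measurable_funM => //; apply: measurable_funD;
    apply: measurableT_comp => //.
  by apply: measurableT_comp.
- apply: measurableT_comp => //.
  by apply: continuous_measurable_fun; exact: continuous_cos.
Qed.

Lemma measurable_fsol_sin x : measurable_fun setT (fsol_sin^~ x).
Proof.
have mlt : measurable_fun setT (fun c : R => 0 < c) by exact: measurable_fun_ltr.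
have mlt' : measurable_fun setT (fun c : R => c < 0) by exact: measurable_fun_ltr.
have msqrt : measurable_fun setT (@Num.sqrt R).
  by apply: continuous_measurable_fun; exact: sqrt_continuous.
apply: measurable_fun_ifT => //.
- apply: measurable_funM => //.
    by apply: measurable_funB; do 2?apply: measurableT_comp.
  by apply: (measurableT_comp measurable_invr); exact: measurable_funM.
- apply: measurable_fun_ifT => //; apply: measurable_funM => //.
    apply: measurableT_comp => //.
    by apply: continuous_measurable_fun; exact: continuous_sin.
  by apply: (measurableT_comp measurable_invr); apply: measurableT_comp.
Qed.

End fundamental_solutions.

Lemma derive0_constant_oo {R : realType} (f : R -> R) (a : R) :
  (forall x, a < x -> is_derive x 1 f 0) ->
  forall x y, a < x -> a < y -> f x = f y.
Proof.
move=> df.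
suff main x y : a < x -> x < y -> f x = f y.
  move=> x y ax ay; have [xy|xy|->//] := ltgtP x y; first exact: main.
  by apply/esym/main.
move=> ax xy.
have [z _ h] : exists2 z, z \in `]x, y[%R & f y - f x = 0 * (y - x).
  apply: (@MVT _ f (fun=> 0)) => //.
    by move=> z; rewrite in_itv/= => /andP[xz _]; apply: df; exact: lt_trans xz.
  apply: derivable_within_continuous => z; rewrite in_itv/= => /andP[xz _].
  by have [] := df z (lt_le_trans ax xz).
by apply/esym/eqP; rewrite -subr_eq0 h mul0r.
Qed.

(** Uniqueness through Wronskians: w1 and w2 have zero derivative on ]0, +oo[, and as the initial
    data are only right limits at 0, their constant values 0 and 1 are found as limits at 0+.
    Writing C, S for the fundamental pair, C^2 - c S^2 = 1 inverts the relations: th = C w1 + S w2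
    and th' = C w2 + c S w1. *)
Lemma is_theta_fsol {R : realType} (c nu l : R) (q th : R -> R) :
  (forall y, q y = l) -> c = l - nu -> is_theta q nu th ->
  (forall y : R, 0 <= y -> th y = fsol_sin c y) /\
  (forall y : R, 0 < y -> derive1 th y = fsol_cos c y).
Proof.
move=> ql cE [cth ode th0 dth0].
have dth (y : R) : 0 < y -> is_derive y 1 th (derive1 th y).
  by move=> y0; have [d _ _] := ode _ y0; rewrite derive1E; exact: derivableP.
have ddth (y : R) : 0 < y -> is_derive y 1 (derive1 th) (c * th y).
  move=> y0; have [_ d e] := ode _ y0.
  apply: DeriveDef => //; rewrite -derive1E.
  by rewrite cE mulrBl -e ql; ring.
pose w1 := fun y => th y * fsol_cos c y - derive1 th y * fsol_sin c y.
pose w2 := fun y => derive1 th y * fsol_cos c y - c * th y * fsol_sin c y.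
have dw1 (y : R) : 0 < y -> is_derive y 1 w1 0.
  move=> y0; have := dth y y0; have := ddth y y0 => d1 d2.
  have := is_derive_fsol_cos c y; have := is_derive_fsol_sin c y => d3 d4.
  rewrite /w1; apply: is_derive_eq; rewrite /GRing.scale/=; ring.
have dw2 (y : R) : 0 < y -> is_derive y 1 w2 0.
  move=> y0; have := dth y y0; have := ddth y y0 => d1 d2.
  have := is_derive_fsol_cos c y; have := is_derive_fsol_sin c y => d3 d4.
  rewrite /w2; apply: is_derive_eq; rewrite /GRing.scale/=; ring.
have thc : th y @[y --> 0^'+] --> (0 : R).
  move/continuous_within_itvcyP : cth => [_]; by rewrite th0.
have cosc : fsol_cos c y @[y --> 0^'+] --> (1 : R).
  apply: cvg_at_right_filter; rewrite -[X in _ --> X](fsol_cos0 c).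
  exact: continuous_fsol_cos.
have sinc : fsol_sin c y @[y --> 0^'+] --> (0 : R).
  apply: cvg_at_right_filter; rewrite -[X in _ --> X](fsol_sin0 c).
  exact: continuous_fsol_sin.
have w1c : w1 y @[y --> 0^'+] --> (0 : R).
  rewrite [X in _ --> X](_ : _ = 0 * 1 - 1 * 0); last ring.
  by apply: cvgB; apply: cvgM.
have w2c : w2 y @[y --> 0^'+] --> (1 : R).
  rewrite [X in _ --> X](_ : _ = 1 * 1 - c * 0 * 0); last ring.
  by apply: cvgB; apply: cvgM => //; apply: cvgM => //; exact: cvg_cst.
have cst_lim (w : R -> R) k : (forall y : R, 0 < y -> is_derive y 1 w 0) ->
    w y @[y --> 0^'+] --> k -> forall y : R, 0 < y -> w y = k.
  move=> dw wk y y0; apply: cvg_unique wk => //.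
  apply: cvg_near_cst; near=> z.
  by apply: (derive0_constant_oo dw).
have w1E := cst_lim _ _ dw1 w1c.
have w2E := cst_lim _ _ dw2 w2c.
have thE (y : R) : 0 < y -> th y = fsol_sin c y.
  move=> y0; have := w1E _ y0; have := w2E _ y0; rewrite /w1 /w2 => e2 e1.
  rewrite -[LHS]mulr1 -(fsol_cos2Bsin2 c y) -[RHS]mulr1 -[in RHS]e2.
  rewrite -[LHS]subr0 -(mulr0 (fsol_cos c y)) -e1; ring.
split=> y y0.
  by move: y0; rewrite le_eqVlt => /predU1P[<-|/thE//]; rewrite th0 fsol_sin0.
have := w1E _ y0; have := w2E _ y0; rewrite /w1 /w2 => e2 e1.
rewrite -[LHS]mulr1 -(fsol_cos2Bsin2 c y) -[RHS]mulr1 -[in RHS]e2.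
rewrite -[LHS]subr0 -(mulr0 (c * fsol_sin c y)) -e1; ring.
Unshelve. all: by end_near. Qed.

(** * Gaussian integrals *)

Section subexponential.
Context {R : realType}.
Implicit Types (f g h : R -> R) (e x y : R).

(** Growth of order exp(M |x|) is allowed. The class is closed under sums, products and rescaling,
    contains both fundamental solutions, and is beaten by every Gaussian, so a single integrability
    lemma serves all integrands below. *)
Definition subexp h := continuous h /\
  exists A M : R, [/\ 0 <= A, 0 <= M & forall x, `|h x| <= A * expR (M * `|x|)].

Lemma subexp_cst k : subexp (cst k).
Proof.
split; first exact: cst_continuous.
exists `|k|, 0; split => // x.
by rewrite mul0r expR0 mulr1.
Qed.

Lemma subexp_id : subexp id.
Proof.
split=> [x|]; first exact: cvg_id.
exists 1, 1; split => // x; rewrite !mul1r.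
by rewrite (le_trans _ (expR_ge1Dx _))// lerDr.
Qed.

Lemma subexp_norm h : subexp h -> subexp (fun x => `|h x|).
Proof.
move=> [ch [A [M [A0 M0 hAM]]]]; split.
  by move=> x; apply: (@cvg_norm _ R); exact: ch.
by exists A, M; split => // x; rewrite normr_id.
Qed.

Lemma subexpD g h : subexp g -> subexp h -> subexp (fun x => g x + h x).
Proof.
move=> [cg [A [M [A0 M0 gAM]]]] [ch [B [N [B0 N0 hBN]]]]; split.
  by move=> x; apply: cvgD; [exact: cg|exact: ch].
exists (A + B), (M + N); split; [exact: addr_ge0..|] => x.
rewrite (le_trans (ler_normD _ _))// mulrDl lerD//.
  by rewrite (le_trans (gAM x))// ler_wpM2l// ler_expR ler_wpM2r// lerDl.
by rewrite (le_trans (hBN x))// ler_wpM2l// ler_expR ler_wpM2r// lerDr.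
Qed.

Lemma subexpM g h : subexp g -> subexp h -> subexp (fun x => g x * h x).
Proof.
move=> [cg [A [M [A0 M0 gAM]]]] [ch [B [N [B0 N0 hBN]]]]; split.
  by move=> x; apply: cvgM; [exact: cg|exact: ch].
exists (A * B), (M + N); split; [exact: mulr_ge0|exact: addr_ge0|] => x.
rewrite normrM mulrDl expRD mulrACA.
by apply: ler_pM.
Qed.

Lemma subexpZ k h : subexp h -> subexp (fun x => k * h x).
Proof. by move=> sh; apply: subexpM => //; exact: subexp_cst. Qed.

Lemma subexpB g h : subexp g -> subexp h -> subexp (fun x => g x - h x).
Proof.
move=> sg sh; under eq_fun do rewrite -mulN1r.
by apply: subexpD => //; exact: subexpZ.
Qed.

Lemma subexp_scale k h : subexp h -> subexp (fun x => h (k * x)).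
Proof.
move=> [ch [A [M [A0 M0 hAM]]]]; split.
  move=> x; apply: (continuous_comp _ (ch _)).
  by apply: cvgM; [exact: cvg_cst|exact: cvg_id].
exists A, (M * `|k|); split => //; first exact: mulr_ge0.
by move=> x; rewrite -mulrA -normrM.
Qed.

Lemma subexp_expR k : subexp (fun x => expR (k * x)).
Proof.
split.
  move=> x; apply: (continuous_comp _ (@continuous_expR _ _)).
  by apply: cvgM; [exact: cvg_cst|exact: cvg_id].
exists 1, `|k|; split => // x.
by rewrite mul1r ger0_norm ?expR_ge0// ler_expR -normrM ler_norm.
Qed.

Lemma subexp_fsol_cos c : subexp (fsol_cos c).
Proof.
rewrite /fsol_cos; have [_|_] := ltP 0 c.
  have -> : (fun x => (expR (Num.sqrt c * x) + expR (- (Num.sqrt c * x))) / 2) =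
     (fun x => 2^-1 * (expR (Num.sqrt c * x) + expR (- Num.sqrt c * x))).
    by apply/funext => x; rewrite mulNr mulrC.
  by apply: subexpZ; apply: subexpD; exact: subexp_expR.
apply: (@subexp_scale _ cos); split; first exact: continuous_cos.
exists 1, 0; split=> // x; rewrite mul0r expR0 mul1r.
by rewrite ler_norml cos_geN1 cos_le1.
Qed.

Lemma subexp_fsol_sin c : subexp (fsol_sin c).
Proof.
rewrite /fsol_sin; have [_|_] := ltP 0 c.
  set k := (2 * _).
  have -> : (fun x => (expR (Num.sqrt c * x) - expR (- (Num.sqrt c * x))) / k) =
     (fun x => k^-1 * (expR (Num.sqrt c * x) - expR (- Num.sqrt c * x))).
    by apply/funext => x; rewrite mulNr mulrC.
  by apply: subexpZ; apply: subexpB; exact: subexp_expR.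
have [_|_] := ltP c 0; last exact: subexp_id.
under eq_fun do rewrite mulrC.
apply: subexpZ.
apply: (@subexp_scale _ sin); split; first exact: continuous_sin.
exists 1, 0; split=> // x; rewrite mul0r expR0 mul1r.
by rewrite ler_norml sin_geN1 sin_le1.
Qed.

End subexponential.

Section gaussian_integrals.
Context {R : realType}.
Implicit Types (f g h : R -> R) (e x y : R).
Let mu := @lebesgue_measure R.

Definition gaussian e x : R := expR (- (e * x ^+ 2)).

Lemma gaussian_ge0 e x : 0 <= gaussian e x. Proof. exact: expR_ge0. Qed.

Lemma gaussianN e x : gaussian e (- x) = gaussian e x.
Proof. by rewrite /gaussian sqrrN. Qed.

Lemma is_derive_gaussian e x :
  is_derive x 1 (gaussian e) (- (2 * e * x) * gaussian e x).
Proof.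
rewrite /gaussian; apply: is_derive_eq; rewrite /GRing.scale/=; ring.
Qed.

Lemma continuous_gaussian e : continuous (gaussian e).
Proof.
move=> x; apply/differentiable_continuous/derivable1_diffP.
by have [] := is_derive_gaussian e x.
Qed.

(** Reduction to the normal density of variance 1 / (2 e), whose total mass is known. *)
Let gaussian_pdf m e x : 0 < e -> gaussian e (x - m) =
  Num.sqrt (pi / e) * normal_pdf m (Num.sqrt (2 * e)^-1) x.
Proof.
move=> e0; have e20 : 0 < (2 * e)^-1 by rewrite invr_gt0 mulr_gt0.
rewrite normal_pdfE; last by rewrite sqrtr_eq0 -ltNge.
rewrite /normal_peak /normal_fun sqr_sqrtr ?ltW// mulrA.
have -> : (2 * e)^-1 * pi *+ 2 = pi / e.
  by rewrite -mulr_natr; field; rewrite gt_eqF.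
rewrite divff ?mul1r; last by rewrite sqrtr_eq0 -ltNge divr_gt0// pi_gt0.
rewrite /gaussian; congr expR; rewrite mulNr; congr (- _).
by rewrite -mulr_natr; field; rewrite gt_eqF.
Qed.

Lemma integrable_gaussian m e : 0 < e ->
  mu.-integrable setT (EFin \o (fun x => gaussian e (x - m))).
Proof.
move=> e0; rewrite (_ : _ \o _ = fun x => ((Num.sqrt (pi / e))%:E *
  (normal_pdf m (Num.sqrt (2 * e)^-1) x)%:E)%E); last first.
  by apply/funext => x /=; rewrite gaussian_pdf.
by apply: integrableZl => //; exact: integrable_normal_pdf.
Qed.

Lemma Rintegral_gaussian m e : 0 < e ->
  Rintegral mu setT (fun x => gaussian e (x - m)) = Num.sqrt (pi / e).
Proof.
move=> e0; under eq_Rintegral do rewrite gaussian_pdf//.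
rewrite RintegralZl//; last exact: integrable_normal_pdf.
by rewrite /Rintegral integral_normal_pdf /= mulr1.
Qed.

(** Half of the exponent of the Gaussian absorbs the exponential growth, by completing the square: e
    x^2 / 2 - M |x| + M^2 / (2 e) = (e |x| - M)^2 / (2 e). *)
Lemma subexp_gaussian_bound h e : 0 < e -> subexp h ->
  exists2 B, 0 <= B & forall x, `|h x * gaussian e x| <= B * gaussian (e / 2) x.
Proof.
move=> e0 [_ [A [M [A0 M0 hAM]]]].
exists (A * expR (M ^+ 2 / (2 * e))); first by rewrite mulr_ge0// expR_ge0.
move=> x; rewrite normrM [`|gaussian _ _|]ger0_norm ?gaussian_ge0//.
apply: le_trans (ler_wpM2r (gaussian_ge0 _ _) (hAM x)) _.
rewrite -!mulrA ler_wpM2l// -!expRD ler_expR.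
have -> : x ^+ 2 = `|x| ^+ 2 by rewrite real_normK// num_real.
rewrite -subr_ge0.
have -> : M * (M / (2 * e)) - e / 2 * `|x| ^+ 2 - (M * `|x| - e * `|x| ^+ 2) =
  (e * `|x| - M) ^+ 2 / (2 * e) by field; rewrite gt_eqF.
by rewrite divr_ge0 ?sqr_ge0// mulr_ge0// ltW.
Qed.

Lemma integrable_subexp_gaussian h e : 0 < e -> subexp h ->
  mu.-integrable setT (EFin \o (fun x => h x * gaussian e x)).
Proof.
move=> e0 sh; have [B B0 hB] := subexp_gaussian_bound e0 sh.
have ch : continuous (fun x => h x * gaussian e x).
  by move=> x; apply: cvgM; [exact: sh.1|exact: continuous_gaussian].
apply: (@le_integrable _ _ _ mu _ measurableT _
  (EFin \o (fun x => B * gaussian (e / 2) (x - 0)))).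
- by apply/measurable_EFinP; exact: continuous_measurable_fun.
- move=> x _ /=; rewrite lee_fin subr0 (le_trans (hB x))//.
  by rewrite ger0_norm// mulr_ge0// gaussian_ge0.
- rewrite (_ : _ \o _ = fun x => (B%:E * (gaussian (e / 2) (x - 0))%:E)%E)//.
  apply: integrableZl => //; apply: integrable_gaussian.
  by rewrite divr_gt0.
Qed.

Lemma cvg_gaussian e : 0 < e -> gaussian e n%:R @[n --> \oo] --> (0 : R).
Proof.
move=> e0; apply: (@squeeze_cvgr _ _ _ _ (cst 0) (fun n : nat => (e * n%:R)^-1)).
- near=> n.
  have n0 : (0 : R) < n%:R by rewrite ltr0n; near: n; exact: nbhs_infty_gt.
  rewrite gaussian_ge0/= /gaussian expRN lef_pV2 ?posrE ?expR_gt0 ?mulr_gt0//.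
  rewrite (le_trans _ (expR_ge1Dx _))// (@le_trans _ _ (e * n%:R ^+ 2))//.
    by rewrite expr2 mulrA ler_peMr ?mulr_ge0 ?(ltW e0)// ler1n -(ltr0n R).
  by rewrite lerDr.
- exact: cvg_cst.
- rewrite (_ : (fun n : nat => _) = (fun n : nat => e^-1 * (n%:R)^-1)); last first.
    by apply/funext => n; rewrite invfM.
  rewrite -[X in _ --> X](mulr0 e^-1); apply: cvgM; first exact: cvg_cst.
  by rewrite -cvg_shiftS; exact: cvg_harmonic.
Unshelve. all: by end_near. Qed.

Lemma Rintegral_derive_eq0 (F f : R -> R) :
  (forall x, is_derive x 1 F (f x)) -> continuous f ->
  mu.-integrable setT (EFin \o f) ->
  F n%:R @[n --> \oo] --> (0 : R) -> F (- n%:R) @[n --> \oo] --> (0 : R) ->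
  Rintegral mu setT f = 0.
Proof.
move=> dF cf intf Fy FNy.
(* The bound [n.+1] keeps every interval nondegenerate, as the fundamental theorem of calculus
   requires. *)
pose fn (n : nat) := (EFin \o f) \_ (`[- n.+1%:R, n.+1%:R] : set R).
have [|||||_ _ h] := @dominated_convergence _ _ _ mu setT measurableT fn
    (EFin \o f) (abse \o (EFin \o f)).
- move=> n; apply/(measurable_restrictT _ _).1 => //.
  by apply/measurable_EFinP; apply: measurable_funTS; exact: continuous_measurable_fun.
- by apply/measurable_EFinP; exact: continuous_measurable_fun.
- apply: aeW => x _; apply: cvg_near_cst; near=> n.
  rewrite /fn patchE ifT// inE/= in_itv/= -ler_norml.
  by rewrite (@le_trans _ _ n%:R)// ?ler_nat//; near: n; exact: nbhs_infty_ger.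
- exact: integrable_abse.
- apply: aeW => x n _; rewrite /fn patchE; case: ifPn => //= _.
  by rewrite lee_fin normr0.
have fnE n : (\int[mu]_x fn n x = (F n.+1%:R - F (- n.+1%:R))%:E)%E.
  rewrite -integral_mkcond EFinB; apply: continuous_FTC2 => //.
  - by rewrite (@lt_trans _ _ 0)// ?oppr_lt0 ltr0n.
  - exact: continuous_subspaceT.
  - have cF : continuous F.
      move=> x; apply/differentiable_continuous/derivable1_diffP.
      by have [] := dF x.
    split=> [x _||]; [by have [] := dF x|..].
    + by apply: cvg_at_right_filter; exact: cF.
    + by apply: cvg_at_left_filter; exact: cF.
  - by move=> x _; rewrite derive1E; have [_ ->] := dF x.
have h0 : (\int[mu]_x fn n x @[n --> \oo] --> 0)%E.
  under eq_fun do rewrite fnE.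
  apply: cvg_EFin; first exact: nearW.
  rewrite -(subrr (0 : R)); apply: cvgB.
    by rewrite -(cvg_shiftS (fun n => F n%:R)) in Fy.
  by rewrite -(cvg_shiftS (fun n => F (- n%:R))) in FNy.
by rewrite /Rintegral (cvg_unique _ h h0).
Unshelve. all: by end_near. Qed.

(** The derivative of h times the Gaussian is (h' - 2 e x h) times the Gaussian, and its integral
    over the line is 0 because the product vanishes at both ends. *)
Lemma Rintegral_gaussian_by_parts e h dh : 0 < e -> subexp h -> subexp dh ->
  (forall x, is_derive x 1 h (dh x)) ->
  Rintegral mu setT (fun x => dh x * gaussian e x) =
  2 * e * Rintegral mu setT (fun x => x * h x * gaussian e x).
Proof.
move=> e0 sh sdh hd.
have sxh : subexp (fun x => x * h x) by apply: subexpM => //; exact: subexp_id.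
apply/eqP; rewrite -subr_eq0 -RintegralZl//; last exact: integrable_subexp_gaussian.
have sxh2 : subexp (fun x => 2 * e * (x * h x)) by exact: subexpZ.
have -> : (fun x => 2 * e * (x * h x * gaussian e x)) =
    (fun x => 2 * e * (x * h x) * gaussian e x).
  by apply/funext => x; rewrite !mulrA.
rewrite -RintegralB//; [|exact: integrable_subexp_gaussian..].
have sB := subexpB sdh sxh2.
have -> : (fun x => dh x * gaussian e x - 2 * e * (x * h x) * gaussian e x) =
    (fun x => (dh x - 2 * e * (x * h x)) * gaussian e x).
  by apply/funext => x; rewrite mulrBl.
have [B B0 hB] := subexp_gaussian_bound e0 sh.
have e20 : 0 < e / 2 by rewrite divr_gt0.
have lim0 (s : R^nat) : (forall n, `|s n| = n%:R) ->
    h (s n) * gaussian e (s n) @[n --> \oo] --> (0 : R).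
  move=> sn; apply: norm_cvg0.
  apply: (@squeeze_cvgr _ _ _ _ (cst 0) (fun n : nat => B * gaussian (e / 2) n%:R)).
  - apply: nearW => n; rewrite normr_ge0 (le_trans (hB _))//.
    by rewrite /gaussian -[s n ^+ 2]real_normK ?num_real// sn.
  - exact: cvg_cst.
  - rewrite -(mulr0 B); apply: cvgM; first exact: cvg_cst.
    exact: cvg_gaussian.
apply/eqP; apply: (@Rintegral_derive_eq0 (fun x => h x * gaussian e x)).
- move=> x; have := hd x; have := is_derive_gaussian e x => d1 d2.
  by apply: is_derive_eq; rewrite /GRing.scale/=; ring.
- by move=> x; apply: cvgM; [exact: sB.1|exact: continuous_gaussian].
- exact: integrable_subexp_gaussian.
- by apply: lim0 => n; rewrite normr_nat.
- by apply: lim0 => n; rewrite normrN normr_nat.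
Qed.

Lemma Rintegral_fsol_sin_gaussian c e : 0 < e ->
  2 * e * Rintegral mu setT (fun x => x * fsol_sin c x * gaussian e x) =
  Rintegral mu setT (fun x => fsol_cos c x * gaussian e x).
Proof.
move=> e0; apply/esym/Rintegral_gaussian_by_parts => //.
- exact: subexp_fsol_sin.
- exact: subexp_fsol_cos.
- exact: is_derive_fsol_sin.
Qed.

(* As a function of r, the integral of fsol_cos c (r x) exp(-e x^2) solves a
   first-order linear ODE. *)
Lemma Rintegral_fsol_cos_gaussian c e : 0 < e ->
  Rintegral mu setT (fun x => fsol_cos c x * gaussian e x) =
  Num.sqrt (pi / e) * expR (c / (4 * e)).
Proof.
move=> e0.
pose f r x := fsol_cos c (r * x) * gaussian e x.
pose Psi r := Rintegral mu setT (f r).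
have df (r x : R) : is_derive r 1 (f^~ x) (c * (x * fsol_sin c (r * x)) * gaussian e x).
  rewrite /f.
  have d1 := is_derive_fsol_cos c (r * x).
  have d2 : is_derive r 1 (fun r : R => r * x) x.
    by apply: is_derive_eq; rewrite /GRing.scale/=; ring.
  have := @is_derive1_comp _ _ (fun r => r * x) _ _ _ d1 d2; rewrite /comp => d3.
  by apply: is_derive_eq; rewrite /GRing.scale/=; ring.
have [cs [A [M [A0 M0 hAM]]]] := subexp_fsol_sin c.
have dPsi (r : R) : is_derive r 1 Psi (c / (2 * e) * r * Psi r).
  (* Dominates the derivative in the parameter uniformly over ]r - 1, r + 1[, where the parameter is
     at most |r| + 1 in absolute value. *)
  pose G x := `|c * x| * (A * expR (M * (`|r| + 1) * `|x|)) * gaussian e x.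
  have sG : subexp (fun x => `|c * x| * (A * expR (M * (`|r| + 1) * `|x|))).
    apply: subexpM; first by apply: subexp_norm; apply: subexpZ; exact: subexp_id.
    apply: subexpZ; split.
      move=> x; apply: (@continuous_comp _ _ _ (fun x : R => M * (`|r| + 1) * `|x|) expR);
        last exact: continuous_expR.
      by apply: cvgM; [exact: cvg_cst|exact: norm_continuous].
    exists 1, (M * (`|r| + 1)); split => //.
      by rewrite mulr_ge0// addr_ge0.
    by move=> x; rewrite mul1r ger0_norm ?expR_ge0.
  have Ir : (`]r - 1, r + 1[%classic : set R) r.
    by rewrite /= in_itv/= ltrBlDr ltrDl ltr01.
  have intf (x : R) : (`]r - 1, r + 1[%classic : set R) x -> mu.-integrable setT (EFin \o f x).
    move=> _; apply: integrable_subexp_gaussian => //.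
    by have := subexp_scale x (subexp_fsol_cos c).
  have df' (x y : R) : (`]r - 1, r + 1[%classic : set R) x -> [set: R] y -> derivable (f^~ y) x 1.
    by move=> _ _; have [] := df x y.
  have iG : mu.-integrable setT (EFin \o G) by exact: integrable_subexp_gaussian.
  have G0 x : 0 <= G x.
    by rewrite mulr_ge0 ?gaussian_ge0// !mulr_ge0// expR_ge0.
  have Gub (x y : R) : (`]r - 1, r + 1[%classic : set R) x -> [set: R] y ->
      `|partial1of2 f x y| <= G y.
    move=> + _; rewrite /= in_itv/= => /andP[x1 x2].
    rewrite partial1of2E; have [_ ->] := df x y.
    rewrite /G !normrM -!mulrA ler_wpM2l// ler_wpM2l// !mulrA.
    rewrite [X in _ * X]ger0_norm ?gaussian_ge0// ler_wpM2r ?gaussian_ge0//.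
    rewrite (le_trans (hAM _))// ler_wpM2l// ler_expR -!mulrA ler_wpM2l// normrM.
    rewrite ler_wpM2r//.
    have := ler_norm r; have := ler_norm (- r); rewrite normrN => r1 r2.
    by rewrite ler_norml; apply/andP; split; lra.
  have d1 := derivable_under_integral measurableT Ir intf df' G0 iG Gub.
  have d2 := differentiation_under_integral measurableT Ir intf df' G0 iG Gub.
  apply: DeriveDef; first exact: d1.
  rewrite -derive1E d2.
  have -> : (fun x => partial1of2 f r x) =
      (fun x => c * (x * fsol_sin c (r * x) * gaussian e x)).
    apply/funext => x; rewrite partial1of2E; have [_ ->] := df r x.
    by rewrite !mulrA.
  have sS : subexp (fun x => fsol_sin c (r * x)).
    by have := subexp_scale r (subexp_fsol_sin c).
  have sC : subexp (fun x => r * fsol_cos c (r * x)).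
    by apply: subexpZ; have := subexp_scale r (subexp_fsol_cos c).
  rewrite RintegralZl//; last first.
    by apply: integrable_subexp_gaussian => //; apply: subexpM => //; exact: subexp_id.
  have dS (x : R) : is_derive x 1 (fun x => fsol_sin c (r * x)) (r * fsol_cos c (r * x)).
    have d3 := is_derive_fsol_sin c (r * x).
    have d4 : is_derive x 1 (fun x : R => r * x) r.
      by apply: is_derive_eq; rewrite /GRing.scale/=; ring.
    have := @is_derive1_comp _ _ (fun x => r * x) _ _ _ d3 d4; rewrite /comp => d5.
    by apply: is_derive_eq; rewrite mulrC.
  (* Integration by parts in x turns the integral of x S(r x) into a multiple of r [Psi r], which
     closes the differential equation. *)
  have := Rintegral_gaussian_by_parts e0 sS sC dS => bp.
  have rPsi : r * Psi r =
      Rintegral mu setT (fun x => r * fsol_cos c (r * x) * gaussian e x).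
    rewrite -RintegralZl//; last exact: (intf _ Ir).
    by congr Rintegral; apply/funext => x; rewrite mulrA.
  by rewrite -mulrA rPsi bp; field; rewrite gt_eqF.
have Psi0 : Psi 0 = Num.sqrt (pi / e).
  rewrite -(Rintegral_gaussian 0 e0) /Psi/f; congr Rintegral.
  by apply/funext => x; rewrite mul0r fsol_cos0 mul1r subr0.
(* Integrating factor for Psi' = c / (2 e) r Psi. Comparing r = 1 with r = 0, where the integrand is
   a plain Gaussian, gives the claim. *)
pose w r := Psi r * expR (- (c / (4 * e) * r ^+ 2)).
have dw (r : R) : is_derive r 1 w 0.
  have := dPsi r => d1; rewrite /w.
  apply: is_derive_eq; rewrite /GRing.scale/=; field; lra.
have := @is_derive_0_is_cst R w 1 0 dw.
rewrite /w Psi0 expr0n/= mulr0 oppr0 expR0 mulr1 expr1n mulr1 => <-.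
rewrite -mulrA -expRD addrC subrr expR0 mulr1 /Psi/f.
by congr Rintegral; apply/funext => x; rewrite mul1r.
Qed.

(** Uniqueness of Lebesgue measure reduces this to ]a, b], whose preimage [y - b, y - a[ has the
    same length. *)
Lemma lebesgue_measure_reflect y (A : set R) : measurable A ->
  pushforward mu ((fun x => y - x) : R -> measurableTypeR R) A = mu A.
Proof.
have mphi : measurable_fun setT ((fun x => y - x) : R -> measurableTypeR R).
  by apply: measurable_funB.
move=> mA; apply/esym/lebesgue_measure_unique => //= _ [[a b]] _ <-.
rewrite /pushforward (_ : _ @^-1` _ = `[y - b, y - a[%classic); last first.
  apply/seteqP; split => x /=; rewrite !in_itv/= => /andP[h1 h2]; apply/andP; split; lra.
by rewrite /mu !lebesgue_measure_itv/= !lte_fin ltrD2l ltrN2; case: ifP => // _; rewrite -?EFinN -?EFinD; congr EFin; ring.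
Qed.

Lemma integrable_reflect y f : mu.-integrable setT (EFin \o f) ->
  mu.-integrable setT (EFin \o (fun x => f (y - x))).
Proof.
move=> /integrableP[mf intf]; apply/integrableP; split.
  apply/measurable_EFinP.
  apply: (@measurableT_comp _ _ _ _ _ _ f); first exact/measurable_EFinP.
  exact: measurable_funB.
have mphi : measurable_fun setT ((fun x => y - x) : R -> measurableTypeR R).
  by apply: measurable_funB.
move: intf; rewrite (@eq_measure_integral _ _ _ _ (pushforward mu ((fun x => y - x) : R -> measurableTypeR R))); last first.
  by move=> A mA _; exact/esym/lebesgue_measure_reflect.
by rewrite ge0_integral_pushforward//; exact: measurableT_comp.
Qed.

Lemma Rintegral_reflect y f : mu.-integrable setT (EFin \o f) ->
  Rintegral mu setT (fun x => f (y - x)) = Rintegral mu setT f.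
Proof.
move=> intf.
have mphi : measurable_fun setT ((fun x => y - x) : R -> measurableTypeR R).
  by apply: measurable_funB.
rewrite /Rintegral; congr fine.
rewrite [RHS](@eq_measure_integral _ _ _ _ (pushforward mu ((fun x => y - x) : R -> measurableTypeR R))); last first.
  by move=> A mA _; exact/esym/lebesgue_measure_reflect.
rewrite integral_pushforward//; first exact: (measurable_int mu).
exact: integrable_reflect.
Qed.

Lemma Rintegral_even f : mu.-integrable setT (EFin \o f) ->
  (forall x, f (- x) = f x) ->
  Rintegral mu setT f = 2 * Rintegral mu `[0, +oo[ f.
Proof.
move=> intf fE.
have iA (A : set R) : measurable A -> mu.-integrable A (EFin \o f).
  by move=> mA; apply: integrableS intf.
have iP (A : set R) : measurable A -> mu.-integrable setT (EFin \o (f \_ A)).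
  by move=> mA; rewrite -restrict_EFin; apply/integrable_restrict => //; rewrite setTI; exact: iA.
rewrite -(setUv `[0%R, +oo[) Rintegral_setU//=; last 3 first.
- exact: measurableC.
- by rewrite setUv.
- exact/disj_setPCl.
rewrite mulr_natl mulr2n; congr +%R.
rewrite setCitvr Rintegral_mkcond -(Rintegral_reflect 0); last exact: iP.
rewrite Rintegral_itv_bndo_bndc; last exact: iA.
rewrite [LHS]Rintegral_mkcond; congr Rintegral; apply/funext => x.
rewrite !patchE sub0r fE; congr (if _ then _ else _).
by apply/idP/idP; rewrite !inE/= !in_itv/= andbT oppr_ge0.
Qed.

End gaussian_integrals.

(** * Odd Gaussian bumps on the half-line: transforms and pairings *)

Section half_line_heat_functions.
Context {R : realType}.
Implicit Types (f g h : R -> R) (e x y a b : R).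
Let mu := @lebesgue_measure R.

Lemma Rintegral_odd f : mu.-integrable setT (EFin \o f) ->
  (forall x, f (- x) = - f x) -> Rintegral mu setT f = 0.
Proof.
move=> intf fN; have := Rintegral_reflect 0 intf.
have -> : (fun x => f (0 - x)) = (fun x => -1 * f x).
  by apply/funext => x; rewrite sub0r fN mulN1r.
rewrite RintegralZl// => h; lra.
Qed.

(* Odd, hence Dirichlet, heat kernel with source y when a = 1, b = 0 and
   e = 1 / (2 s). *)
Definition odd_bump e a b y x : R :=
  (a + b * (y - x)) * gaussian e (y - x) - (a + b * (y + x)) * gaussian e (y + x).

Lemma odd_bumpN e a b y x : odd_bump e a b y (- x) = - odd_bump e a b y x.
Proof. by rewrite /odd_bump !opprK opprB. Qed.

Lemma gaussianB e y x :
  gaussian e (y - x) = gaussian e y * expR (2 * e * y * x) * gaussian e x.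
Proof. by rewrite /gaussian -!expRD; congr expR; ring. Qed.

Lemma gaussianBM e y x :
  gaussian e (y - x) * gaussian e (y + x) = gaussian (2 * e) y * gaussian (2 * e) x.
Proof. by rewrite /gaussian -!expRD; congr expR; ring. Qed.

(** Factoring out the Gaussian centred at 0 leaves only affine and exponential factors in x. *)
Lemma odd_bump_subexp e a b y : exists2 h, subexp h &
  forall x, odd_bump e a b y x = h x * gaussian e x.
Proof.
exists (fun x => gaussian e y * ((a + b * (y - x)) * expR (2 * e * y * x)
   - (a + b * (y + x)) * expR (- (2 * e * y) * x))).
  have s1 (k : R) : subexp (fun x => a + b * (y + k * x)).
    apply: subexpD; first exact: subexp_cst.
    apply: subexpZ; apply: subexpD; first exact: subexp_cst.
    by apply: subexpZ; exact: subexp_id.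
  apply: subexpZ; apply: subexpB; apply: subexpM; try exact: subexp_expR.
    by under eq_fun do rewrite -mulN1r; exact: s1.
  by under eq_fun do rewrite -[X in y + X]mul1r; exact: s1.
move=> x; rewrite /odd_bump gaussianB -[in y + x](opprK x) gaussianB gaussianN.
by rewrite !opprK mulrN mulNr; ring.
Qed.

Lemma integrable_odd_bumpM e a b y h : 0 < e -> subexp h ->
  mu.-integrable setT (EFin \o (fun x => odd_bump e a b y x * h x)).
Proof.
move=> e0 sh; have [k sk kE] := odd_bump_subexp e a b y.
have -> : (fun x => odd_bump e a b y x * h x) = (fun x => k x * h x * gaussian e x).
  by apply/funext => x; rewrite kE mulrAC.
by apply: integrable_subexp_gaussian => //; exact: subexpM.
Qed.

Lemma continuous_odd_bump e a b y : continuous (odd_bump e a b y).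
Proof.
have [k [ck _] kE] := odd_bump_subexp e a b y.
rewrite (_ : odd_bump e a b y = fun x => k x * gaussian e x); last exact/funext.
by move=> x; apply: cvgM; [exact: ck|exact: continuous_gaussian].
Qed.

(** After the substitution u = y - x the addition law produces four integrals. The two with odd
    integrands vanish; the even ones are the cosine integral and, by parts, 1 / (2 e) times it. The
    affine factor b u is what brings in the derivative of the solution at y. *)
Lemma Rintegral_bump_fsol_sin e a b y c : 0 < e ->
  mu.-integrable setT
    (EFin \o (fun x => (a + b * (y - x)) * gaussian e (y - x) * fsol_sin c x)) /\
  Rintegral mu setT
    (fun x => (a + b * (y - x)) * gaussian e (y - x) * fsol_sin c x) =
  Num.sqrt (pi / e) * expR (c / (4 * e)) *
    (a * fsol_sin c y - b / (2 * e) * fsol_cos c y).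
Proof.
move=> e0.
pose h u := (a + b * u) * gaussian e u * fsol_sin c (y - u).
have -> : (fun x => (a + b * (y - x)) * gaussian e (y - x) * fsol_sin c x) =
    (fun x => h (y - x)).
  by apply/funext => x; rewrite /h opprB addrCA subrr addr0.
have sS := subexp_fsol_sin c; have sC := subexp_fsol_cos c.
have sI := @subexp_id R.
have sIS := subexpM sI sS; have sIC := subexpM sI sC.
have iS := integrable_subexp_gaussian e0 sS.
have iC := integrable_subexp_gaussian e0 sC.
have iIS := integrable_subexp_gaussian e0 sIS.
have iIC := integrable_subexp_gaussian e0 sIC.
pose k1 := a * fsol_sin c y; pose k2 := - (a * fsol_cos c y).
pose k3 := b * fsol_sin c y; pose k4 := - (b * fsol_cos c y).
have hE : h = (fun u => k1 * (fsol_cos c u * gaussian e u) +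
    k2 * (fsol_sin c u * gaussian e u) + k3 * (u * fsol_cos c u * gaussian e u) +
    k4 * (u * fsol_sin c u * gaussian e u)).
  by apply/funext => u; rewrite /h fsol_sinB /k1 /k2 /k3 /k4; ring.
have i1 := integrable_mulr measurableT k1 iC.
have i2 := integrable_mulr measurableT k2 iS.
have i3 := integrable_mulr measurableT k3 iIC.
have i4 := integrable_mulr measurableT k4 iIS.
have i12 := integrable_addr measurableT i1 i2.
have i123 := integrable_addr measurableT i12 i3.
have ih : mu.-integrable setT (EFin \o h) by rewrite hE; exact: integrable_addr.
split; first exact: integrable_reflect.
rewrite Rintegral_reflect// hE.
rewrite RintegralD// RintegralD// RintegralD// !RintegralZl//.
rewrite (Rintegral_odd iS); last by move=> x; rewrite fsol_sinN gaussianN mulNr.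
rewrite (Rintegral_odd iIC); last by move=> x; rewrite fsol_cosN gaussianN !mulNr.
have := Rintegral_fsol_sin_gaussian c e0; rewrite Rintegral_fsol_cos_gaussian// => hS.
have -> : Rintegral mu setT (fun x => x * fsol_sin c x * gaussian e x) =
    (2 * e)^-1 * (Num.sqrt (pi / e) * expR (c / (4 * e))).
  by rewrite -hS mulrA mulVf ?mul1r// mulf_neq0 ?gt_eqF.
by rewrite /k1 /k4; field; rewrite gt_eqF.
Qed.

(** Both factors are odd, so the half-line integral is half of the full one, to which the source at
    y and the mirror source at -y contribute equally. *)
Lemma Rintegral_odd_bump_fsol_sin e a b y c : 0 < e ->
  Rintegral mu `[0, +oo[ (fun x => odd_bump e a b y x * fsol_sin c x) =
  Num.sqrt (pi / e) * expR (c / (4 * e)) *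
    (a * fsol_sin c y - b / (2 * e) * fsol_cos c y).
Proof.
move=> e0; have sS := subexp_fsol_sin c.
have := Rintegral_even (integrable_odd_bumpM a b y e0 sS).
have ev x : odd_bump e a b y (- x) * fsol_sin c (- x) =
    odd_bump e a b y x * fsol_sin c x.
  by rewrite odd_bumpN fsol_sinN mulrNN.
move=> /(_ ev) h.
have [i1 e1] := Rintegral_bump_fsol_sin a b y c e0.
have i2 := integrable_reflect 0 i1.
have e2 := Rintegral_reflect 0 i1.
set k := RHS; set J := LHS.
apply: (@mulfI _ (2 : R)); first by rewrite pnatr_eq0.
rewrite /J -h /odd_bump.
set p := fun x => (a + b * (y - x)) * gaussian e (y - x) * fsol_sin c x in i1 i2 e1 e2.
have -> : (fun x => ((a + b * (y - x)) * gaussian e (y - x) -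
    (a + b * (y + x)) * gaussian e (y + x)) * fsol_sin c x) =
   (fun x => p x + p (0 - x)).
  by apply/funext => x; rewrite /p sub0r fsol_sinN opprK; ring.
by rewrite RintegralD// e2 e1 /k; ring.
Qed.

(** The diagonal products are Gaussians of parameter 2 e centred at y and -y. The cross products are
    centred at 0 with prefactor [gaussian (2 * e) y], the source of the terms with e^(-y^2/s).
    Parity removes all linear factors. *)
Lemma Rintegral_odd_bumpM e a b y : 0 < e ->
  Rintegral mu `[0, +oo[ (fun x => odd_bump e 1 0 y x * odd_bump e a b y x) =
  Num.sqrt (pi / (2 * e)) * (a - gaussian (2 * e) y * (a + b * y)).
Proof.
move=> e0; have e20 : 0 < 2 * e by rewrite mulr_gt0.
pose k u := (a + b * u) * gaussian (2 * e) u.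
pose m u := (a + b * y + b * u) * gaussian (2 * e) u.
have sl (a' b' : R) : subexp (fun u => a' + b' * u).
  by apply: subexpD; [exact: subexp_cst|apply: subexpZ; exact: subexp_id].
have ilin (a' b' : R) : mu.-integrable setT (EFin \o (fun u => (a' + b' * u) * gaussian (2 * e) u)).
  by apply: integrable_subexp_gaussian => //; exact: sl.
have elin (a' b' : R) : Rintegral mu setT (fun u => (a' + b' * u) * gaussian (2 * e) u) =
    a' * Num.sqrt (pi / (2 * e)).
  have iI : mu.-integrable setT (EFin \o (fun u => u * gaussian (2 * e) u)).
    exact: integrable_subexp_gaussian e20 (@subexp_id R).
  have i1 : mu.-integrable setT (EFin \o (fun u => 1 * gaussian (2 * e) u)).
    exact: integrable_subexp_gaussian e20 (@subexp_cst R 1).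
  rewrite -(Rintegral_gaussian 0 e20).
  under [in RHS]eq_fun do rewrite subr0 -[gaussian _ _]mul1r.
  have -> : (fun u => (a' + b' * u) * gaussian (2 * e) u) =
     (fun u => a' * (1 * gaussian (2 * e) u) + b' * (u * gaussian (2 * e) u)).
    by apply/funext => u; ring.
    rewrite RintegralD//; [|exact: integrable_mulr..].
  rewrite (RintegralZl _ measurableT i1) (RintegralZl _ measurableT iI).
  by rewrite (Rintegral_odd iI) ?mulr0 ?addr0// => x; rewrite gaussianN mulNr.
have ik := ilin a b; have im := ilin (a + b * y) b.
have ik1 := integrable_reflect y ik; have ek1 := Rintegral_reflect y ik.
have ik2 := integrable_reflect 0 ik1; have ek2 := Rintegral_reflect 0 ik1.
have im2 := integrable_reflect 0 im; have em2 := Rintegral_reflect 0 im.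
pose F x := k (y - x) + k (y - (0 - x)) - gaussian (2 * e) y * (m x + m (0 - x)).
have FE : (fun x => odd_bump e 1 0 y x * odd_bump e a b y x) = F.
  apply/funext => x; rewrite /F /k /m /odd_bump !mul0r !addr0 !mul1r sub0r opprK.
  have g2 z : gaussian (2 * e) z = gaussian e z * gaussian e z.
    by rewrite /gaussian -expRD; congr expR; ring.
  have := gaussianBM e y x; rewrite gaussianN (g2 (y - x)) (g2 (y + x)).
  move: (gaussian e (y - x)) (gaussian e (y + x)) => A B h1.
  have -> : gaussian (2 * e) y * ((a + b * y + b * x) * gaussian (2 * e) x +
      (a + b * y + b * - x) * gaussian (2 * e) x) =
      2 * (a + b * y) * (A * B) by rewrite h1; ring.
  ring.
have iK := integrable_addr measurableT ik1 ik2.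
have iM := integrable_addr measurableT im im2.
have iM' := integrable_mulr measurableT (gaussian (2 * e) y) iM.
have iF : mu.-integrable setT (EFin \o F) := integrable_subr measurableT iK iM'.
have := @Rintegral_even _ F iF; rewrite FE => /(_ _)/wrap[|h2].
  by move=> x; rewrite -FE !odd_bumpN mulrNN.
set c := RHS; set J := LHS.
apply: (@mulfI _ (2 : R)); first by rewrite pnatr_eq0.
rewrite /J -h2 /F (RintegralB measurableT iK iM').
rewrite (RintegralD measurableT ik1 ik2) (RintegralZl _ measurableT iM).
rewrite (RintegralD measurableT im im2).
rewrite ek2 em2 ek1 /k /m !elin /c; ring.
Qed.

End half_line_heat_functions.

(** * The spectral transform *)

Section spectral_transform.
Context {R : realType} (th : R -> R -> R) (rho : cumulative R R).
Let mu : {measure set (measurableTypeR R) -> \bar R} := @lebesgue_measure R.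
Let mr : {measure set (measurableTypeR R) -> \bar R} :=
  lebesgue_stieltjes_measure rho.
Let Rp : set (measurableTypeR R) := `[0, +oo[%classic.

Let mRp : measurable Rp. Proof. exact: measurable_itv. Qed.

Lemma integrable_sqr d (T : measurableType d) (m : {measure set T -> \bar R})
    (A : set T) (f : T -> R) : measurable A -> L2fun m A f ->
  m.-integrable A (EFin \o (fun x => f x ^+ 2)).
Proof.
move=> mA [mf foo]; apply/integrableP; split.
  by apply/measurable_EFinP; exact: measurable_funX.
apply: le_lt_trans foo; rewrite le_eqVlt; apply/orP; left; apply/eqP.
by apply: eq_integral => x _ /=; rewrite ger0_norm// sqr_ge0.
Qed.

Lemma L2fun_patch (f g : R -> R) : L2fun mu Rp f -> measurable_fun Rp g ->
  (forall x, `|g x| <= `|f x|) -> L2fun mu Rp g.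
Proof.
move=> [mf foo] mg gf; split => //; apply: le_lt_trans foo.
apply: ge0_le_integral => //.
- by move=> x _; rewrite lee_fin sqr_ge0.
- by apply/measurable_EFinP; exact: measurable_funX.
- by apply/measurable_EFinP; exact: measurable_funX.
- move=> x _; rewrite lee_fin -[g x ^+ 2]real_normK ?num_real//.
  by rewrite -[f x ^+ 2]real_normK ?num_real// ler_sqr ?nnegrE.
Qed.

(** From (f + g)^2 <= 2 f^2 + 2 g^2. The factor 1 matches the shape of [Ulin]. *)
Lemma L2funD (f g : R -> R) : L2fun mu Rp f -> L2fun mu Rp g ->
  L2fun mu Rp (fun x => 1 * f x + g x).
Proof.
move=> lf lg; have [mf _] := lf; have [mg _] := lg.
have i1 := integrable_sqr mRp lf; have i2 := integrable_sqr mRp lg.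
split; first by apply: measurable_funD => //; exact: measurable_funM.
have := integrableD mRp (integrableD mRp i1 i1) (integrableD mRp i2 i2).
move/integrableP => [_]; apply: le_lt_trans.
apply: ge0_le_integral => //.
- by move=> x _; rewrite lee_fin sqr_ge0.
- apply/measurable_EFinP; apply: measurable_funX; apply: measurable_funD => //.
  exact: measurable_funM.
- apply: measurableT_comp => //; apply: emeasurable_funD; apply: emeasurable_funD => //;
    by apply/measurable_EFinP; exact: measurable_funX.
- move=> x _ /=; rewrite lee_fin mul1r ger0_norm; last first.
    by rewrite !addr_ge0// sqr_ge0.
  rewrite -subr_ge0; have := sqr_ge0 (f x - g x).
  by congr (0 <= _); ring.
Qed.

Let aeF : Filter (nbhs (almost_everywhere mr)).
Proof. exact: ae_filter_ringOfSetsType. Qed.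

Variables (U : (R -> R) -> R -> R).
Hypothesis Uiso : forall f, L2fun mu Rp f -> L2fun mr setT (U f) /\
  (\int[mr]_nu ((U f nu) ^+ 2)%:E = \int[mu]_(y in Rp) ((f y) ^+ 2)%:E)%E.
Hypothesis Ulin : forall (c : R) f g, L2fun mu Rp f -> L2fun mu Rp g ->
  {ae mr, forall nu, U (fun y => c * f y + g y) nu = c * U f nu + U g nu}.
Hypothesis Ubnd : forall f, L2fun mu Rp f ->
  (exists b, forall y, b < y -> f y = 0) ->
  {ae mr, forall nu, U f nu = Rintegral mu Rp (fun y => f y * th nu y)}.

(* The cut-offs of f to [0, n] converge in L^2, hence so do their transforms;
   Fatou's lemma identifies the limit. *)
Lemma spectral_transformE (f : R -> R) : L2fun mu Rp f ->
  (forall nu, mu.-integrable Rp (EFin \o (fun y => f y * th nu y))) ->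
  {ae mr, forall nu, U f nu = Rintegral mu Rp (fun y => f y * th nu y)}.
Proof.
have ? := aeF.
move=> lf ith; have [mf foo] := lf.
pose fn (n : nat) y := if y <= n%:R then f y else 0.
have mle n : measurable_fun Rp (fun y : R => y <= n%:R).
  by apply: measurable_funTS; exact: measurable_fun_ler.
have mfn n : measurable_fun Rp (fn n).
  apply: measurable_fun_if => //.
  - by apply: measurable_funS mf => //; exact: subIsetl.
have fnf n x : `|fn n x| <= `|f x|.
  by rewrite /fn; case: ifP => // _; rewrite normr0.
have lfn n : L2fun mu Rp (fn n) by exact: L2fun_patch (fnf n).
(* The tail f - [fn n], written in the form required by [Ulin]; by the isometry its transform tends
   to 0 in L^2. *)
pose rn n y := -1 * fn n y + f y.
have rnf n x : `|rn n x| <= `|f x|.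
  rewrite /rn /fn; case: ifP => _; first by rewrite mulN1r addNr normr0.
  by rewrite mulr0 add0r.
have mrn n : measurable_fun Rp (rn n).
  by apply: measurable_funD => //; exact: measurable_funM.
have lrn n : L2fun mu Rp (rn n) by exact: L2fun_patch (rnf n).
have Urn0 : (\int[mr]_nu ((U (rn n) nu) ^+ 2)%:E @[n --> \oo] --> 0)%E.
  under eq_fun do rewrite (Uiso (lrn _)).2.
  have i2 := integrable_sqr mRp lf.
  have [|||||_ _] := @dominated_convergence _ _ _ mu Rp mRp
    (fun n y => ((rn n y) ^+ 2)%:E) (cst 0%E) (EFin \o (fun x => f x ^+ 2)).
  - by move=> n; apply/measurable_EFinP; exact: measurable_funX.
  - exact: measurable_cst.
  - apply: aeW => x _; apply: cvg_near_cst; near=> n.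
    rewrite /rn /fn ifT ?mulN1r ?addNr ?expr0n//.
    by near: n; exact: nbhs_infty_ger.
  - exact: i2.
  - apply: aeW => x n _ /=; rewrite lee_fin ger0_norm ?sqr_ge0//.
    rewrite -[rn n x ^+ 2]real_normK ?num_real//.
    by rewrite -[f x ^+ 2]real_normK ?num_real// ler_sqr ?nnegrE.
  by rewrite integral0.
have Pn nu : Rintegral mu Rp (fun y => fn n y * th nu y) @[n --> \oo] -->
    Rintegral mu Rp (fun y => f y * th nu y).
  have [|||||_ _ h] := @dominated_convergence _ _ _ mu Rp mRp
    (fun n y => (fn n y * th nu y)%:E) (EFin \o (fun y => f y * th nu y))
    (abse \o (EFin \o (fun y => f y * th nu y))).
  - move=> n; apply: (@eq_measurable_fun _ _ _ _ Rp
       (fun y => if y <= n%:R then (f y * th nu y)%:E else 0%E)).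
      by move=> y _; rewrite /fn; case: ifP => // _; rewrite mul0r.
    apply: measurable_fun_if => //.
    have := measurable_int mu (ith nu).
    by apply: measurable_funS => //; exact: subIsetl.
  - exact: measurable_int (ith nu).
  - apply: aeW => x _; apply: cvg_near_cst; near=> n.
    rewrite /fn ifT//.
    by near: n; exact: nbhs_infty_ger.
  - by apply: integrable_abse; exact: ith.
  - apply: aeW => x n _ /=; rewrite lee_fin !normrM.
    by rewrite ler_wpM2r.
  apply: fine_cvg; rewrite fineK//; exact: integrable_fin_num (ith nu).
have ae1 : {ae mr, forall nu, forall n,
    U (fn n) nu = Rintegral mu Rp (fun y => fn n y * th nu y)}.
  apply/ae_foralln => n; apply: Ubnd => //.
  by exists n%:R => y ny; rewrite /fn leNgt ny.
have ae2 : {ae mr, forall nu, forall n, U (rn n) nu = -1 * U (fn n) nu + U f nu}.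
  by apply/ae_foralln => n; exact: Ulin.
have mUr n : measurable_fun setT (fun nu => ((U (rn n) nu) ^+ 2)%:E).
  by apply/measurable_EFinP; apply: measurable_funX; exact: (Uiso (lrn n)).1.1.
(* Taking the lower limit avoids the choice of an almost everywhere convergent subsequence: by Fatou
   it has integral 0, hence vanishes almost everywhere. Pointwise convergence of the truncated
   integrals identifies it with (U f - Phi)^2. *)
pose g nu := limn_einf (fun n => ((U (rn n) nu) ^+ 2)%:E).
have g0 nu : (0 <= g nu)%E.
  apply: (@le_trans _ _ (einfs (fun n => ((U (rn n) nu) ^+ 2)%:E) 0%N)).
    by apply: le_ereal_inf_tmp => _ [m /= _ <-]; rewrite lee_fin sqr_ge0.
  rewrite /g limn_einf_lim; apply: lime_ge; first exact: is_cvg_einfs.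
  by apply: nearW => n; apply: nondecreasing_einfs.
have Fat : (\int[mr]_nu `|g nu| = 0)%E.
  under eq_integral do rewrite gee0_abs//.
  apply/eqP; rewrite eq_le; apply/andP; split; last exact: integral_ge0.
  apply: le_trans (fatou _ _ _ _) _ => //.
  - by move=> n x _; rewrite lee_fin sqr_ge0.
  - by rewrite (cvg_limn_einf_sup Urn0).1.
have mg : measurable_fun setT g.
  rewrite /g /limn_einf; apply: measurableT_comp => //.
  by apply: measurable_fun_limn_esup => n; exact: measurableT_comp (mUr n).
have ae3 : {ae mr, forall nu, setT nu -> g nu = 0%E}.
  by move/(ae_eq_integral_abs mr measurableT mg) : Fat.
apply: filterS3 ae1 ae2 ae3 => nu h1 h2 /(_ I) h3.
set Phi := RHS.
have cv : ((U (rn n) nu) ^+ 2)%:E @[n --> \oo] --> ((U f nu - Phi) ^+ 2)%:E.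
  apply: cvg_EFin; first exact: nearW.
  under eq_fun do rewrite h2 h1 mulN1r addrC.
  by apply: cvgM; apply: cvgB => //; exact: cvg_cst.
have := (cvg_limn_einf_sup cv).1; rewrite -/(g nu) h3 => -[] /esym/eqP.
by rewrite sqrf_eq0 subr_eq0 => /eqP.
Unshelve. all: by end_near. Qed.

Let spectral_sqr (f F : R -> R) : L2fun mu Rp f -> measurable_fun setT F ->
  {ae mr, forall nu, U f nu = F nu} ->
  mr.-integrable setT (EFin \o (fun nu => F nu ^+ 2)) /\
  Rintegral mr setT (fun nu => F nu ^+ 2) = Rintegral mu Rp (fun y => f y ^+ 2).
Proof.
have ? := aeF.
move=> lf mF UF; have [[mUf Ufoo] Uf] := Uiso lf.
have mF2 : measurable_fun setT (fun nu => (F nu ^+ 2)%:E).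
  by apply/measurable_EFinP; exact: measurable_funX.
have mU2 : measurable_fun setT (fun nu => (U f nu ^+ 2)%:E).
  by apply/measurable_EFinP; exact: measurable_funX.
have ae2 : ae_eq mr setT (fun nu => (F nu ^+ 2)%:E) (fun nu => (U f nu ^+ 2)%:E).
  by apply: (filterS _ UF) => nu /= + _ => <-.
have e := @ae_eq_integral _ _ _ mr setT _ _ measurableT mF2 mU2 ae2.
rewrite Uf in e.
split; last by rewrite /Rintegral e.
apply: (integrable_sqr measurableT); split; first exact: mF.
by rewrite e -Uf; exact: Ufoo.
Qed.

(** Polarisation of the isometry. The transforms are known only up to null sets, so explicit
    functions [F] and [G] stand in for them and their measurability is asked separately. *)
Lemma spectral_Rintegral_mul (f g F G : R -> R) :
  L2fun mu Rp f -> L2fun mu Rp g -> measurable_fun setT F -> measurable_fun setT G ->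
  (forall nu, mu.-integrable Rp (EFin \o (fun y => f y * th nu y))) ->
  (forall nu, mu.-integrable Rp (EFin \o (fun y => g y * th nu y))) ->
  (forall nu, Rintegral mu Rp (fun y => f y * th nu y) = F nu) ->
  (forall nu, Rintegral mu Rp (fun y => g y * th nu y) = G nu) ->
  mr.-integrable setT (EFin \o (fun nu => F nu * G nu)) /\
  Rintegral mr setT (fun nu => F nu * G nu) = Rintegral mu Rp (fun y => f y * g y).
Proof.
have ? := aeF.
move=> lf lg mF mG ith ith' fF gG.
have UF : {ae mr, forall nu, U f nu = F nu}.
  by apply: filterS (spectral_transformE lf ith) => nu ->.
have UG : {ae mr, forall nu, U g nu = G nu}.
  by apply: filterS (spectral_transformE lg ith') => nu ->.
have lfg := L2funD lf lg.
have mFG : measurable_fun setT (fun nu => F nu + G nu) by exact: measurable_funD.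
have UFG : {ae mr, forall nu, U (fun y => 1 * f y + g y) nu = F nu + G nu}.
  by apply: filterS3 UF UG (Ulin 1 lf lg) => nu -> -> ->; rewrite mul1r.
have [iF eF] := spectral_sqr lf mF UF.
have [iG eG] := spectral_sqr lg mG UG.
have [iFG eFG] := spectral_sqr lfg mFG UFG.
have jf := integrable_sqr mRp lf; have jg := integrable_sqr mRp lg.
have jfg := integrable_sqr mRp lfg.
have [i1 e1] := Rintegral_polarization measurableT iFG iF iG.
have [i2 e2] := Rintegral_polarization mRp jfg jf jg.
have E1 : (fun nu => F nu * G nu) =
    (fun nu => 2^-1 * ((F nu + G nu) ^+ 2 - F nu ^+ 2 - G nu ^+ 2)).
  by apply/funext => nu; field.
have E2 : (fun nu => f nu * g nu) =
    (fun nu => 2^-1 * ((1 * f nu + g nu) ^+ 2 - f nu ^+ 2 - g nu ^+ 2)).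
  by apply/funext => nu; field.
rewrite E1 E2; split; first exact: i1.
rewrite e1 e2.
have alg (x y z x' y' z' : R) : x = x' -> y = y' -> z = z' ->
    2^-1 * (x - y - z) = 2^-1 * (x' - y' - z') by move=> -> -> ->.
exact: alg eFG eF eG.
Qed.

End spectral_transform.

(** * Closed form of the spectral integral for one eigenvalue *)

Section cusp_integral.
Context {R : realType}.
Let mu : {measure set (measurableTypeR R) -> \bar R} := @lebesgue_measure R.
Let Rp : set (measurableTypeR R) := `[0, +oo[%classic.
Let mRp : measurable Rp. Proof. exact: measurable_itv. Qed.

Lemma subexp_gaussian (e : R) : 0 <= e -> subexp (gaussian e).
Proof.
move=> e0; split; first exact: continuous_gaussian.
exists 1, 0; split => // x; rewrite mul1r mul0r expR0 ger0_norm ?gaussian_ge0//.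
by rewrite /gaussian expR_le1 oppr_le0 mulr_ge0// sqr_ge0.
Qed.

Lemma L2fun_odd_bump (e a b y : R) : 0 < e -> L2fun mu Rp (odd_bump e a b y).
Proof.
move=> e0; split.
  by apply: measurable_funTS; apply: continuous_measurable_fun; exact: continuous_odd_bump.
have [k sk kE] := odd_bump_subexp e a b y.
have sG := subexp_gaussian (ltW e0).
have : mu.-integrable Rp (EFin \o (fun x => odd_bump e a b y x * (k x * gaussian e x))).
  apply: integrableS (integrable_odd_bumpM a b y e0 (subexpM sk sG)) => //.
move/integrableP => [_]; apply: le_lt_trans.
rewrite le_eqVlt; apply/orP; left; apply/eqP; apply: eq_integral => x _ /=.
by rewrite -kE -expr2 ger0_norm// sqr_ge0.
Qed.

Lemma cusp_spectral_integral (l s y : R) (q : R -> R) (th : R -> R -> R)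
    (rho : cumulative R R) : 0 < s -> 0 < y -> (forall x, q x = l ^+ 2) ->
  (forall nu, is_theta q nu (th nu)) -> is_spectral_function th rho ->
  let f nu := expR (- s * nu) * th nu y * (derive1 (th nu) y + l * th nu y) in
  (lebesgue_stieltjes_measure rho).-integrable setT (EFin \o f) /\
  Rintegral (lebesgue_stieltjes_measure rho) setT f =
  expR (- (s * l ^+ 2)) / (2 * Num.sqrt (pi * s)) *
    (l * (1 - expR (- (y ^+ 2 / s))) + y / s * expR (- (y ^+ 2 / s))).
Proof.
move=> s0 y0.
have sp0 : 0 < Num.sqrt (pi * s) by rewrite sqrtr_gt0 mulr_gt0// pi_gt0.
have pE : pi = Num.sqrt (pi * s) ^+ 2 / s.
  rewrite sqr_sqrtr; last by rewrite mulr_ge0 ?pi_ge0// ltW.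
  by rewrite mulfK// gt_eqF.
have epi (e : R) : 0 < e -> e / pi * (pi / e) = 1.
  move=> e0; have pi0 := pi_gt0 R.
  by rewrite mulf_div [pi * e]mulrC divff// mulf_neq0// gt_eqF.
move=> qE thP [U [V [Uiso Ulin Ubnd _ _]]] f.
(* Each transform carries exp(c / (4 e)) = exp(s c / 2), so a product of two carries exp(s (l^2 -
   nu)): this choice creates exactly the heat factor e^(-s nu). *)
pose e := (2 * s)^-1.
have e0 : 0 < e by rewrite invr_gt0 mulr_gt0.
pose c nu := l ^+ 2 - nu.
have thE nu x : 0 <= x -> th nu x = fsol_sin (c nu) x.
  by apply: (is_theta_fsol qE erefl (thP nu)).1.
have dthE nu x : 0 < x -> derive1 (th nu) x = fsol_cos (c nu) x.
  by apply: (is_theta_fsol qE erefl (thP nu)).2.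
pose k nu := Num.sqrt (pi / e) * expR (c nu / (4 * e)).
have ith a b nu : mu.-integrable Rp (EFin \o (fun x => odd_bump e a b y x * th nu x)).
  have i1 : mu.-integrable Rp (EFin \o (fun x => odd_bump e a b y x * fsol_sin (c nu) x)).
    by apply: integrableS (integrable_odd_bumpM a b y e0 (subexp_fsol_sin _)).
  apply: (@eq_integrable _ _ _ _ _ mRp _ _ _ i1) => x.
  by move=> /set_mem; rewrite /Rp/= in_itv/= andbT => x0 /=; rewrite thE.
have trans a b nu : Rintegral mu Rp (fun x => odd_bump e a b y x * th nu x) =
    k nu * (a * fsol_sin (c nu) y - b / (2 * e) * fsol_cos (c nu) y).
  rewrite /k -Rintegral_odd_bump_fsol_sin//; apply: eq_Rintegral => x.
  by move=> /set_mem; rewrite /Rp/= in_itv/= andbT => x0 /=; rewrite thE.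
have mc : measurable_fun setT c by exact: measurable_funB.
have mk : measurable_fun setT k.
  apply: measurable_funM => //; apply: measurableT_comp => //.
  exact: measurable_funM.
have mtr a b : measurable_fun setT (fun nu =>
    k nu * (a * fsol_sin (c nu) y - b / (2 * e) * fsol_cos (c nu) y)).
  apply: measurable_funM => //; apply: measurable_funB; apply: measurable_funM => //.
    exact: (measurableT_comp (measurable_fsol_sin y) mc).
  exact: (measurableT_comp (measurable_fsol_cos y) mc).
(* The coefficients (1, 0) give theta(y), and (l, -2 e) give theta'(y) + l theta(y): the two factors
   of the integrand. *)
have [i0 E0] := spectral_Rintegral_mul Uiso Ulin Ubnd (L2fun_odd_bump 1 0 y e0)
  (L2fun_odd_bump l (- (2 * e)) y e0) (mtr 1 0) (mtr l (- (2 * e)))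
  (ith 1 0) (ith l (- (2 * e))) (trans 1 0) (trans l (- (2 * e))).
(* Cancels the factor (pi / e) exp(s l^2) left over from [k nu * k nu]. *)
pose m := e / pi * expR (- (s * l ^+ 2)).
have fE : f = (fun nu => m * (k nu * (1 * fsol_sin (c nu) y - 0 / (2 * e) * fsol_cos (c nu) y) *
   (k nu * (l * fsol_sin (c nu) y - (- (2 * e)) / (2 * e) * fsol_cos (c nu) y)))).
  apply/funext => nu; rewrite /f (thE _ _ (ltW y0)) (dthE _ _ y0).
  have k2 : k nu * k nu = pi / e * expR (s * l ^+ 2 - s * nu).
    rewrite /k mulrACA -expr2 sqr_sqrtr; last exact: divr_ge0 (pi_ge0 _) (ltW e0).
    rewrite -expRD; congr (_ * expR _); rewrite /c /e; field.
    by rewrite gt_eqF.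
  have -> : expR (- s * nu) = m * (k nu * k nu).
    rewrite k2 /m mulrACA -expRD.
    by rewrite (epi _ e0) mul1r; congr expR; ring.
  by field; rewrite gt_eqF.
split.
  by rewrite fE; exact: (integrable_mulr measurableT m i0).
rewrite fE (RintegralZl _ measurableT i0) E0 (Rintegral_odd_bumpM _ _ _ e0).
have -> : pi / (2 * e) = pi * s by rewrite /e; field; rewrite gt_eqF.
have g1 : gaussian (2 * e) y = expR (- (y ^+ 2 / s)).
  by rewrite /gaussian; congr expR; rewrite /e; field; rewrite gt_eqF.
rewrite g1 /m.
rewrite {1}pE /e.
move: (Num.sqrt _) sp0 (expR (- (y ^+ 2 / s))) (expR _) => r r0 E1 E2.
by field; rewrite !gt_eqF.
Qed.

Lemma xi_cst0 (a a' : R) : a <= a' -> xi (cst 0) a a' = a' - a.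
Proof.
move=> aa'; rewrite /xi /cst expR0.
by rewrite Rintegral_cst//= mul1r lebesgue_measure_itv/= lte_fin;
  move: aa'; rewrite le_eqVlt => /predU1P[->|->]; rewrite ?ltxx ?subrr.
Qed.

Lemma qplus_cst0 (a l y : R) : qplus (cst 0) a l y = l ^+ 2.
Proof.
rewrite /qplus derive1_cst addr0 /= mulr0 expR0 mulr1 expr2//.
Qed.

Lemma cusp_integrand_cst0 (a a' l s nu : R) th : a <= a' ->
  cusp_integrand (cst 0) a a' l s th nu =
  expR (- s * nu) * th nu (a' - a) *
    (derive1 (th nu) (a' - a) + l * th nu (a' - a)).
Proof. by move=> aa'; rewrite /cusp_integrand xi_cst0// oppr0 expR0 mulr1. Qed.

End cusp_integral.

(** * Subordination *)

Section gauss_primitive.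
Context {R : realType}.
Let mu := @lebesgue_measure R.

(** This is sqrt(pi) / 2 times the error function; both kernel integrals below reduce to it by
    substitution. *)
Definition gauss_primitive (x : R) : R := Rintegral mu `[0, x] gauss_fun.

Lemma is_derive_gauss_primitive (x : R) : 0 < x ->
  is_derive x 1 gauss_primitive (gauss_fun x).
Proof.
move=> x0.
have ig : mu.-integrable `[0, x + 1] (EFin \o gauss_fun).
  exact: integrableS integrableT_gauss.
have cg : {for x, continuous (@gauss_fun R)} by exact: continuous_gauss_fun.
have xx : x < x + 1 by rewrite ltrDl.
have [d e] := continuous_FTC1_closed xx ig x0 cg.
by apply: DeriveDef; [exact: d|rewrite -derive1E; exact: e].
Qed.

Lemma gauss_primitive_cvg0 (v : R^nat) : (forall n, 0 <= v n) ->
  v n @[n --> \oo] --> (0 : R) ->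
  gauss_primitive (v n) @[n --> \oo] --> (0 : R).
Proof.
move=> v0 cv; apply: (@squeeze_cvgr _ _ _ _ (cst 0) v _ _ _ (cvg_cst _) cv).
apply: nearW => n; apply/andP; split.
  by apply: Rintegral_ge0 => x _; exact: gauss_fun_ge0.
apply: (@le_trans _ _ (Rintegral mu `[0, v n] (cst 1))).
  apply: le_Rintegral => //.
  - exact: integrableS integrableT_gauss.
  - apply: continuous_compact_integrable; first exact: segment_compact.
    by apply: continuous_subspaceT; exact: cst_continuous.
  - by move=> x _; exact: gauss_fun_le1.
rewrite Rintegral_cst//= mul1r lebesgue_measure_itv/= lte_fin; case: ifPn => //= _.
by rewrite subr0.
Qed.

Lemma gauss_primitive_cvgy (v : R^nat) : v n @[n --> \oo] --> +oo ->
  gauss_primitive (v n) @[n --> \oo] --> Num.sqrt pi / 2.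
Proof.
move=> vy.
have h : gauss_primitive x @[x --> +oo] --> Num.sqrt pi / 2.
  (* The known limit, pi / 4, is that of the square; nonnegativity allows the root to be taken. *)
  have : Num.sqrt (gauss_primitive x ^+ 2) @[x --> +oo] --> Num.sqrt (pi / 4).
    apply: continuous_cvg; first exact: sqrt_continuous.
    exact: gauss_integral_proof.cvg_integral0_gauss_sqr.
  rewrite sqrtrM ?pi_ge0// sqrtrV// (_ : 4 = 2 ^+ 2); last by rewrite expr2 -natrM.
  rewrite sqrtr_sqr ger0_norm//.
  rewrite (_ : (fun _ => Num.sqrt _) = gauss_primitive)//.
  apply/funext => r; rewrite sqrtr_sqr// ger0_norm//.
  by apply: Rintegral_ge0 => x _; exact: gauss_fun_ge0.
exact: (cvg_comp _ _ vy h).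
Qed.

End gauss_primitive.

Section improper_FTC.
Context {R : realType}.
Let mu := @lebesgue_measure R.

(** Monotone convergence over an exhaustion by compact intervals: for a nonnegative integrand,
    singular or infinite endpoints need no prior integrability, only limits of the primitive. *)
Lemma ge0_integral_exhaustion (f F : R -> R) (a b : R^nat) (D : set R) (A B : R) :
  (forall n, a n < b n) -> (forall n, a n.+1 <= a n) -> (forall n, b n <= b n.+1) ->
  (forall n x, a n <= x <= b n -> D x) ->
  (forall x, D x -> exists n, a n <= x <= b n) ->
  (forall x, D x -> 0 <= f x) ->
  (forall x, D x -> is_derive x 1 F (f x)) ->
  (forall x, D x -> {for x, continuous f}) ->
  F (a n) @[n --> \oo] --> A -> F (b n) @[n --> \oo] --> B ->
  (\int[mu]_(x in D) (f x)%:E = (B - A)%:E)%E.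
Proof.
move=> ab na nb abD Dab f0 dF cf FA FB.
pose I n : set R := `[a n, b n]%classic.
have DE : D = \bigcup_n I n.
  apply/seteqP; split => [x /Dab[n xn]|x [n _ xn]].
    by exists n => //; rewrite /I/= in_itv.
  by apply: (abD n); move: xn; rewrite /I/= in_itv.
have ID n x : I n x -> D x by rewrite /I/= in_itv; exact: abD.
have cfI n : {within I n, continuous f}.
  apply: continuous_in_subspaceT => x /set_mem xI.
  exact: cf (ID _ _ xI).
have nI : nondecreasing_seq I.
  apply/nondecreasing_seqP => n; rewrite subsetEset => x.
  rewrite /I/= !in_itv/= => /andP[ax xb].
  by rewrite (le_trans (na n) ax) (le_trans xb (nb n)).
have mI n : measurable (I n) by exact: measurable_itv.
have mf n : measurable_fun (I n) (EFin \o f).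
  by apply/measurable_EFinP; exact: subspace_continuous_measurable_fun.
have f0' n x : I n x -> (0 <= (EFin \o f) x)%E.
  by move=> xI; rewrite lee_fin f0//; exact: ID xI.
have h := @ge0_nondecreasing_set_cvg_integral _ _ _ _ _ mu nI mI mf f0'.
rewrite -DE in h.
have E n : (\int[mu]_(x in I n) (f x)%:E = (F (b n) - F (a n))%:E)%E.
  rewrite EFinB; apply: continuous_FTC2 => //.
  - exact: (cfI n).
  - have cF x : I n x -> {for x, continuous F}.
      move=> xI; apply/differentiable_continuous/derivable1_diffP.
      by have [] := dF x (ID _ _ xI).
    split=> [x xab||].
    + have xI : I n x by rewrite /I/=; exact: subset_itv_oo_cc xab.
      by have [] := dF x (ID _ _ xI).
    + apply: cvg_at_right_filter; apply: cF.
      by rewrite /I/= in_itv/= lexx ltW.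
    + apply: cvg_at_left_filter; apply: cF.
      by rewrite /I/= in_itv/= lexx ltW.
  - move=> x xab; rewrite derive1E.
    have xI : I n x by rewrite /I/=; exact: subset_itv_oo_cc xab.
    by have [_ ->] := dF x (ID _ _ xI).
have h' : ((\int[mu]_(x in I n) (f x)%:E)%E @[n --> \oo] --> (B - A)%:E)%E.
  under eq_fun do rewrite E.
  by apply: cvg_EFin; [exact: nearW|exact: cvgB].
exact: cvg_unique h h'.
Qed.

End improper_FTC.

(** * The two kernel integrals of the subordination argument *)

Section kernels.
Context {R : realType}.
Let mu := @lebesgue_measure R.

Let cvgy_sqrt (u : R^nat) : u n @[n --> \oo] --> +oo ->
  Num.sqrt (u n) @[n --> \oo] --> +oo.
Proof.
move=> uy; apply/cvgryPge => A.
move/cvgryPge : uy => uy; near=> n.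
rewrite (le_trans (ler_norm A))// -sqrtr_sqr ler_wsqrtr//; near: n; exact: uy.
Unshelve. all: by end_near. Qed.

Let cvg0_sqrt (u : R^nat) : u n @[n --> \oo] --> (0 : R) ->
  Num.sqrt (u n) @[n --> \oo] --> (0 : R).
Proof.
move=> u0; rewrite -[X in _ --> X]sqrtr0.
by apply: continuous_cvg => //; exact: sqrt_continuous.
Qed.

Let cvgyn k : (n + k)%:R @[n --> \oo] --> (+oo : set_system R).
Proof.
apply/cvgryPge => A; near=> n; rewrite (@le_trans _ _ n%:R) ?ler_nat ?leq_addr//.
by near: n; exact: nbhs_infty_ger.
Unshelve. all: by end_near. Qed.

Let cvgMy (k : R) (u : R^nat) : 0 < k -> u n @[n --> \oo] --> +oo ->
  k * u n @[n --> \oo] --> +oo.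
Proof.
move=> k0 uy; apply/cvgryPge => A.
move/cvgryPge : uy => uy; near=> n.
rewrite mulrC -ler_pdivrMr//; near: n; exact: uy.
Unshelve. all: by end_near. Qed.

(* The substitution v = m sqrt(r - s). *)
Lemma integral_expR_invsqrt (m s : R) : 0 < m ->
  (\int[mu]_r (expR (- r * m ^+ 2) / Num.sqrt (r - s))%:E =
   (Num.sqrt pi * expR (- s * m ^+ 2) / m)%:E)%E.
Proof.
move=> m0.
pose f r := expR (- r * m ^+ 2) / Num.sqrt (r - s).
pose F r := 2 / m * expR (- s * m ^+ 2) * gauss_primitive (m * Num.sqrt (r - s)).
have step : (\int[mu]_(r in `]s, +oo[) (f r)%:E =
    (2 / m * expR (- s * m ^+ 2) * (Num.sqrt pi / 2) - 2 / m * expR (- s * m ^+ 2) * 0)%:E)%E.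
  (* The intervals stay away from the singularity at s and from infinity; [n.+2] ensures
     nondegeneracy at n = 0. *)
  apply: (@ge0_integral_exhaustion _ f F (fun n => s + n.+1%:R^-1) (fun n => s + n.+2%:R)).
  - move=> n; rewrite ltrD2l (@le_lt_trans _ _ 1)// ?ltr1n//.
    by rewrite invf_le1// ler1n.
  - by move=> n; rewrite lerD2l lef_pV2 ?posrE// ler_nat.
  - by move=> n; rewrite lerD2l ler_nat.
  - move=> n x /andP[sx _]; rewrite /= in_itv/= andbT (lt_le_trans _ sx)// ltrDl.
    by rewrite invr_gt0.
  - move=> x; rewrite /= in_itv/= andbT -subr_gt0 => sx.
    near \oo => n; exists n; rewrite -lerBrDl -[x <= _]lerBlDl.
    have n1 : (x - s)^-1 <= n%:R by near: n; exact: nbhs_infty_ger.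
    have n2 : x - s <= n%:R by near: n; exact: nbhs_infty_ger.
    rewrite (le_trans n2) ?ler_nat ?andbT; last by rewrite -addn2 leq_addr.
    rewrite invf_ple ?posrE// (le_trans n1)// ler_nat//.
  - by move=> x _; rewrite /f divr_ge0// ?expR_ge0// sqrtr_ge0.
  - move=> x; rewrite /= in_itv/= andbT -subr_gt0 => sx.
    have d1 : is_derive x 1 (fun r => m * Num.sqrt (r - s)) (m / (2 * Num.sqrt (x - s))).
      have d2 := is_derive1_sqrt sx.
      have d3 : is_derive x 1 (fun r => r - s) 1.
        by apply: is_derive_eq; rewrite subr0.
      have := @is_derive1_comp _ Num.sqrt (fun r => r - s) _ _ _ d2 d3.
      rewrite /comp => d4.
      by apply: is_derive_eq; rewrite /GRing.scale/= mulr1.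
    have v0 : 0 < m * Num.sqrt (x - s) by rewrite mulr_gt0// sqrtr_gt0.
    have d5 := is_derive_gauss_primitive v0.
    have := @is_derive1_comp _ gauss_primitive (fun r => m * Num.sqrt (r - s)) _ _ _ d5 d1.
    rewrite /comp => d6; rewrite /F.
    apply: is_derive_eq; rewrite /GRing.scale/= /f /gauss_fun.
    rewrite exprMn sqr_sqrtr ?(ltW sx)//.
    have -> : expR (- x * m ^+ 2) = expR (- s * m ^+ 2) * expR (- (m ^+ 2 * (x - s))).
      by rewrite -expRD; congr expR; ring.
    have : 0 < Num.sqrt (x - s) by rewrite sqrtr_gt0.
    move: (Num.sqrt _) => q q0; field; rewrite !gt_eqF//.
  - move=> x; rewrite /= in_itv/= andbT -subr_gt0 => sx.
    apply: cvgM.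
      apply: (@continuous_comp _ _ _ (fun r : R => - r * m ^+ 2) expR); last exact: continuous_expR.
      by apply: cvgM; [apply: cvgN; exact: cvg_id|exact: cvg_cst].
    apply: cvgV; first by rewrite gt_eqF// sqrtr_gt0.
    apply: (@continuous_comp _ _ _ (fun r : R => r - s) Num.sqrt); last exact: sqrt_continuous.
    by apply: cvgB; [exact: cvg_id|exact: cvg_cst].
  - apply: cvgM; first exact: cvg_cst.
    apply: gauss_primitive_cvg0.
      by move=> n; rewrite mulr_ge0 ?sqrtr_ge0// ltW.
    rewrite -(mulr0 m); apply: cvgM; first exact: cvg_cst.
    apply: cvg0_sqrt; under eq_fun do rewrite addrAC subrr add0r.
    exact: cvg_harmonic.
  - apply: cvgM; first exact: cvg_cst.
    apply: gauss_primitive_cvgy; apply: cvgMy => //; apply: cvgy_sqrt.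
    under eq_fun do rewrite addrAC subrr add0r.
    by under eq_fun do rewrite -addn2; exact: cvgyn.
(* For r <= s the integrand is 0, as the square root of a nonpositive number is 0 and so is its
   inverse. The same convention confines the next kernel to 0 < s < r. *)
transitivity (\int[mu]_(r in `]s, +oo[) (f r)%:E)%E; last first.
  by rewrite step; congr EFin; field; rewrite gt_eqF.
rewrite [RHS]integral_mkcond; apply: eq_integral => r _.
rewrite patchE; case: ifPn => //; rewrite notin_setE/= in_itv/= andbT => /negP.
by rewrite -leNgt -subr_le0 => rs; rewrite ler0_sqrtr// invr0 mulr0.
Unshelve. all: by end_near. Qed.

(* The substitution v = y sqrt(1/s - 1/r). *)
Lemma integral_heat_invsqrt (y r : R) : 0 < y ->
  (\int[mu]_s (y / (s * Num.sqrt s) * expR (- (y ^+ 2 / s)) / Num.sqrt (r - s))%:E =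
   (Num.sqrt pi / Num.sqrt r * expR (- (y ^+ 2 / r)))%:E)%E.
Proof.
move=> y0.
pose f s := y / (s * Num.sqrt s) * expR (- (y ^+ 2 / s)) / Num.sqrt (r - s).
have f0 s : s <= 0 \/ r <= s -> f s = 0.
  case=> [s0|rs]; rewrite /f; first by rewrite (ler0_sqrtr s0) !(mulr0, invr0, mul0r).
  by rewrite [Num.sqrt (r - s)]ler0_sqrtr ?invr0 ?mulr0// subr_le0.
have [r0|r0] := leP r 0.
  rewrite (ler0_sqrtr r0) invr0 mulr0 mul0r integral0_eq// => s _.
  congr EFin; apply: f0; have [s0|s0] := leP s 0; [by left|right].
  exact: le_trans r0 (ltW s0).
pose K := 2 / Num.sqrt r * expR (- (y ^+ 2 / r)).
pose v s := y / Num.sqrt r * (Num.sqrt (r - s) / Num.sqrt s).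
(* [v] decreases from +oo at 0 to 0 at r, whence the sign; [K] contains the factor left by
   exp(-y^2/s) = exp(-y^2/r) exp(-v^2). *)
pose F s := - K * gauss_primitive (v s).
have vE s : 0 < s -> Num.sqrt (r - s) / Num.sqrt s = Num.sqrt ((r - s) / s).
  by move=> s0; rewrite [in RHS]mulrC sqrtrM ?invr_ge0 ?(ltW s0)// sqrtrV ?(ltW s0)// mulrC.
have step : (\int[mu]_(s in `]0%R, r[) (f s)%:E =
    (- K * 0 - (- K * (Num.sqrt pi / 2)))%R%:E)%E.
  (* Since n + 3 > 2, the left end lies below the right one; the quotient (r - s) / s takes the
     values n + 2 and 1 / (n + 2) at the two ends. *)
  apply: (@ge0_integral_exhaustion _ f F (fun n => r / n.+3%:R) (fun n => r - r / n.+3%:R)).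
  - move=> n; rewrite ltrBrDl -mulr2n -[_ *+ 2]mulr_natr mulrAC ltr_pdivrMr// ltr_pM2l//.
    by rewrite ltr_nat.
  - by move=> n; rewrite ler_pM2l// lef_pV2 ?posrE// ler_nat.
  - by move=> n; rewrite lerD2l lerN2 ler_pM2l// lef_pV2 ?posrE// ler_nat.
  - move=> n x /andP[x1 x2]; rewrite /= in_itv/= (lt_le_trans _ x1) ?divr_gt0//=.
    by rewrite (le_lt_trans x2)// ltrBlDr ltrDl divr_gt0.
  - move=> x; rewrite /= in_itv/= => /andP[x1]; rewrite -subr_gt0 => x2.
    near \oo => n; exists n.
    have n1 : r / x <= n%:R by near: n; exact: nbhs_infty_ger.
    have n2 : r / (r - x) <= n%:R by near: n; exact: nbhs_infty_ger.
    have n3 : (n%:R : R) <= n.+3%:R by rewrite ler_nat -addn3 leq_addr.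
    rewrite [x <= _]lerBrDl -lerBrDr !ler_pdivrMr// ![_ * n.+3%:R]mulrC.
    by rewrite -!ler_pdivrMr// (le_trans n1)// (le_trans n2).
  - move=> x; rewrite /= in_itv/= => /andP[x1 x2].
    apply: divr_ge0; last exact: sqrtr_ge0.
    apply: mulr_ge0; last exact: expR_ge0.
    by apply: divr_ge0; [exact: ltW|apply: mulr_ge0; [exact: ltW|exact: sqrtr_ge0]].
  - move=> x; rewrite /= in_itv/= => /andP[x1 x2].
    have rx : 0 < r - x by rewrite subr_gt0.
    have d2 := is_derive1_sqrt rx.
    have d3 : is_derive x 1 (fun s => r - s) (-1).
      by apply: is_derive_eq; rewrite /GRing.scale/=; ring.
    have := @is_derive1_comp _ Num.sqrt (fun s => r - s) _ _ _ d2 d3.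
    rewrite /comp => d4.
    have d5 := is_derive1_sqrt x1.
    have q1 : 0 < Num.sqrt x by rewrite sqrtr_gt0.
    have q2 : 0 < Num.sqrt (r - x) by rewrite sqrtr_gt0.
    have q3 : 0 < Num.sqrt r by rewrite sqrtr_gt0.
    have d6 : is_derive x 1 (fun s => (Num.sqrt s)^-1) (- (Num.sqrt x) ^- 2 * (2 * Num.sqrt x)^-1).
      have q1' : Num.sqrt x != 0 by rewrite gt_eqF.
      by apply: is_derive_eq; rewrite /GRing.scale.
    have d1 : is_derive x 1 v (- (y * Num.sqrt r / 2 / (Num.sqrt (r - x) * x * Num.sqrt x))).
      rewrite /v; apply: is_derive_eq; rewrite /GRing.scale/=.
      have xE : x = Num.sqrt x ^+ 2 by rewrite sqr_sqrtr// ltW.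
      have rxE : r = Num.sqrt (r - x) ^+ 2 + Num.sqrt x ^+ 2 by rewrite !sqr_sqrtr ?ltW// subrK.
      have rE : r = Num.sqrt r ^+ 2 by rewrite sqr_sqrtr// ltW.
      rewrite [X in _ * X * Num.sqrt x]xE.
      move: (Num.sqrt x) (Num.sqrt (r - x)) (Num.sqrt r) q1 q2 q3 rxE rE.
      move=> a b c a0 b0 c0 -> abc.
      transitivity (- (y * (b ^+ 2 + a ^+ 2) / c / 2 / (b * a ^+ 2 * a))).
        by field; rewrite !gt_eqF.
      by rewrite abc; field; rewrite !gt_eqF.
    have v0 : 0 < v x by rewrite /v mulr_gt0// divr_gt0.
    have d7 := is_derive_gauss_primitive v0.
    have := @is_derive1_comp _ gauss_primitive v _ _ _ d7 d1.
    rewrite /comp => d8; rewrite /F.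
    apply: is_derive_eq; rewrite /GRing.scale/= /f /gauss_fun /K.
    have -> : expR (- (y ^+ 2 / x)) = expR (- (y ^+ 2 / r)) * expR (- v x ^+ 2).
      rewrite -expRD; congr expR; rewrite /v !exprMn !exprVn !sqr_sqrtr ?ltW//.
      by field; rewrite !gt_eqF.
    move: (Num.sqrt _) (Num.sqrt _) (Num.sqrt _) q1 q2 q3 => a b c a0 b0 c0.
    by field; rewrite !gt_eqF.
  - move=> x; rewrite /= in_itv/= => /andP[x1 x2].
    have c1 : {for x, continuous (fun s : R => s^-1)}.
      by apply: inv_continuous; rewrite gt_eqF.
    have c2 : Num.sqrt (z - 0) @[z --> x] --> Num.sqrt x.
      by under eq_fun do rewrite subr0; exact: sqrt_continuous.
    have c3 : Num.sqrt z @[z --> x] --> Num.sqrt x by exact: sqrt_continuous.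
    apply: cvgM; first apply: cvgM.
    - apply: cvgM; first exact: cvg_cst.
      apply: cvgV; first by rewrite mulf_neq0 ?gt_eqF ?sqrtr_gt0.
      by apply: cvgM => //; exact: cvg_id.
    - apply: (@continuous_comp _ _ _ (fun s : R => - (y ^+ 2 / s)) expR); last exact: continuous_expR.
      by apply: cvgN; apply: cvgM => //; exact: cvg_cst.
    - apply: cvgV; first by rewrite gt_eqF// sqrtr_gt0 subr_gt0.
      apply: (@continuous_comp _ _ _ (fun s : R => r - s) Num.sqrt); last exact: sqrt_continuous.
      by apply: cvgB; [exact: cvg_cst|exact: cvg_id].
  - apply: cvgM; first exact: cvg_cst.
    apply: gauss_primitive_cvgy.
    under eq_fun => n do rewrite /v vE ?divr_gt0//.
    apply: cvgMy; first by rewrite divr_gt0// sqrtr_gt0.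
    apply: cvgy_sqrt.
    rewrite (_ : (fun n => _) = (fun n => (n + 2)%:R)); first exact: cvgyn.
    apply/funext => n; rewrite -[n.+3]addn3 (natrD _ n 3) (natrD _ n 2); field.
    have n3 : n%:R + 3 != 0 :> R by rewrite -(natrD _ n 3) pnatr_eq0 addn3.
    by rewrite n3 gt_eqF.
  - apply: cvgM; first exact: cvg_cst.
    apply: gauss_primitive_cvg0.
      by move=> n; rewrite /v mulr_ge0// divr_ge0 ?sqrtr_ge0// ltW.
    have bn n : 0 < r - r / n.+3%:R by rewrite subr_gt0 ltr_pdivrMr// ltr_pMr// ltr1n.
    under eq_fun => n do rewrite /v vE//.
    rewrite -(mulr0 (y / Num.sqrt r)); apply: cvgM; first exact: cvg_cst.
    apply: cvg0_sqrt.
    rewrite (_ : (fun n => _) = (fun n => n.+2%:R^-1)).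
      by have := @cvg_harmonic R; rewrite -cvg_shiftS; exact.
    apply/funext => n; rewrite -[n.+3]addn3 -[n.+2]addn2 (natrD _ n 3) (natrD _ n 2).
    have n3 : n%:R + 3 != 0 :> R by rewrite -(natrD _ n 3) pnatr_eq0 addn3.
    have n2 : n%:R + 2 != 0 :> R by rewrite -(natrD _ n 2) pnatr_eq0 addn2.
    have -> : r - r / (n%:R + 3) = r * (n%:R + 2) / (n%:R + 3) by field.
    by field; rewrite n3 n2 gt_eqF.
transitivity (\int[mu]_(s in `]0%R, r[) (f s)%:E)%E; last first.
  rewrite step /K; congr EFin; field; rewrite gt_eqF// sqrtr_gt0//.
rewrite [RHS]integral_mkcond; apply: eq_integral => s _.
rewrite patchE; case: ifPn => //; rewrite notin_setE/= in_itv/= => /negP.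
rewrite negb_and -!leNgt => /orP h; congr EFin; apply: f0.
by case: h => h; [left|right].
Unshelve. all: by end_near. Qed.

End kernels.

Section subordination.
Context {R : realType}.
Let mu := @lebesgue_measure R.
(** In the application m k is the absolute value of an eigenvalue, and b k its sign times the real
    or imaginary part of the diagonal coefficient of g. *)
Variables (b m : R^nat) (A H : R -> R) (y : R).
Hypotheses (y0 : 0 < y) (m0 : forall k, 0 < m k).
Hypothesis bfin : forall s : R, 0 < s ->
  (\sum_(k <oo) (`|b k| * expR (- s * m k ^+ 2))%:E < +oo)%E.
Hypothesis bA : forall s : R, 0 < s ->
  series (fun k => b k * expR (- s * m k ^+ 2)) @ \oo --> A s.
Hypothesis bH : forall s : R, 0 < s ->
  series (fun k => b k * m k * expR (- s * m k ^+ 2)) @ \oo --> H s.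
Hypothesis intH :
  mu.-integrable `]0, +oo[ (EFin \o (fun s => H s / Num.sqrt s)).

(** The values of [H] at s <= 0 are arbitrary; extension by 0 lets all integrals run over the
    line. *)
Let H0 := H \_ (`]0, +oo[ : set R).

Let mexp (c : R) : measurable_fun setT (fun r : R => expR (- r * c)).
Proof. by apply: measurableT_comp => //; apply: measurable_funM. Qed.

Let minvsqrt (s : R) : measurable_fun setT (fun r : R => (Num.sqrt (r - s))^-1).
Proof.
apply: (measurableT_comp measurable_invr).
apply: (@measurableT_comp _ _ _ _ _ _ (@Num.sqrt R)).
  by apply: continuous_measurable_fun; exact: sqrt_continuous.
exact: measurable_funB.
Qed.

Let mterm (k : nat) (s : R) :
  measurable_fun setT (fun r : R => expR (- r * m k ^+ 2) / Num.sqrt (r - s)).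
Proof. by apply: measurable_funM. Qed.

Let iterm (k : nat) (s : R) : mu.-integrable setT
  (EFin \o (fun r : R => expR (- r * m k ^+ 2) / Num.sqrt (r - s))).
Proof.
apply/integrableP; split; first by apply/measurable_EFinP; exact: mterm.
under eq_integral => r _.
  rewrite /= ger0_norm; last by rewrite divr_ge0 ?expR_ge0 ?sqrtr_ge0.
  over.
by rewrite integral_expR_invsqrt// ltry.
Qed.

(* Termwise integration of 1/m = pi^(-1/2) int_0^oo u^(-1/2) exp(-u m^2) du. *)
Lemma integral_subordination (s : R) : 0 < s ->
  mu.-integrable setT (EFin \o (fun r => H0 r / Num.sqrt (r - s))) /\
  (\int[mu]_r (H0 r / Num.sqrt (r - s))%:E = (Num.sqrt pi * A s)%:E)%E.
Proof.
move=> s0.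
pose D : set R := `]s, +oo[%classic.
pose t (k : nat) (r : R) := expR (- r * m k ^+ 2) / Num.sqrt (r - s).
pose S n r := \sum_(0 <= k < n) b k * m k * t k r.
(* Dominates all partial sums. The integral of its k-th term is sqrt(pi) |b k| exp(-s (m k)^2),
   since the kernel integral supplies 1 / m k; so [bfin] makes it integrable. *)
pose g r := (\sum_(k <oo) (`|b k| * m k * t k r)%:E)%E.
have t0 k r : 0 <= t k r by rewrite divr_ge0 ?expR_ge0 ?sqrtr_ge0.
have mg : measurable_fun setT g.
  apply: ge0_emeasurable_sum => [k r _ _|k _].
    by rewrite lee_fin !mulr_ge0// ltW.
  by apply/measurable_EFinP; apply: measurable_funM => //; exact: mterm.
have ig : mu.-integrable setT g.
  apply/integrableP; split => //.
  under eq_integral => r _.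
    rewrite gee0_abs; last by apply: nneseries_ge0 => k _ _; rewrite lee_fin !mulr_ge0// ltW.
    over.
  rewrite integral_nneseries//; last 2 first.
  - by move=> k; apply/measurable_EFinP; apply: measurable_funM => //; exact: mterm.
  - by move=> k r _; rewrite lee_fin !mulr_ge0// ltW.
  have E k : (\int[mu]_r (`|b k| * m k * t k r)%:E =
      (Num.sqrt pi)%:E * (`|b k| * expR (- s * m k ^+ 2))%:E)%E.
    under eq_integral do rewrite EFinM.
    rewrite integralZl//; last exact: iterm.
    rewrite integral_expR_invsqrt// -!EFinM; congr EFin.
    by field; rewrite gt_eqF.
  under eq_eseriesr do rewrite E.
  rewrite nneseriesZl; last by move=> k _; rewrite lee_fin mulr_ge0 ?expR_ge0.
  by rewrite lte_mul_pinfty ?lee_fin ?sqrtr_ge0// bfin.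
have tD k r : r <= s -> t k r = 0.
  by rewrite -subr_le0 => rs; rewrite /t ler0_sqrtr// invr0 mulr0.
have mS n : measurable_fun setT (S n).
  by apply: measurable_sum => k; apply: measurable_funM => //; exact: mterm.
have Scv r : S n r @[n --> \oo] --> H0 r / Num.sqrt (r - s).
  have [rs|rs] := leP r s.
    rewrite ler0_sqrtr ?subr_le0// invr0 mulr0.
    apply: cvg_near_cst; apply: nearW => n.
    by rewrite /S big1// => k _; rewrite tD// mulr0.
  have r0 : 0 < r by exact: lt_trans rs.
  rewrite /H0 patchE mem_set/=; last by rewrite in_itv/= r0.
  rewrite (_ : (fun n => S n r) = (fun n =>
    series (fun k => b k * m k * expR (- r * m k ^+ 2)) n / Num.sqrt (r - s))).
    by apply: cvgM; [exact: bH|exact: cvg_cst].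
  apply/funext => n; rewrite /S /series/= mulr_suml.
  by apply: eq_bigr => k _; rewrite /t mulrA.
have mH : measurable_fun setT (fun r => H0 r / Num.sqrt (r - s)).
  by apply: (measurable_fun_cvg mS) => r _; exact: Scv.
have Sg n r : (`|(S n r)%:E| <= g r)%E.
  rewrite /= (@le_trans _ _ (\sum_(0 <= k < n) (`|b k| * m k * t k r)%:E)%E)//.
    rewrite sumEFin lee_fin (le_trans (ler_norm_sum _ _ _))//.
    apply: ler_sum => k _; rewrite normrM normrM (ger0_norm (t0 k r)).
    by rewrite (gtr0_norm (m0 k)).
  apply: nneseries_lim_ge => k _; by rewrite lee_fin !mulr_ge0// ltW.
have [|||||i1 _ i2] := @dominated_convergence _ _ _ mu setT measurableT
    (fun n => EFin \o S n) (EFin \o (fun r => H0 r / Num.sqrt (r - s))) g.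
- by move=> n; apply/measurable_EFinP; exact: mS.
- by apply/measurable_EFinP; exact: mH.
- by apply: aeW => r _; apply: cvg_EFin; [exact: nearW|exact: Scv].
- exact: ig.
- by apply: aeW => r n _; exact: Sg.
split => //.
have ES n : (\int[mu]_r (EFin \o S n) r =
    (Num.sqrt pi * series (fun k => b k * expR (- s * m k ^+ 2)) n)%:E)%E.
  rewrite /comp /S /series /=.
  under eq_integral do rewrite -sumEFin.
  rewrite integral_sum//; last by move=> k; apply: integrable_mulr => //; exact: iterm.
  rewrite mulr_sumr -sumEFin; apply: eq_bigr => k _.
  under eq_integral do rewrite EFinM.
  rewrite integralZl//; last exact: iterm.
  rewrite integral_expR_invsqrt// -!EFinM; congr EFin.
  by field; rewrite gt_eqF.
have i3 : ((\int[mu]_r (EFin \o S n) r)%E @[n --> \oo] --> (Num.sqrt pi * A s)%:E)%E.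
  under eq_fun do rewrite ES.
  apply: cvg_EFin; first exact: nearW.
  by apply: cvgM; [exact: cvg_cst|exact: bA].
exact: cvg_unique i2 i3.
Qed.

Let hk (s : R) := y / (s * Num.sqrt s) * expR (- (y ^+ 2 / s)).

Let hk0 s : s <= 0 -> hk s = 0.
Proof. by move=> s0; rewrite /hk ler0_sqrtr// mulr0 invr0 mulr0 mul0r. Qed.

Let hk_ge0 s : 0 <= hk s.
Proof.
have [s0|s0] := leP s 0; first by rewrite hk0.
by rewrite /hk mulr_ge0 ?expR_ge0// divr_ge0 ?mulr_ge0 ?sqrtr_ge0 ?ltW.
Qed.

Let msqrt : measurable_fun setT (@Num.sqrt R).
Proof. by apply: continuous_measurable_fun; exact: sqrt_continuous. Qed.

Let mhk : measurable_fun setT hk.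
Proof.
apply: measurable_funM.
  apply: measurable_funM => //; apply: (measurableT_comp measurable_invr).
  exact: measurable_funM.
apply: measurableT_comp => //; apply: measurableT_comp => //.
by apply: measurable_funM => //; exact: measurable_invr.
Qed.

Let mH0 : measurable_fun setT H0.
Proof.
have mm : measurable_fun (`]0, +oo[ : set R) H.
  have m1 : measurable_fun (`]0, +oo[ : set R) (fun s => H s / Num.sqrt s * Num.sqrt s).
    apply: measurable_funM; last exact: measurable_funTS.
    by apply/measurable_EFinP; exact: measurable_int intH.
  apply: eq_measurable_fun m1 => s; rewrite inE/= in_itv/= andbT => s0.
  by rewrite divfK// gt_eqF// sqrtr_gt0.
exact/(measurable_restrictT _ _).1.
Qed.

(** Absolute integrability of the double integral is tested with the s-integral inside: there the
    kernel is nonnegative and explicit, and its integral is bounded by sqrt(pi / r), so [intH]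
    suffices. Integrating in r instead yields the transform of A, whose integrability is thus a
    consequence. *)
Lemma heat_transform_subordination :
  mu.-integrable `]0, +oo[
    (EFin \o (fun s => y / (s * Num.sqrt s) * expR (- (y ^+ 2 / s)) * A s)) /\
  Rintegral mu `]0, +oo[
    (fun s => y / (s * Num.sqrt s) * expR (- (y ^+ 2 / s)) * A s) =
  Rintegral mu `]0, +oo[ (fun s => H s / Num.sqrt s * expR (- (y ^+ 2 / s))).
Proof.
pose f (z : R * R) : \bar R := (hk z.1 * (H0 z.2 / Num.sqrt (z.2 - z.1)))%:E.
have mf : measurable_fun setT f.
  apply/measurable_EFinP; apply: measurable_funM.
    exact: (measurableT_comp mhk).
  apply: measurable_funM; first exact: (measurableT_comp mH0).
  apply: (measurableT_comp measurable_invr); apply: (measurableT_comp msqrt).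
  by apply: measurable_funB.
have inner r : (\int[mu]_s (hk s / Num.sqrt (r - s))%:E =
    (Num.sqrt pi / Num.sqrt r * expR (- (y ^+ 2 / r)))%:E)%E.
  exact: integral_heat_invsqrt.
have mi r : measurable_fun setT (fun s => hk s / Num.sqrt (r - s)).
  apply: measurable_funM => //.
  apply: (measurableT_comp measurable_invr); apply: (measurableT_comp msqrt).
  by apply: measurable_funB.
have hk_i r s : 0 <= hk s / Num.sqrt (r - s) by rewrite divr_ge0// sqrtr_ge0.
have ii r : mu.-integrable setT (EFin \o (fun s => hk s / Num.sqrt (r - s))).
  apply/integrableP; split; first by apply/measurable_EFinP; exact: mi.
  under eq_integral do rewrite /= ger0_norm//.
  by rewrite inner ltry.
have H0E : forall r, H0 r / Num.sqrt r = ((fun r => H r / Num.sqrt r) \_ (`]0, +oo[ : set R)) r.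
  by move=> r; rewrite /H0 !patchE; case: ifPn => //; rewrite mul0r.
have iH0 : mu.-integrable setT (EFin \o (fun r => H0 r / Num.sqrt r)).
  rewrite (_ : (fun r => H0 r / Num.sqrt r) = (fun r => H r / Num.sqrt r) \_ (`]0, +oo[ : set R)).
    by rewrite -restrict_EFin; apply/integrable_restrict => //; rewrite setTI.
  exact/funext.
have e1 (r : R) : 0 < r -> expR (- (y ^+ 2 / r)) <= 1.
  by move=> r0; rewrite expR_le1 oppr_le0 divr_ge0 ?sqr_ge0// ltW.
have fE r s : f (s, r) = ((H0 r)%:E * (hk s / Num.sqrt (r - s))%:E)%E.
  by rewrite /f/= -EFinM; congr EFin; ring.
have G r : (\int[mu]_s f (s, r) = (Num.sqrt pi * (H0 r / Num.sqrt r * expR (- (y ^+ 2 / r))))%:E)%E.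
  under eq_integral do rewrite fE.
  rewrite (integralZl measurableT (ii r)).
  transitivity ((H0 r)%:E * (Num.sqrt pi / Num.sqrt r * expR (- (y ^+ 2 / r)))%:E)%E.
    by apply: (congr1 (fun z => (H0 r)%:E * z)%E); exact: inner.
  by rewrite -EFinM; congr EFin; ring.
have Gabs r : (\int[mu]_s `|f (s, r)| =
    (Num.sqrt pi * `|H0 r / Num.sqrt r * expR (- (y ^+ 2 / r))|)%:E)%E.
  under eq_integral do rewrite fE abseM [X in (_ * X)%E]gee0_abs ?lee_fin//.
  rewrite ge0_integralZl//; last 2 first.
  - by apply/measurable_EFinP; exact: mi.
  - by move=> s _; rewrite lee_fin.
  rewrite inner -EFinM; congr EFin.
  by rewrite !normrM (ger0_norm (expR_ge0 _)) [`|(Num.sqrt r)^-1|]ger0_norm ?invr_ge0 ?sqrtr_ge0//; ring.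
have mHe : measurable_fun setT (fun r => H0 r / Num.sqrt r * expR (- (y ^+ 2 / r))).
  apply: measurable_funM; first by apply/measurable_EFinP; exact: measurable_int iH0.
  apply: measurableT_comp => //; apply: measurableT_comp => //.
  by apply: measurable_funM => //; exact: measurable_invr.
have leHe r : `|H0 r / Num.sqrt r * expR (- (y ^+ 2 / r))| <= `|H0 r / Num.sqrt r|.
  rewrite normrM.
  have [r0|r0] := leP r 0; first by rewrite (ler0_sqrtr r0) invr0 mulr0 normr0 mul0r.
  by rewrite ler_piMr// ger0_norm ?expR_ge0// e1.
have iHe : mu.-integrable setT (EFin \o (fun r => H0 r / Num.sqrt r * expR (- (y ^+ 2 / r)))).
  apply: (le_integrable measurableT _ _ iH0); first by apply/measurable_EFinP; exact: mHe.
  by move=> r _; rewrite lee_fin; exact: leHe.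
have fint : (mu \x mu)%E.-integrable setT f.
  apply/integrable21ltyP => //.
  under eq_integral do rewrite Gabs.
  have /integrableP[_] := integrable_mulr measurableT (Num.sqrt pi) iHe.
  apply: le_lt_trans; rewrite le_eqVlt; apply/orP; left; apply/eqP.
  apply: eq_integral => r _ /=; congr EFin.
  by rewrite [in RHS]normrM [`|Num.sqrt pi|]ger0_norm ?sqrtr_ge0.
have F s : (\int[mu]_r f (s, r) = (hk s * (Num.sqrt pi * A s))%:E)%E.
  have [s0|s0] := leP s 0.
    by rewrite hk0// mul0r; apply: integral0_eq => r _; rewrite /f/= hk0// mul0r.
  have [i1 e] := integral_subordination s0.
  rewrite /f/=; under eq_integral do rewrite EFinM.
  by rewrite integralZl// e EFinM.
have iF := integrable_fubini_F fint.
rewrite /fubini_F in iF.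
have iF' : mu.-integrable setT (EFin \o (fun s => hk s * (Num.sqrt pi * A s))).
  by apply: eq_integrable iF => // s _; rewrite F.
have sp0 : Num.sqrt pi != 0 :> R by rewrite gt_eqF// sqrtr_gt0 pi_gt0.
have hkA : (fun s => hk s * A s) = (fun s => (Num.sqrt pi)^-1 * (hk s * (Num.sqrt pi * A s))).
  by apply/funext => s; field.
have iA : mu.-integrable setT (EFin \o (fun s => hk s * A s)).
  by rewrite hkA; exact: integrable_mulr.
split; first exact: integrableS iA.
have Fub : (\int[mu]_s (hk s * (Num.sqrt pi * A s))%:E =
    \int[mu]_r (Num.sqrt pi * (H0 r / Num.sqrt r * expR (- (y ^+ 2 / r))))%:E)%E.
  have := Fubini fint; under eq_integral do rewrite F.
  by move=> ->; apply: eq_integral => r _; exact: G.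
have E1 : Rintegral mu setT (fun s => hk s * A s) =
    Rintegral mu setT (fun r => H0 r / Num.sqrt r * expR (- (y ^+ 2 / r))).
  apply: (mulfI sp0); rewrite -!RintegralZl//.
  rewrite /Rintegral -Fub; congr fine; apply: eq_integral => s _.
  by congr EFin; ring.
rewrite Rintegral_mkcond [RHS]Rintegral_mkcond.
transitivity (Rintegral mu setT (fun s => hk s * A s)).
  congr Rintegral; apply/funext => s; rewrite patchE; case: ifPn => //.
  rewrite notin_setE/= in_itv/= andbT => /negP; rewrite -leNgt => s0.
  by rewrite hk0// mul0r.
rewrite E1; congr Rintegral; apply/funext => r; rewrite H0E !patchE.
by case: ifPn => // _; rewrite mul0r.
Qed.

End subordination.

(** * Eigenvalue sums and traces *)

Section summation_by_fibres.
Context {R : realType}.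

Lemma nneseries_fine_cvg (f : nat -> R) : (forall k, 0 <= f k) ->
  (\sum_(k <oo) (f k)%:E < +oo)%E ->
  series f @ \oo --> fine (\esum_(k in [set: nat]) (f k)%:E).
Proof.
move=> f0 foo.
rewrite -nneseries_esumT; last by move=> k; rewrite lee_fin.
have c : cvgn (fun n => (\sum_(0 <= k < n) (f k)%:E)%E).
  by apply: is_cvg_nneseries => k _ _; rewrite lee_fin.
have h : (series f n)%:E @[n --> \oo] --> (\sum_(k <oo) (f k)%:E)%E.
  by under eq_fun do rewrite /series/= -sumEFin.
apply: (@fine_cvg _ _ _ _ (EFin \o series f)); rewrite fineK//.
rewrite ge0_fin_numE//; apply: nneseries_ge0 => k _ _; by rewrite lee_fin.
Qed.

(** Absolute convergence lets the series be regrouped by the values of [lam]. Every fibre is finite,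
    and a point of [S] with empty fibre contributes 0, so [S] may exceed the set of values taken. *)
Lemma Rsum_fibres (S : set R) (lam x : nat -> R) (al : pred nat) (w t : R -> R) :
  (forall k, al k -> S (lam k)) ->
  (forall l, S l -> exists2 N, (forall k, al k -> lam k = l -> (k < N)%N) &
     t l = \sum_(0 <= k < N | al k && (lam k == l)) x k) ->
  (\sum_(k <oo) `|if al k then x k * w (lam k) else 0|%:E < +oo)%E ->
  summable S (fun l => (t l * w l)%:E) /\
  series (fun k => if al k then x k * w (lam k) else 0) @ \oo
    --> Rsum S (fun l => t l * w l).
Proof.
move=> alS fib foo.
pose y k := if al k then x k * w (lam k) else 0.
pose yp k := Num.max (y k) 0; pose yn k := Num.max (- y k) 0.
have yE k : y k = yp k - yn k.
  rewrite /yp /yn; have [y0|y0] := leP (y k) 0.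
    by rewrite max_l ?oppr_ge0// sub0r opprK.
  by rewrite max_r ?subr0// oppr_le0 ltW.
have yp0 k : 0 <= yp k by rewrite le_max lexx orbT.
have yn0 k : 0 <= yn k by rewrite le_max lexx orbT.
have yple k : yp k <= `|y k| by rewrite ge_max ler_norm normr_ge0.
have ynle k : yn k <= `|y k| by rewrite ge_max -normrN ler_norm normr_ge0.
have le_foo (z : nat -> R) : (forall k, 0 <= z k) -> (forall k, z k <= `|y k|) ->
    (\sum_(k <oo) (z k)%:E < +oo)%E.
  move=> z0 zy; apply: le_lt_trans foo.
  by apply: lee_nneseries => k _; rewrite lee_fin.
have ypoo := le_foo _ yp0 yple; have ynoo := le_foo _ yn0 ynle.
pose K l : set nat := [set k | al k /\ lam k = l].
have trK : trivIset [set: R] K.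
  by move=> i j _ _ [k [[_ <-] [_ <-]]].
have esumK (z : nat -> R) : (forall k, 0 <= z k) -> (forall k, ~~ al k -> z k = 0) ->
    (\esum_(k in [set: nat]) (z k)%:E = \esum_(l in S) \esum_(k in K l) (z k)%:E)%E.
  move=> z0 zal.
  rewrite esum_esum; last by move=> *; rewrite lee_fin.
  (* The graph k |-> (lam k, k) turns the double sum over fibres into a sum over indices. *)
  rewrite (@reindex_esum _ _ _ [set k | al k] _ (fun k => (lam k, k)))/=; last first.
    split.
    - by move=> k /= alk; split => //; exact: alS.
    - by move=> i j _ _ [].
    - by move=> [l k] /= [_ [alk <-]]; exists k.
  rewrite [RHS]esum_mkcond; apply: eq_esum => k _; case: ifPn => //.
  by rewrite notin_setE/= => /negP /zal ->.
have yp_al k : ~~ al k -> yp k = 0 by rewrite /yp /y => /negbTE ->; rewrite maxxx.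
have yn_al k : ~~ al k -> yn k = 0 by rewrite /yn /y => /negbTE ->; rewrite oppr0 maxxx.
(* Terms within a fibre may cancel, so P and Q are not the positive and negative parts of t l * w l;
   only the difference of their sums agrees, by additivity on summable families. *)
pose P l := (\esum_(k in K l) (yp k)%:E)%E; pose Q l := (\esum_(k in K l) (yn k)%:E)%E.
have P0 l : (0 <= P l)%E by apply: esum_ge0 => k _; rewrite lee_fin.
have Q0 l : (0 <= Q l)%E by apply: esum_ge0 => k _; rewrite lee_fin.
have twE l : S l -> (t l * w l)%:E = (P l - Q l)%E.
  move=> Sl; have [N NP tE] := fib _ Sl.
  have E (z : nat -> R) : (forall k, 0 <= z k) ->
     (\esum_(k in K l) (z k)%:E = (\sum_(0 <= k < N | al k && (lam k == l)) z k)%:E)%E.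
    move=> z0; rewrite (_ : K l = [set k | al k && (lam k == l)]); last first.
      by apply/seteqP; split => k /=; [move=> [-> ->]; rewrite eqxx|move=> /andP[? /eqP]].
    rewrite -nneseries_esum; last by move=> k _; rewrite lee_fin.
    apply/cvg_lim => //; apply: cvg_near_cst; exists N => // n /= Nn.
    rewrite (big_cat_nat (leq0n N) Nn)//= [X in (_ + X)%E]big1_seq; first by rewrite adde0 sumEFin.
    move=> k /andP[/andP[alk /eqP lk]]; rewrite mem_index_iota => /andP[Nk _].
    by have := NP _ alk lk; rewrite ltnNge Nk.
  rewrite /P /Q !E// -EFinB -sumrB tE mulr_suml; congr EFin.
  by apply: eq_bigr => k /andP[alk /eqP <-]; rewrite -yE /y alk.
have sP : summable S P.
  rewrite /summable; under eq_esum do rewrite gee0_abs//.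
  by rewrite -esumK// -nneseries_esumT// => k; rewrite lee_fin.
have sQ : summable S Q.
  rewrite /summable; under eq_esum do rewrite gee0_abs//.
  by rewrite -esumK// -nneseries_esumT// => k; rewrite lee_fin.
have sPQ := summableB sP sQ.
have stw : summable S (fun l => (t l * w l)%:E).
  move: sPQ; rewrite /summable (@eq_esum _ _ S _ (fun l => `|(t l * w l)%:E|)%E)//.
  by move=> l Sl; rewrite -twE.
split => //.
have -> : Rsum S (fun l => t l * w l) =
    fine (\esum_(k in [set: nat]) (yp k)%:E) - fine (\esum_(k in [set: nat]) (yn k)%:E).
  have fin_num (z : R -> \bar R) : summable S z -> (forall l, 0 <= z l)%E ->
      (\esum_(l in S) z l)%E \is a fin_num.
    by move=> sz z0; move: sz; rewrite summableE; under eq_esum do rewrite gee0_abs//.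
  rewrite /Rsum !esumK//.
  rewrite -[RHS]fineB; [|exact: (fin_num P)|exact: (fin_num Q)].
  rewrite -(esumB sP sQ)//.
  have fp : summable S (P \- Q)^\+%E by exact: summable_funepos.
  have fn : summable S (P \- Q)^\-%E by exact: summable_funeneg.
  rewrite fineB; [|by apply: fin_num => // l; exact: funepos_ge0|by apply: fin_num => // l; exact: funeneg_ge0].
  congr (fine _ - fine _); apply: eq_esum => l Sl.
    by rewrite funeposE -twE// -EFin_max.
  by rewrite funenegE -twE// -EFinN -EFin_max.
rewrite (_ : series _ = series yp \- series yn).
  by apply: cvgB; exact: nneseries_fine_cvg.
apply/funext => n; rewrite /series/= -sumrB; apply: eq_bigr => k _; exact: yE.
Qed.

End summation_by_fibres.

Lemma ReD (R : realType) (z w : R[i]) :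
  complex.Re (z + w) = complex.Re z + complex.Re w.
Proof. by case: z w => [? ?] [? ?]. Qed.

Lemma ImD (R : realType) (z w : R[i]) :
  complex.Im (z + w) = complex.Im z + complex.Im w.
Proof. by case: z w => [? ?] [? ?]. Qed.

Lemma Re_sum (R : realType) I (r : seq I) (p : pred I) (F : I -> R[i]) :
  complex.Re (\sum_(k <- r | p k) F k) = \sum_(k <- r | p k) complex.Re (F k).
Proof. by apply: (big_morph _ (@ReD R)). Qed.

Lemma Im_sum (R : realType) I (r : seq I) (p : pred I) (F : I -> R[i]) :
  complex.Im (\sum_(k <- r | p k) F k) = \sum_(k <- r | p k) complex.Im (F k).
Proof. by apply: (big_morph _ (@ImD R)). Qed.

Lemma ReZ (R : realType) (c : R) (z : R[i]) :
  complex.Re (c%:C%C * z) = c * complex.Re z.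
Proof. by case: z => x y /=; rewrite mul0r subr0. Qed.

Lemma ImZ (R : realType) (c : R) (z : R[i]) :
  complex.Im (c%:C%C * z) = c * complex.Im z.
Proof. by case: z => x y /=; rewrite mul0r addr0. Qed.

Lemma Re_norm (R : realType) (z : R[i]) :
  complex.Re `|z| = Num.sqrt (complex.Re z ^+ 2 + complex.Im z ^+ 2).
Proof. by rewrite normc_def. Qed.

Lemma ler_Re_norm (R : realType) (z : R[i]) : `|complex.Re z| <= complex.Re `|z|.
Proof.
by rewrite Re_norm -sqrtr_sqr ler_wsqrtr// lerDl sqr_ge0.
Qed.

Lemma ler_Im_norm (R : realType) (z : R[i]) : `|complex.Im z| <= complex.Re `|z|.
Proof.
by rewrite Re_norm -sqrtr_sqr ler_wsqrtr// lerDr sqr_ge0.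
Qed.

Lemma conjcM (R : realType) (z w : R[i]) : ((z * w)^*)%C = (z^*)%C * (w^*)%C.
Proof. exact: rmorphM. Qed.

Lemma conjc_sum (R : realType) I (r : seq I) (F : I -> R[i]) :
  ((\sum_(k <- r) F k)^*)%C = \sum_(k <- r) ((F k)^*)%C.
Proof. exact: rmorph_sum. Qed.

Lemma sum_nat_uniq (R : nmodType) (F : nat -> R) (s : seq nat) n : uniq s ->
  (forall k, k \in s -> (k < n)%N) -> (forall k, k \notin s -> F k = 0) ->
  \sum_(0 <= k < n) F k = \sum_(k <- s) F k.
Proof.
move=> us sn F0.
rewrite [RHS](perm_big [seq k <- index_iota 0 n | k \in s]); last first.
  apply: uniq_perm => //; first by rewrite filter_uniq ?iota_uniq.
  move=> k; rewrite mem_filter mem_index_iota/=.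
  by case: (boolP (k \in s)) => // /sn ->.
rewrite big_filter [RHS]big_mkcond.
by apply: eq_bigr => k _; case: ifPn => // /F0.
Qed.

(** * Sections as vectors: linear combinations and spans *)

Section sections.
Context {R : realType} {X : Type} {E : bundle R X}.
Implicit Types u v w : sec E.

Definition sec0 : sec E := fun=> 0.
Definition comb (a : R[i]) u v : sec E := fun x => a *: u x + v x.

(* Linear combinations of smooth sections are smooth too, but the algebra of inner
   products below only needs them to have continuous pairings. *)
Inductive lspan (P : set (sec E)) : sec E -> Prop :=
| lspan_in u : P u -> lspan P u
| lspan_0 : lspan P sec0
| lspan_comb a u v : lspan P u -> lspan P v -> lspan P (comb a u v).

Lemma secP u v : sec_eq u v -> u = v.
Proof. exact: functional_extensionality_dep. Qed.

Lemma scale_sec a u : (fun x => a *: u x) = comb a u sec0.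
Proof. by apply: secP => x; rewrite /comb addr0. Qed.

Lemma sum_sec_nil I (a : I -> R[i]) (b : I -> sec E) :
  (fun x => \sum_(k <- [::]) a k *: b k x) = sec0.
Proof. by apply: secP => x; rewrite big_nil. Qed.

Lemma sum_sec_cons I (a : I -> R[i]) (b : I -> sec E) i r :
  (fun x => \sum_(k <- i :: r) a k *: b k x) =
  comb (a i) (b i) (fun x => \sum_(k <- r) a k *: b k x).
Proof. by apply: secP => x; rewrite big_cons. Qed.

Lemma lspan_sum P I (r : seq I) (a : I -> R[i]) (b : I -> sec E) :
  (forall k, lspan P (b k)) -> lspan P (fun x => \sum_(k <- r) a k *: b k x).
Proof.
move=> Pb; elim: r => [|i r IH]; first by rewrite sum_sec_nil; exact: lspan_0.
by rewrite sum_sec_cons; exact: lspan_comb.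
Qed.

End sections.

(** * Eigensections of a symmetric operator and traces on its eigenspaces *)

Section operator.
Context {R : realType} {X : Type} {E : bundle R X}.
Variables (inner : sec E -> sec E -> R[i]) (P : set (sec E)).
Variables (D T : sec E -> sec E).
Local Notation L := (lspan P).
Local Notation V := (Defs.eigenspace P D).
Hypothesis inner_lin : forall a u v w, L u -> L v -> L w ->
  inner (comb a u v) w = a * inner u w + inner v w.
Hypothesis inner_conj : forall u v, L u -> L v -> inner v u = (inner u v)^*%C.
Hypothesis inner_def : forall u, L u -> inner u u = 0 -> u = sec0.
Hypothesis D_sym : forall u v, P u -> P v -> inner (D u) v = inner u (D v).
Hypothesis D_gap : exists2 K : R, 0 < K & forall u, P u ->
  nrm2 inner u <= K * nrm2 inner (fun x => D u x - 0%:C%C *: u x).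
Hypothesis T_lin : forall a u v, T (comb a u v) = comb a (T u) (T v).
Hypothesis T_eig : forall l u, V l u -> V l (T u).
Hypothesis T_heat : forall s : R, 0 < s -> exists z, is_heat_trace inner P D T s z.

Lemma linear_sec0 : T sec0 = sec0.
Proof.
have e0 : comb (-1) sec0 sec0 = sec0 :> sec E.
  by apply: secP => x; rewrite /comb scaler0 addr0.
rewrite -{1}e0 T_lin; apply: secP => x.
by rewrite /comb scaleN1r addNr.
Qed.

Lemma linear_sec_scale a u : T (fun x => a *: u x) = (fun x => a *: T u x).
Proof. by rewrite !scale_sec T_lin linear_sec0. Qed.

Lemma linear_sec_sum I (r : seq I) (a : I -> R[i]) (b : I -> sec E) :
  T (fun x => \sum_(k <- r) a k *: b k x) =
  (fun x => \sum_(k <- r) a k *: T (b k) x).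
Proof.
elim: r => [|i r IH]; first by rewrite !sum_sec_nil linear_sec0.
by rewrite !sum_sec_cons T_lin IH.
Qed.

Lemma inner0l w : L w -> inner sec0 w = 0.
Proof.
move=> Lw; have e0 : comb (-1) sec0 sec0 = sec0 :> sec E.
  by apply: secP => x; rewrite /comb scaler0 addr0.
rewrite -{1}e0 inner_lin//; try exact: lspan_0.
by rewrite mulN1r addNr.
Qed.

Lemma inner_suml I (r : seq I) (a : I -> R[i]) (b : I -> sec E) w :
  (forall k, L (b k)) -> L w ->
  inner (fun x => \sum_(k <- r) a k *: b k x) w = \sum_(k <- r) a k * inner (b k) w.
Proof.
move=> Lb Lw; elim: r => [|i r IH]; first by rewrite sum_sec_nil big_nil inner0l.
by rewrite sum_sec_cons big_cons inner_lin ?IH//; exact: lspan_sum.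
Qed.

Lemma inner_scalel a u w : L u -> L w ->
  inner (fun x => a *: u x) w = a * inner u w.
Proof.
by move=> Lu Lw; rewrite scale_sec inner_lin ?inner0l ?addr0//; exact: lspan_0.
Qed.

Lemma inner_scaler a u w : L u -> L w ->
  inner w (fun x => a *: u x) = a^*%C * inner w u.
Proof.
move=> Lu Lw; have Lau : L (fun x => a *: u x).
  by rewrite scale_sec; apply: lspan_comb => //; exact: lspan_0.
by rewrite (inner_conj Lau Lw) inner_scalel// conjcM -(inner_conj Lu Lw).
Qed.

Lemma inner_real u : L u -> inner u u = ((nrm2 inner u)%:C)%C.
Proof.
move=> Lu; have := inner_conj Lu Lu; rewrite /nrm2.
case: (inner u u) => x y [] /= yN; congr Complex; lra.
Qed.

Lemma eig_L l u : V l u -> L u.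
Proof. by case=> Pu _; exact: lspan_in. Qed.

Lemma eig_D l u : V l u -> D u = (fun x => (l%:C)%C *: u x).
Proof. by case=> _ /secP. Qed.

Lemma inner_eig_ortho l l' u v : V l u -> V l' v -> l != l' -> inner u v = 0.
Proof.
move=> Vu Vv ll'.
have := D_sym Vu.1 Vv.1; rewrite (eig_D Vu) (eig_D Vv).
have Lu := eig_L Vu; have Lv := eig_L Vv.
rewrite inner_scalel// inner_scaler// conjc_real => /eqP.
rewrite -subr_eq0 -mulrBl mulf_eq0 => /orP[|/eqP//].
by rewrite subr_eq0 => /eqP[] h; rewrite h eqxx in ll'.
Qed.

(** On a unit eigensection the resolvent bound at 0 reads 1 <= K l^2. *)
Lemma eig_gap : exists2 c : R, 0 < c & forall l u, V l u ->
  inner u u = 1 -> c <= `|l|.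
Proof.
case: D_gap => K K0 KP; exists (Num.sqrt K^-1); first by rewrite sqrtr_gt0 invr_gt0.
move=> l u Vu u1; have := KP _ Vu.1.
rewrite (_ : (fun x => _) = (fun x => (l%:C)%C *: u x)); last first.
  by apply: secP => x; rewrite (eig_D Vu) scale0r subr0.
have Lu := eig_L Vu.
have Llu : L (fun x => (l%:C)%C *: u x).
  by rewrite scale_sec; apply: lspan_comb => //; exact: lspan_0.
rewrite /nrm2 inner_scalel// inner_scaler// u1 conjc_real mulr1 /=.
rewrite mul0r subr0 => h.
rewrite -sqrtr_sqr ler_wsqrtr// -div1r ler_pdivrMr// mulrC expr2 //.
Qed.

Section basis.
Variables (e : nat -> sec E) (lam : nat -> R).
Hypothesis eonb : onb inner P e.
Hypothesis elam : forall k, V (lam k) (e k).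

Let Le k : L (e k). Proof. exact: eig_L (elam k). Qed.

(** An orthonormal basis may contain zero entries here, and for these [lam k] is arbitrary; only the
    unit entries carry spectral information. *)
Let alive k := inner (e k) (e k) == 1.

Lemma dead_sec0 k : ~~ alive k -> e k = sec0.
Proof.
rewrite /alive; case: eonb => _ _ /(_ k)[->|/secP -> //] _.
by rewrite eqxx.
Qed.

(** Eigensections for different eigenvalues are orthogonal, so Parseval for u becomes a finite sum
    over s. Then u and its projection v have equal norms and the same pairing, so u - v has norm 0
    and vanishes by definiteness. *)
Lemma eig_expansion l (s : seq nat) u : uniq s -> (forall k, alive k -> lam k = l -> k \in s) ->
  (forall k, k \in s -> alive k) ->
  V l u -> u = (fun x => \sum_(k <- s) inner u (e k) *: e k x).
Proof.
move=> us sP sal Vu.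
have Lu := eig_L Vu.
case: eonb => Pe eo _ /(_ _ Vu.1) pars.
pose v : sec E := fun x => \sum_(k <- s) inner u (e k) *: e k x.
have Lv : L v by exact: lspan_sum.
have z k : k \notin s -> inner u (e k) = 0.
  move=> ks; case: (boolP (alive k)) => [ak|/dead_sec0 ->]; last first.
    by rewrite (inner_conj (lspan_0 P) Lu) inner0l// conjc0.
  apply: (inner_eig_ortho Vu (elam k)); apply: contra ks => /eqP lk.
  exact: sP.
have uu : inner u u = \sum_(k <- s) `|inner u (e k)| ^+ 2.
  rewrite inner_real//.
  have -> : nrm2 inner u = \sum_(k <- s) complex.Re (`|inner u (e k)| ^+ 2).
    apply: EFin_inj; rewrite -pars; apply/cvg_lim => //.
    pose N := (\max_(k <- s) k.+1)%N.
    have kN k : k \in s -> (k < N)%N.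
      by move=> ks; rewrite /N (big_rem _ ks)/= leq_max leqnn.
    apply: cvg_near_cst; exists N => // n Nn.
    rewrite sumEFin; congr EFin; apply: sum_nat_uniq => // k ks.
      exact: leq_trans (kN _ ks) Nn.
    by rewrite z// normr0 expr0n.
  rewrite (raddf_sum (@real_complex_def R (Phant R))); apply: eq_bigr => k _.
  by rewrite -add_Re2_Im2.
have ve k : k \in s -> inner v (e k) = inner u (e k).
  move=> ks; rewrite inner_suml// (big_rem _ ks)/= (eqP (sal _ ks)) mulr1.
  rewrite big1_seq ?addr0// => j /andP[_].
  by rewrite mem_rem_uniq// inE => /andP[jk _]; rewrite eo ?mulr0.
have uv : inner u v = \sum_(k <- s) `|inner u (e k)| ^+ 2.
  rewrite (inner_conj Lv Lu) inner_suml// conjc_sum; apply: eq_bigr => k _.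
  by rewrite conjcM -(inner_conj (Le k) Lu) mulrC sqr_normc.
have vv : inner v v = \sum_(k <- s) `|inner u (e k)| ^+ 2.
  rewrite {1}/v inner_suml//; apply: eq_big_seq => k ks.
  by rewrite (inner_conj Lv (Le k)) ve// sqr_normc.
have vu : inner v u = \sum_(k <- s) `|inner u (e k)| ^+ 2.
  rewrite /v inner_suml//; apply: eq_big_seq => k ks.
  by rewrite (inner_conj Lu (Le k)) sqr_normc.
have Lw : L (comb (-1) v u) by exact: lspan_comb.
have : inner (comb (-1) v u) (comb (-1) v u) = 0.
  rewrite inner_lin// (inner_conj Lw Lv) (inner_conj Lw Lu) !inner_lin//.
  by rewrite vv uv vu uu mulN1r addNr.
move/(inner_def Lw) => w0.
apply: secP => x; have := congr1 (fun f : sec E => f x) w0.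
by rewrite /comb /sec0 scaleN1r addrC => /eqP; rewrite subr_eq0 => /eqP.
Qed.

(** [fin_trace] selects some admissible value, so beyond exhibiting the orthonormal basis one has to
    show that every basis yields the same trace. *)
Lemma fin_trace_eig l (s : seq nat) : uniq s ->
  (forall k, alive k -> lam k = l -> k \in s) ->
  (forall k, k \in s -> alive k /\ lam k = l) ->
  fin_trace (V l) T = \sum_(k <- s) inner (T (e k)) (e k).
Proof.
move=> us sP sl.
case: (eonb) => _ eo _ _.
pose n := size s; pose eps (j : 'I_n) := e (nth 0%N s j).
have eps_s (j : 'I_n) : nth 0%N s j \in s by rewrite mem_nth.
have Veps j : V l (eps j) by have [_ <-] := sl _ (eps_s j); exact: elam.
have Leps j : L (eps j) by exact: Le.
have epsE i j : inner (eps i) (eps j) = (i == j)%:R.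
  have [->|ij] := eqVneq i j; first by have [/eqP] := sl _ (eps_s j).
  by rewrite eo// nth_uniq.
have expand u : V l u -> u = (fun x => \sum_j inner u (eps j) *: eps j x).
  move=> Vu; rewrite {1}(@eig_expansion l s u us sP _ Vu); last by move=> k /sl[].
  by apply: secP => x; rewrite (big_nth 0%N) big_mkord.
have sumE : \sum_(k <- s) inner (T (e k)) (e k) = \sum_j inner (T (eps j)) (eps j).
  by rewrite (big_nth 0%N) big_mkord.
rewrite /fin_trace; apply: xget_subset1.
  exists n, eps, (\matrix_(j, k) inner (T (eps j)) (eps k)); split => //.
  - move=> u Vu; exists (\row_k inner u (eps k)); split.
      by move=> x; rewrite {1}(expand _ Vu); apply: eq_bigr => k _; rewrite mxE.
    move=> a /secP ua; apply/rowP => j; rewrite mxE ua inner_suml//.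
    rewrite (bigD1 j)//= epsE eqxx mulr1 big1 ?addr0// => i /negbTE ij.
    by rewrite epsE ij mulr0.
  - move=> j x; rewrite {1}(expand _ (T_eig (Veps j))).
    by apply: eq_bigr => k _; rewrite mxE.
  - by rewrite sumE; apply: eq_bigr => j _; rewrite mxE.
move=> t t' [m [b [A [Vb bcoord TA ->]]]] [m' [b' [A' [Vb' bcoord' TA' ->]]]].
suff key : forall m0 (b0 : 'I_m0 -> sec E) (A0 : 'M[R[i]]_m0), (forall k, V l (b0 k)) ->
    (forall u, V l u -> exists! a : 'rV[R[i]]_m0,
       sec_eq u (fun x => \sum_k a 0 k *: b0 k x)) ->
    (forall j, sec_eq (T (b0 j)) (fun x => \sum_k A0 j k *: b0 k x)) ->
    \tr A0 = \sum_j inner (T (eps j)) (eps j).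
  by rewrite (key _ _ _ Vb bcoord TA) (key _ _ _ Vb' bcoord' TA').
move=> {m b A Vb bcoord TA m' b' A' Vb' bcoord' TA'} m0 b0 A0 Vb bcoord TA.
have Lb k : L (b0 k) by exact: eig_L (Vb k).
have /choice[f fP] j : exists a : 'rV[R[i]]_m0, eps j = (fun x => \sum_k a 0 k *: b0 k x).
  by have [a [/secP ? _]] := bcoord _ (Veps j); exists a.
pose C := \matrix_(j, k) f j 0 k.
pose B := \matrix_(k, j) inner (b0 k) (eps j).
(* B and C are the changes between [b0] and [eps], rectangular because the two lengths are not known
   to agree. Uniqueness of coordinates gives B C = 1, and cyclicity tr A0 = tr (C A0 B). *)
have BC : B *m C = 1%:M.
  apply/row_matrixP => k; have [a [_ au]] := bcoord _ (Vb k).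
  rewrite -(au (row k 1%:M)); last first.
    move=> x; rewrite (bigD1 k)//= !mxE eqxx scale1r big1 ?addr0// => i /negbTE ik.
    by rewrite !mxE eq_sym ik scale0r.
  apply/esym/au => x; rewrite {1}(expand _ (Vb k)).
  have fx j : eps j x = \sum_k f j 0 k *: b0 k x by rewrite fP.
  under eq_bigr do rewrite fx scaler_sumr.
  rewrite exchange_big/=; apply: eq_bigr => i _; rewrite !mxE scaler_suml.
  by apply: eq_bigr => j _; rewrite !mxE scalerA.
rewrite -(mulmx1 A0) -BC mulmxA mxtrace_mulC mulmxA.
apply: eq_bigr => j _.
have -> : T (eps j) = (fun x => \sum_k f j 0 k *: T (b0 k) x).
  by rewrite -linear_sec_sum -fP.
rewrite inner_suml//; last by move=> k; exact: eig_L (T_eig (Vb k)).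
rewrite -mulmxA mxE; apply: eq_bigr => k _; rewrite !mxE; congr (_ * _).
have -> : T (b0 k) = (fun x => \sum_i A0 k i *: b0 i x) by exact: secP.
by rewrite inner_suml//; apply: eq_bigr => i _; rewrite mxE.
Qed.

(** The trace class condition on D e^(-s D^2), without the group element, tested on the eigenbasis
    paired with itself. *)
Lemma trace_class_fcalc (s : R) : 0 < s ->
  (\sum_(k <oo) (if alive k then `|lam k| * expR (- s * lam k ^+ 2) else 0)%:E < +oo)%E.
Proof.
move=> s0; have [z [Q [[_ _ _ _ Qe] /(_ _ _ eonb eonb) + _]]] := T_heat s0.
apply: le_lt_trans; apply: lee_nneseries => k _.
  by rewrite lee_fin; case: ifP => // _; rewrite mulr_ge0 ?expR_ge0.
rewrite lee_fin (secP (Qe _ _ (elam k))) inner_scalel//.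
case: ifPn => [/eqP ->|_]; last by rewrite Re_norm sqrtr_ge0.
by rewrite mulr1 Re_norm/= expr0n addr0 sqrtr_sqr normrM (ger0_norm (expR_ge0 _)).
Qed.

(** The terms of a convergent series tend to 0, so the positive value |l| exp(-l^2) recurs only
    finitely often; l = 0 is excluded by the gap. *)
Lemma finite_multiplicity l : exists N, forall k, alive k -> lam k = l -> (k < N)%N.
Proof.
have [c c0 cP] := eig_gap.
have [->|l0] := eqVneq l 0.
  exists 0%N => k /eqP ak lk; have := cP _ _ (elam k) ak.
  by rewrite lk normr0 leNgt c0.
pose f k := if alive k then `|lam k| * expR (- 1 * lam k ^+ 2) else 0.
have f0 k : 0 <= f k by rewrite /f; case: ifP => // _; rewrite mulr_ge0 ?expR_ge0.
have fcvg := nneseries_fine_cvg f0 (trace_class_fcalc ltr01).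
have /cvg_series_cvg_0/cvgr0Pnorm_lt : cvgn (series f) by apply/cvg_ex; eexists; exact: fcvg.
have e0 : 0 < `|l| * expR (- 1 * l ^+ 2) by rewrite mulr_gt0 ?expR_gt0 ?normr_gt0.
move=> /(_ _ e0)[N _ NP]; exists N => k ak lk; rewrite ltnNge; apply/negP => Nk.
by have := NP _ Nk; rewrite /= ger0_norm// /f ak lk ltxx.
Qed.

Lemma fin_trace_eigenspace l : exists2 N,
  (forall k, alive k -> lam k = l -> (k < N)%N) &
  fin_trace (V l) T = \sum_(0 <= k < N | alive k && (lam k == l)) inner (T (e k)) (e k).
Proof.
have [N NP] := finite_multiplicity l; exists N => //.
rewrite -big_filter; apply: fin_trace_eig.
- by rewrite filter_uniq ?iota_uniq.
- by move=> k ak lk; rewrite mem_filter ak lk eqxx/= mem_index_iota NP.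
- by move=> k; rewrite mem_filter => /andP[/andP[-> /eqP]].
Qed.

Lemma alive_spec k : alive k -> spec inner P D (lam k).
Proof.
move=> /eqP ak [_ [K _ /(_ _ (elam k).1)]].
rewrite (_ : (fun x => _) = sec0); last first.
  by apply: secP => x; rewrite (eig_D (elam k)) subrr.
rewrite /nrm2 ak (inner0l (lspan_0 P)) /= mulr0 => h.
by have := ltr01 (R := R); rewrite ltNge h.
Qed.

Lemma dead_trace k : ~~ alive k -> inner (T (e k)) (e k) = 0.
Proof. by move=> /dead_sec0 ->; rewrite linear_sec0 inner0l//; exact: lspan_0. Qed.

Lemma heat_trace_series (s : R) : 0 < s ->
  let x k := (lam k * expR (- s * lam k ^+ 2))%:C%C * inner (T (e k)) (e k) in
  [/\ (\sum_(k <oo) (complex.Re `|x k|)%:E < +oo)%E,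
      series (fun k => complex.Re (x k)) @ \oo
        --> complex.Re (heat_trace inner P D T s) &
      series (fun k => complex.Im (x k)) @ \oo
        --> complex.Im (heat_trace inner P D T s)].
Proof.
move=> s0 x.
have [Q [[_ _ _ _ Qe] _ [TQ hT]]] : is_heat_trace inner P D T s (heat_trace inner P D T s).
  by have [z zP] := T_heat s0; rewrite /heat_trace; apply: xgetPex; exists z.
have xE : x = (fun k => inner ((T \o Q) (e k)) (e k)).
  apply/funext => k; rewrite /x /= (secP (Qe _ _ (elam k))) linear_sec_scale inner_scalel//.
  exact: eig_L (T_eig (elam k)).
have [h1 h2] := hT _ eonb.
by rewrite xE; split => //; exact: TQ.
Qed.

End basis.

(** The eigenbasis is taken from the functional calculus at time 1. It serves all times, because the
    trace and the trace class bound hold in every orthonormal basis. *)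
Lemma eigen_data : exists (lam : nat -> R) (tau : nat -> R[i]) (al : pred nat) (c : R),
  [/\ [/\ 0 < c, forall k, al k -> c <= `|lam k|, forall k, ~~ al k -> tau k = 0
       & forall k, al k -> spec inner P D (lam k)],
      (forall l, exists2 N, (forall k, al k -> lam k = l -> (k < N)%N) &
         fin_trace (V l) T = \sum_(0 <= k < N | al k && (lam k == l)) tau k) &
      forall s : R, 0 < s ->
      let x k := (lam k * expR (- s * lam k ^+ 2))%:C%C * tau k in
      [/\ (\sum_(k <oo) (complex.Re `|x k|)%:E < +oo)%E,
        series (fun k => complex.Re (x k)) @ \oo
          --> complex.Re (heat_trace inner P D T s) &
        series (fun k => complex.Im (x k)) @ \oo
          --> complex.Im (heat_trace inner P D T s)]].
Proof.
have [c c0 cP] := eig_gap.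
have [z [Q [[[e [lam [eonb elam]]] _ _ _ _] _ _]]] := T_heat ltr01.
exists lam, (fun k => inner (T (e k)) (e k)), (fun k => inner (e k) (e k) == 1), c.
split; first split => //.
- by move=> k /eqP; exact: cP (elam k).
- by move=> k; exact: dead_trace.
- by move=> k; exact: alive_spec.
- exact: fin_trace_eigenspace.
- exact: heat_trace_series.
Qed.

End operator.

Lemma nneseries_lin_lty (R : realType) (f g : nat -> R) (a b : R) :
  0 <= a -> 0 <= b -> (forall k, 0 <= f k) -> (forall k, 0 <= g k) ->
  (\sum_(k <oo) (f k)%:E < +oo)%E -> (\sum_(k <oo) (g k)%:E < +oo)%E ->
  (\sum_(k <oo) (a * f k + b * g k)%:E < +oo)%E.
Proof.
move=> a0 b0 f0 g0 foo goo.
under eq_eseriesr do rewrite EFinD !EFinM.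
rewrite nneseriesD; last 2 first.
- by move=> k _; rewrite -EFinM lee_fin mulr_ge0.
- by move=> k _; rewrite -EFinM lee_fin mulr_ge0.
rewrite !nneseriesZl; last 2 first.
- by move=> k _; rewrite lee_fin.
- by move=> k _; rewrite lee_fin.
by rewrite lte_add_pinfty// lte_mul_pinfty ?lee_fin.
Qed.

(** * The cusp contribution *)

Section cusp_assembly.
Context {R : realType}.
Let mu := @lebesgue_measure R.
(** [x k] and [t l] stand for the real or imaginary parts of the diagonal coefficients and of the
    traces on eigenspaces. *)
Variables (lam x : nat -> R) (al : pred nat) (c : R) (S : set R) (t H : R -> R) (y : R).
Hypotheses (y0 : 0 < y) (c0 : 0 < c).
Hypothesis lam_gap : forall k, al k -> c <= `|lam k|.
Hypothesis x_dead : forall k, ~~ al k -> x k = 0.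
Hypothesis lamS : forall k, al k -> S (lam k).
Hypothesis tE : forall l, exists2 N, (forall k, al k -> lam k = l -> (k < N)%N) &
  t l = \sum_(0 <= k < N | al k && (lam k == l)) x k.
Hypothesis Habs : forall s : R, 0 < s ->
  (\sum_(k <oo) `|lam k * expR (- s * lam k ^+ 2) * x k|%:E < +oo)%E.
Hypothesis Hcvg : forall s : R, 0 < s ->
  series (fun k => lam k * expR (- s * lam k ^+ 2) * x k) @ \oo --> H s.
Hypothesis intH :
  mu.-integrable `]0, +oo[ (EFin \o (fun s => H s / Num.sqrt s)).

Let J (s l : R) := expR (- (s * l ^+ 2)) / (2 * Num.sqrt (pi * s)) *
  (l * (1 - expR (- (y ^+ 2 / s))) + y / s * expR (- (y ^+ 2 / s))).

Let b k := x k * Num.sg (lam k).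
(** Indices of zero basis entries get the value 1, so that m is positive throughout; their [b k] is
    0. *)
Let m k := if al k then `|lam k| else 1.

Let m0 k : 0 < m k.
Proof. by rewrite /m; case: ifP => // /lam_gap; exact: lt_le_trans. Qed.

Let bmE (s : R) k :
  b k * m k * expR (- s * m k ^+ 2) = lam k * expR (- s * lam k ^+ 2) * x k.
Proof.
rewrite /b /m; case: (boolP (al k)) => [ak|/x_dead ->]; last by rewrite !(mul0r, mulr0).
rewrite real_normK ?num_real//.
transitivity (Num.sg (lam k) * `|lam k| * expR (- s * lam k ^+ 2) * x k); first by ring.
by rewrite -numEsg.
Qed.

Let bm_ge0 (s : R) k : 0 <= `|b k * m k * expR (- s * m k ^+ 2)|.
Proof. exact: normr_ge0. Qed.

Let bmfin (s : R) : 0 < s ->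
  (\sum_(k <oo) `|b k * m k * expR (- s * m k ^+ 2)|%:E < +oo)%E.
Proof. by move=> s0; under eq_eseriesr do rewrite bmE; exact: Habs. Qed.

(** The gap c <= m k replaces the missing factor m k by 1 / c, which is why A exists although only
    the traces defining H are given. *)
Let bfin (s : R) : 0 < s ->
  (\sum_(k <oo) (`|b k| * expR (- s * m k ^+ 2))%:E < +oo)%E.
Proof.
move=> s0; have ci : 0 <= c^-1 by rewrite invr_ge0 ltW.
have := @nneseries_lin_lty R _ _ c^-1 0 ci (lexx _) (bm_ge0 s) (bm_ge0 s)
  (bmfin s0) (bmfin s0).
apply: le_lt_trans; apply: lee_nneseries => k _.
  by rewrite lee_fin mulr_ge0 ?expR_ge0.
rewrite lee_fin mul0r addr0 !normrM (ger0_norm (expR_ge0 _)) (gtr0_norm (m0 k)).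
rewrite ler_pdivlMl// /b /m; case: (boolP (al k)) => [ak|/x_dead ->]; last first.
  by rewrite normr0 !(mul0r, mulr0).
rewrite mulrA ler_wpM2r ?expR_ge0// mulrC ler_wpM2l// ?lam_gap//.
Qed.

Let A (s : R) := lim (series (fun k => b k * expR (- s * m k ^+ 2)) @ \oo).

Let bA (s : R) : 0 < s ->
  series (fun k => b k * expR (- s * m k ^+ 2)) @ \oo --> A s.
Proof.
move=> s0; apply: normed_cvg.
have := nneseries_fine_cvg _ (bfin s0).
move=> h; apply/cvg_ex; eexists.
rewrite (_ : [normed _] = series (fun k => `|b k| * expR (- s * m k ^+ 2))).
  by apply: h => k; rewrite mulr_ge0 ?expR_ge0.
apply/funext => n; apply: eq_bigr => k _.
by rewrite /= normrM (ger0_norm (expR_ge0 _)).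
Qed.

Let bH (s : R) : 0 < s ->
  series (fun k => b k * m k * expR (- s * m k ^+ 2)) @ \oo --> H s.
Proof. move=> s0; rewrite (_ : (fun k => _) = (fun k => lam k * expR (- s * lam k ^+ 2) * x k)).
  exact: Hcvg.
by apply/funext => k; exact: bmE. Qed.

Let z (s : R) k := if al k then x k * (Num.sg (lam k) * J s `|lam k|) else 0.

Let zE (s : R) k : z s k = (2 * Num.sqrt (pi * s))^-1 *
  ((1 - expR (- (y ^+ 2 / s))) * (b k * m k * expR (- s * m k ^+ 2)) +
   y / s * expR (- (y ^+ 2 / s)) * (b k * expR (- s * m k ^+ 2))).
Proof.
rewrite /z /b /m; case: (boolP (al k)) => [ak|/x_dead ->]; last first.
  by rewrite !(mul0r, mulr0, addr0).
by rewrite /J mulNr; ring.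
Qed.

Let zfin (s : R) : 0 < s -> (\sum_(k <oo) `|z s k|%:E < +oo)%E.
Proof.
move=> s0; set d := (2 * Num.sqrt (pi * s))^-1.
have d0 : 0 <= d by rewrite invr_ge0 mulr_ge0 ?sqrtr_ge0.
pose E := expR (- (y ^+ 2 / s)).
have a1 : 0 <= d * `|1 - E| by rewrite mulr_ge0.
have a2 : 0 <= d * `|y / s * E| by rewrite mulr_ge0.
have g0 k : 0 <= `|b k| * expR (- s * m k ^+ 2) by rewrite mulr_ge0 ?expR_ge0.
have := nneseries_lin_lty a1 a2 (bm_ge0 s) g0 (bmfin s0) (bfin s0).
apply: le_lt_trans; apply: lee_nneseries => k _; first by rewrite lee_fin.
rewrite lee_fin zE -/d -/E normrM (ger0_norm d0) -!mulrA -mulrDr ler_wpM2l//.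
apply: (le_trans (ler_normD _ _)); rewrite !normrM (ger0_norm (expR_ge0 (- s * m k ^+ 2))).
by rewrite !mulrA.
Qed.

Lemma cusp_summable (s : R) : 0 < s ->
  summable S (fun l => (t l * (Num.sg l * J s `|l|))%:E).
Proof.
move=> s0.
have [] // := @Rsum_fibres R S lam x al (fun l => Num.sg l * J s `|l|) t lamS _ (zfin s0).
Qed.

Lemma cusp_RsumE (s : R) : 0 < s ->
  Rsum S (fun l => t l * (Num.sg l * J s `|l|)) =
  (2 * Num.sqrt pi)^-1 * (H s / Num.sqrt s - H s / Num.sqrt s * expR (- (y ^+ 2 / s)) +
    y / (s * Num.sqrt s) * expR (- (y ^+ 2 / s)) * A s).
Proof.
move=> s0.
have [//|_ h] := @Rsum_fibres R S lam x al (fun l => Num.sg l * J s `|l|) t lamS _ (zfin s0).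
have h2 : series (z s) @ \oo --> (2 * Num.sqrt (pi * s))^-1 *
    ((1 - expR (- (y ^+ 2 / s))) * H s + y / s * expR (- (y ^+ 2 / s)) * A s).
  rewrite (_ : series (z s) = (fun n => (2 * Num.sqrt (pi * s))^-1 *
    ((1 - expR (- (y ^+ 2 / s))) * series (fun k => b k * m k * expR (- s * m k ^+ 2)) n +
     y / s * expR (- (y ^+ 2 / s)) * series (fun k => b k * expR (- s * m k ^+ 2)) n))).
    apply: cvgMl_tmp; apply: cvgD; apply: cvgMl_tmp; [exact: bH|exact: bA].
  apply/funext => n; rewrite /series/= !mulr_sumr -big_split/= mulr_sumr.
  by apply: eq_bigr => k _; exact: zE.
rewrite (cvg_unique _ h h2)//.
rewrite sqrtrM ?pi_ge0//; field.
by rewrite !gt_eqF ?sqrtr_gt0 ?pi_gt0.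
Qed.

(** The integrand may be split because its pieces are separately integrable: the second is bounded
    by |H s| / sqrt s, the third is handled by subordination. *)
Lemma cusp_Rintegral :
  mu.-integrable `]0, +oo[ (EFin \o (fun s => Rsum S (fun l => t l * (Num.sg l * J s `|l|)))) /\
  2 * Rintegral mu `]0, +oo[ (fun s => Rsum S (fun l => t l * (Num.sg l * J s `|l|))) =
  (Num.sqrt pi)^-1 * Rintegral mu `]0, +oo[ (fun s => H s / Num.sqrt s).
Proof.
have [i3 e3] := heat_transform_subordination y0 m0 bfin bA bH intH.
have i2 : mu.-integrable `]0, +oo[
    (EFin \o (fun s => H s / Num.sqrt s * expR (- (y ^+ 2 / s)))).
  apply: (le_integrable _ _ _ intH) => //.
    apply/measurable_EFinP; apply: measurable_funM.
      by apply/measurable_EFinP; exact: measurable_int intH.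
    apply: measurable_funTS; apply: measurableT_comp => //; apply: measurableT_comp => //.
    by apply: measurable_funM => //; exact: measurable_invr.
  move=> s; rewrite /= in_itv/= andbT => s0; rewrite lee_fin normrM ler_piMr//.
  by rewrite ger0_norm ?expR_ge0// expR_le1 oppr_le0 divr_ge0 ?sqr_ge0// ltW.
have mD : measurable (`]0, +oo[%classic : set (measurableTypeR R)) by exact: measurable_itv.
have i12 := integrable_subr mD intH i2.
have i123 := integrable_addr mD i12 i3.
have iZ := integrable_mulr mD (2 * Num.sqrt pi)^-1 i123.
have E s : `]0, +oo[%classic s -> Rsum S (fun l => t l * (Num.sg l * J s `|l|)) =
  (2 * Num.sqrt pi)^-1 * (H s / Num.sqrt s - H s / Num.sqrt s * expR (- (y ^+ 2 / s)) +
    y / (s * Num.sqrt s) * expR (- (y ^+ 2 / s)) * A s).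
  by rewrite /= in_itv/= andbT; exact: cusp_RsumE.
split.
  by apply: eq_integrable iZ => // s /set_mem Ds; rewrite /= E.
have -> : Rintegral mu `]0, +oo[ (fun s => Rsum S (fun l => t l * (Num.sg l * J s `|l|))) =
  Rintegral mu `]0, +oo[ (fun s => (2 * Num.sqrt pi)^-1 *
    (H s / Num.sqrt s - H s / Num.sqrt s * expR (- (y ^+ 2 / s)) +
    y / (s * Num.sqrt s) * expR (- (y ^+ 2 / s)) * A s)).
  by apply: eq_Rintegral => s /set_mem Ds; exact: E.
rewrite (RintegralZl _ mD i123) (RintegralD mD i12 i3) (RintegralB mD intH i2) e3.
rewrite subrK; field.
by rewrite gt_eqF// sqrtr_gt0 pi_gt0.
Qed.

End cusp_assembly.

Lemma eq_Rsum (R : realType) (S : set R) (f g : R -> R) :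
  (forall l, S l -> f l = g l) -> Rsum S f = Rsum S g.
Proof.
by move=> fg; rewrite /Rsum; congr (fine _ - fine _); apply: eq_esum => l Sl; rewrite fg.
Qed.

Lemma eq_complexE (R : realType) (z w : R[i]) :
  complex.Re z = complex.Re w -> complex.Im z = complex.Im w -> z = w.
Proof. by case: z w => [a b] [a' b'] /= -> ->. Qed.

(** * Comparison of the two invariants for an abstract operator *)

Section cusp_eta.
Context {R : realType} {X : Type} {E : bundle R X}.
Variables (inner : sec E -> sec E -> R[i]) (P : set (sec E)).
Variables (D T : sec E -> sec E).
Local Notation L := (lspan P).
Local Notation V := (Defs.eigenspace P D).
Local Notation S := (spec inner P D).
Hypothesis inner_lin : forall a u v w, L u -> L v -> L w ->
  inner (comb a u v) w = a * inner u w + inner v w.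
Hypothesis inner_conj : forall u v, L u -> L v -> inner v u = (inner u v)^*%C.
Hypothesis inner_def : forall u, L u -> inner u u = 0 -> u = sec0.
Hypothesis D_sym : forall u v, P u -> P v -> inner (D u) v = inner u (D v).
Hypothesis D_gap : exists2 K : R, 0 < K & forall u, P u ->
  nrm2 inner u <= K * nrm2 inner (fun x => D u x - 0%:C%C *: u x).
Hypothesis T_lin : forall a u v, T (comb a u v) = comb a (T u) (T v).
Hypothesis T_eig : forall l u, V l u -> V l (T u).
Hypothesis eta_def : eta_defined inner P D T.
Variables (a a' : R) (theta : R -> R -> R -> R) (rho : R -> cumulative R R).
Hypothesis aa' : a < a'.
Hypothesis thetaP : forall l, S l -> forall nu,
  is_theta (qplus (cst 0) a `|l|) nu (theta `|l| nu).
Hypothesis rhoP : forall l, S l -> is_spectral_function (theta `|l|) (rho `|l|).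
Let mu := @lebesgue_measure R.
Let y := a' - a.
Let y0 : 0 < y. Proof. by rewrite subr_gt0. Qed.

Let J (s l : R) := expR (- (s * l ^+ 2)) / (2 * Num.sqrt (pi * s)) *
  (l * (1 - expR (- (y ^+ 2 / s))) + y / s * expR (- (y ^+ 2 / s))).

Let cusp_integral (s l : R) : 0 < s -> S l ->
  (lebesgue_stieltjes_measure (rho `|l|)).-integrable setT
    (fun nu => (cusp_integrand (cst 0) a a' `|l| s (theta `|l|) nu)%:E) /\
  Rintegral (lebesgue_stieltjes_measure (rho `|l|)) setT
    (cusp_integrand (cst 0) a a' `|l| s (theta `|l|)) = J s `|l|.
Proof.
move=> s0 Sl.
have -> : cusp_integrand (cst 0) a a' `|l| s (theta `|l|) =
    (fun nu => expR (- s * nu) * theta `|l| nu y *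
      (derive1 (theta `|l| nu) y + `|l| * theta `|l| nu y)).
  by apply/funext => nu; rewrite cusp_integrand_cst0// ltW.
exact: (cusp_spectral_integral s0 y0 (qplus_cst0 a `|l|) (thetaP Sl) (rhoP Sl)).
Qed.

Let H s := heat_trace inner P D T s.

Let part (q : R[i] -> R) := forall (c : R) z, q (c%:C%C * z) = c * q z.

(** [q] is the real or the imaginary part: additive, real-homogeneous and bounded by the modulus.
    The fourth premise picks the matching one of the two convergent series, so the argument is made
    once for both. *)
Let cusp_part (q : R[i] -> R) : part q ->
  (forall I (r : seq I) (p : pred I) F, 
     q (\sum_(k <- r | p k) F k) = \sum_(k <- r | p k) q (F k)) ->
  (forall z, `|q z| <= complex.Re `|z|) ->
  (forall lam tau s, 0 < s ->
      series (fun k => complex.Re ((lam k * expR (- s * lam k ^+ 2))%:C%C * tau k)) @ \oo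
         --> complex.Re (H s) ->
      series (fun k => complex.Im ((lam k * expR (- s * lam k ^+ 2))%:C%C * tau k)) @ \oo
         --> complex.Im (H s) ->
      series (fun k => q ((lam k * expR (- s * lam k ^+ 2))%:C%C * tau k)) @ \oo --> q (H s)) ->
  mu.-integrable `]0, +oo[ (EFin \o (fun s => q (H s) / Num.sqrt s)) ->
  let Z s := Rsum S (fun l => q (cusp_term P D T (cst 0) a a' theta rho s l)) in
  [/\ forall s, 0 < s -> summable S (fun l => (q (cusp_term P D T (cst 0) a a' theta rho s l))%:E),
    mu.-integrable `]0, +oo[ (EFin \o Z) &
    2 * Rintegral mu `]0, +oo[ Z =
    (Num.sqrt pi)^-1 * Rintegral mu `]0, +oo[ (fun s => q (H s) / Num.sqrt s)].
Proof.
move=> qZ qsum qle qcvg intH Z.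
have [lam [tau [al [c [[c0 cP dead alS] fib heat]]]]] :=
  eigen_data inner_lin inner_conj inner_def D_sym D_gap T_lin T_eig eta_def.1.
pose t l := q (fin_trace (V l) T).
have q0 : q 0 = 0 by rewrite -[0 in LHS](mul0r (0 : R[i])) -[0 in LHS]/(0%:C%C) qZ mul0r.
have xdead k : ~~ al k -> q (tau k) = 0 by move=> /dead ->.
have tE l : exists2 N, (forall k, al k -> lam k = l -> (k < N)%N) &
    t l = \sum_(0 <= k < N | al k && (lam k == l)) q (tau k).
  by have [N NP NE] := fib l; exists N => //; rewrite /t NE qsum.
have Habs (s : R) : 0 < s ->
    (\sum_(k <oo) `|lam k * expR (- s * lam k ^+ 2) * q (tau k)|%:E < +oo)%E.
  move=> s0; have [+ _ _] := heat s s0; apply: le_lt_trans.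
  apply: lee_nneseries => k _; first by rewrite lee_fin.
  by rewrite lee_fin -qZ; exact: qle.
have Hcvg (s : R) : 0 < s ->
    series (fun k => lam k * expR (- s * lam k ^+ 2) * q (tau k)) @ \oo --> q (H s).
  move=> s0; have [_ h1 h2] := heat s s0.
  rewrite (_ : (fun k => _) = (fun k => q ((lam k * expR (- s * lam k ^+ 2))%:C%C * tau k))).
    exact: qcvg h1 h2.
  by apply/funext => k; rewrite qZ.
have termE (s : R) : 0 < s -> forall l, S l ->
    q (cusp_term P D T (cst 0) a a' theta rho s l) = t l * (Num.sg l * J s `|l|).
  move=> s0 l Sl; rewrite /cusp_term (cusp_integral s0 Sl).2.
  by rewrite mulrC qZ qZ /t; ring.
have sm := cusp_summable (t := t) y c0 cP xdead alS tE Habs.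
have [iZ eZ] := cusp_Rintegral (t := t) y0 c0 cP xdead alS tE Habs Hcvg intH.
have ZE (s : R) : `]0, +oo[%classic s -> Z s = Rsum S (fun l => t l * (Num.sg l * J s `|l|)).
  by rewrite /= in_itv/= andbT => s0; apply: eq_Rsum; exact: termE.
split.
- move=> s s0; have := sm s s0; rewrite /summable.
  by under eq_esum => l Sl do rewrite -(termE s s0 l Sl).
- by apply: eq_integrable iZ => // s /set_mem Ds; rewrite /= ZE.
- rewrite -eZ; congr (_ * _); apply: eq_Rintegral => s /set_mem Ds; exact: ZE.
Qed.

Lemma cusp_contribution_eq_eta (p : nat) :
  cusp_defined inner P D T (cst 0) a a' theta rho /\
  cusp_contribution inner P D T p (cst 0) a a' theta rho = eta_invariant inner P D T.
Proof.
have [_ [iRe iIm]] := eta_def.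
have eRe : (fun s => complex.Re (eta_integrand inner P D T s)) =
    (fun s => complex.Re (H s) / Num.sqrt s).
  by apply/funext => s; rewrite /eta_integrand mulrC ReZ mulrC.
have eIm : (fun s => complex.Im (eta_integrand inner P D T s)) =
    (fun s => complex.Im (H s) / Num.sqrt s).
  by apply/funext => s; rewrite /eta_integrand mulrC ImZ mulrC.
have [sR iR ER] := cusp_part (@ReZ R) (@Re_sum R) (@ler_Re_norm R)
  (fun _ _ _ _ h _ => h) (eq_ind _ (fun f => mu.-integrable `]0, +oo[ (EFin \o f)) iRe _ eRe).
have [sI iI EI] := cusp_part (@ImZ R) (@Im_sum R) (@ler_Im_norm R)
  (fun _ _ _ _ _ h => h) (eq_ind _ (fun f => mu.-integrable `]0, +oo[ (EFin \o f)) iIm _ eIm).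
split.
  split; last by split; [exact: iR|exact: iI].
  move=> s s0; split; first by move=> l Sl; exact: (cusp_integral s0 Sl).1.
  by split; [exact: sR|exact: sI].
rewrite /cusp_contribution /eta_invariant /= mulr0 oppr0 expR0 mulr1.
apply: eq_complexE.
  rewrite !ReZ /Cintegral eRe; exact: ER.
rewrite !ImZ /Cintegral eIm; exact: EI.
Qed.

End cusp_eta.

(** * Geometry of the cylindrical end *)

(** A filter pushed forward to the range clusters at some i x, and the induced topology brings the
    cluster point back to x. *)
Lemma compact_embedding (X Y : topologicalType) (i : Y -> X) :
  (forall V : set Y, open V -> exists2 W : set X, open W & V = i @^-1` W) ->
  compact (range i) -> compact [set: Y].
Proof.
move=> emb cpt F PF _.
have FiY : (i @ F) (range i) by apply: (@filterS _ F _ setT) => [y _|]; [exists y|exact: filterT].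
have [_ [[x _ <-] clx]] := cpt (i @ F) _ FiY.
exists x; split => // A B FA; rewrite nbhsE => -[V [oV Vx] VB].
have [W oW VW] := emb _ oV.
have FA' : (i @ F) (i @` A) by apply: (@filterS _ F _ A) => // a Aa; exists a.
have [|_ [[a Aa <-] Wa]] := clx _ W FA'.
  by apply: open_nbhs_nbhs; split => //; move: Vx; rewrite VW.
by exists a; split => //; apply: VB; rewrite VW.
Qed.

(** The boundary is the intersection of the compact Z with the closed complement of its interior.
    Compactness of N makes support conditions automatic, so the volume functional is linear and
    positive on all continuous functions. *)
Lemma compact_ceN (R : realType) p (X : cylindrical_end R p) : compact [set: ceN X].
Proof.
have [_ _ _ emb] := ce_i_embedding X.
apply: (compact_embedding emb); rewrite ce_i_boundary setDE.
apply: compact_closedI; first exact: ceZ_compact.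
by rewrite closedC; exact: open_interior.
Qed.

Lemma smooth_fun_continuous (R : realType) n (X : manifold R n) (f : X -> R) :
  smooth_fun setT f -> continuous f.
Proof.
move=> sf x; set c := chart_at x.
have cx : cdom c x by exact: chart_at_dom.
have ac : atlas c by exact: chart_at_atlas.
have [oc _ cK cc _] := atlas_chart ac.
have [/(_ (cmap c x)) h _] := sf c ac 0%N.
have {}h : {for cmap c x, continuous (f \o cinv c)}.
  by apply: h; exists x => //; split.
have e : {near x, (f \o cinv c) \o cmap c =1 f}.
  near=> z; rewrite /= cK//; near: z; exact: open_nbhs_nbhs.
have h2 := continuous_comp (cc x cx) h.
have fx : ((f \o cinv c) \o cmap c) x = f x by rewrite /= cK.
by rewrite /continuous_at -fx; apply: cvg_trans h2; exact: near_eq_cvg.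
Unshelve. all: by end_near. Qed.

(** * The inner product of sections over a compact manifold *)

Section compact_integral.
Context {R : realType} {n : nat} {X : manifold R n}.
Variables (B : X -> 'M[R]_n) (vol : (X -> R) -> R).
Hypotheses (cX : compact [set: X]) (volP : is_volume B vol).

Lemma outside_compactT (A : set X) : outside_compact A.
Proof. by exists setT; split => // x /(_ Logic.I). Qed.

Let vol_lin (a : R) (f g : X -> R) : continuous f -> continuous g ->
  vol (fun x => a * f x + g x) = a * vol f + vol g.
Proof. by move=> cf cg; apply: volP.1 => //; exact: outside_compactT. Qed.

Let cont0 : continuous (fun _ : X => 0 : R). Proof. by move=> x; exact: cvg_cst. Qed.

Let vol0 : vol (fun=> 0) = 0.
Proof.
by have := vol_lin (-1) cont0 cont0; rewrite mulN1r addNr mulN1r addNr.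
Qed.

Let volN (f : X -> R) : continuous f -> vol (fun x => - f x) = - vol f.
Proof.
move=> cf; rewrite -mulN1r -[RHS]addr0 -vol0 -vol_lin//.
by congr vol; apply/funext => x; rewrite mulN1r addr0.
Qed.

Definition ccontinuous (f : X -> R[i]) :=
  continuous (fun x => complex.Re (f x)) /\ continuous (fun x => complex.Im (f x)).

Lemma ccontinuous_lin (a : R[i]) (f g : X -> R[i]) : ccontinuous f -> ccontinuous g ->
  ccontinuous (fun x => a * f x + g x).
Proof.
move=> [fr fi] [gr gi]; split => x.
  rewrite (_ : (fun x => _) = (fun x => complex.Re a * complex.Re (f x) -
      complex.Im a * complex.Im (f x) + complex.Re (g x))); last first.
    by apply/funext => z; rewrite ReD; case: a (f z) => [? ?] [? ?].
  apply: cvgD; last exact: gr.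
  by apply: cvgB; apply: cvgM; [exact: cvg_cst|exact: fr|exact: cvg_cst|exact: fi].
rewrite (_ : (fun x => _) = (fun x => complex.Re a * complex.Im (f x) +
    complex.Im a * complex.Re (f x) + complex.Im (g x))); last first.
  by apply/funext => z; rewrite ImD; case: a (f z) => [? ?] [? ?].
apply: cvgD; last exact: gi.
by apply: cvgD; apply: cvgM; [exact: cvg_cst|exact: fi|exact: cvg_cst|exact: fr].
Qed.

Lemma ccontinuous_conj (f : X -> R[i]) : ccontinuous f ->
  ccontinuous (fun x => (f x)^*%C).
Proof.
move=> [fr fi]; split => x.
  rewrite (_ : (fun x => _) = (fun x => complex.Re (f x))); first exact: fr.
  by apply/funext => z; case: (f z).
rewrite (_ : (fun x => _) = (fun x => - complex.Im (f x))); first by apply: cvgN; exact: fi.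
by apply/funext => z; case: (f z).
Qed.

Lemma cvol_lin (a : R[i]) (f g : X -> R[i]) : ccontinuous f -> ccontinuous g ->
  cvol vol (fun x => a * f x + g x) = a * cvol vol f + cvol vol g.
Proof.
move=> [fr fi] [gr gi]; rewrite /cvol; apply: eq_complexE.
  rewrite ReD /=; case: a => [ar ai] /=.
  rewrite -addrA -mulNr -!vol_lin//.
    by congr vol; apply/funext => z; rewrite ReD; case: (f z) => * /=; ring.
  move=> x; apply: cvgD; last exact: gr.
  by apply: cvgM; [exact: cvg_cst|exact: fi].
rewrite ImD /=; case: a => [ar ai] /=.
rewrite -addrA -!vol_lin//.
  by congr vol; apply/funext => z; rewrite ImD; case: (f z) => * /=; ring.
move=> x; apply: cvgD; last exact: gi.
by apply: cvgM; [exact: cvg_cst|exact: fr].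
Qed.

Lemma cvol_conj (f : X -> R[i]) : ccontinuous f ->
  cvol vol (fun x => (f x)^*%C) = (cvol vol f)^*%C.
Proof.
move=> [fr fi]; rewrite /cvol /=; congr Complex.
  by congr vol; apply/funext => z; case: (f z).
by rewrite -volN//; congr vol; apply/funext => z; case: (f z).
Qed.

Lemma cvol_gt0 (f : X -> R[i]) : ccontinuous f -> (forall x, 0 <= f x) ->
  (exists x, f x != 0) -> cvol vol f != 0.
Proof.
move=> [fr _] f0 [x fx]; apply/eqP => /(congr1 (@complex.Re R))/= v0.
suff : 0 < vol (fun x => complex.Re (f x)) by rewrite v0 ltxx.
apply: volP.2.1 => //; first exact: outside_compactT.
  by move=> z; have := f0 z; rewrite lecE => /andP[].
(* A nonnegative complex number has zero imaginary part, so it is nonzero only if its real part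
   is. *)
exists x; apply: contra fx => /eqP r0; have := f0 x; rewrite lecE /= r0 => /andP[/eqP i0 _].
by rewrite eq_complex /= r0 i0 eqxx.
Qed.

Variables (E : bundle R X) (h : forall x, E x -> E x -> R[i]).
Hypothesis hP : is_hermitian h.
Let inner (u v : sec E) := cvol vol (fun x => h (u x) (v x)).
Local Notation L := (lspan (@smooth_sec R n X E)).

(** Induction over both spans, with conjugate symmetry reducing the second argument to the first;
    smoothness is used only in the base case. *)
Lemma ccontinuous_hermitian u v : L u -> L v -> ccontinuous (fun x => h (u x) (v x)).
Proof.
have [hl hc _ hs] := hP.
have sym (u1 v1 : sec E) : ccontinuous (fun x => h (u1 x) (v1 x)) ->
    ccontinuous (fun x => h (v1 x) (u1 x)).
  by move=> /ccontinuous_conj; under eq_fun do rewrite -hc.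
have lin a (u1 v1 w : sec E) : ccontinuous (fun x => h (u1 x) (w x)) ->
    ccontinuous (fun x => h (v1 x) (w x)) -> ccontinuous (fun x => h (comb a u1 v1 x) (w x)).
  by move=> uw vw; under eq_fun do rewrite /comb hl; exact: ccontinuous_lin.
have z (w : sec E) : ccontinuous (fun x => h (sec0 x) (w x)).
  have h0 x : h (sec0 x) (w x) = 0.
    have := hl x (-1) 0 0 (w x); rewrite scaler0 addr0 /sec0 mulN1r addNr; exact.
  by split; under eq_fun do rewrite h0; exact: cont0.
move=> Lu; elim=> {v} [v sv||a v w _ IHv _ IHw].
- elim: Lu => {u} [u su||a u w _ IHu _ IHw]; [|exact: z|exact: lin].
  by have [? ?] := hs _ _ su sv; split; exact: smooth_fun_continuous.
- by apply: sym; exact: z.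
- by apply: (sym); apply: lin; exact: (sym).
Qed.

Lemma inner_comb a u v w : L u -> L v -> L w ->
  inner (comb a u v) w = a * inner u w + inner v w.
Proof.
move=> Lu Lv Lw; have [hl _ _ _] := hP.
rewrite /inner; under eq_fun do rewrite /comb hl.
by apply: cvol_lin; exact: ccontinuous_hermitian.
Qed.

Lemma inner_conjc u v : L u -> L v -> inner v u = (inner u v)^*%C.
Proof.
move=> Lu Lv; have [_ hc _ _] := hP.
rewrite -cvol_conj; last exact: ccontinuous_hermitian.
by congr cvol; apply/funext => x; rewrite hc.
Qed.

Lemma inner_eq0 u : L u -> inner u u = 0 -> u = sec0.
Proof.
move=> Lu uu; have [hl _ hpos _] := hP.
apply: secP => x; apply: contrapT => /eqP ux.
have /eqP [] : inner u u != 0; last by [].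
apply: cvol_gt0.
- exact: ccontinuous_hermitian.
- move=> z; have [->|uz] := eqVneq (u z) 0; last by rewrite ltW// hpos.
  have := hl z (-1) 0 0 0; rewrite scaler0 addr0 mulN1r addNr => ->; exact: lexx.
- by exists x; rewrite gt_eqF// hpos.
Qed.

End compact_integral.

Lemma lmulgV (R : realType) (G : lie_group R) (g : G) : lmul g (linv g) = lone G.
Proof.
rewrite -[lmul g _]lmul1 -(lmulV (linv g)) -lmulA; congr lmul.
by rewrite lmulA lmulV lmul1.
Qed.

(** * The group action on sections over N *)

Section action.
Context {R : realType} {p : nat} {X : cylindrical_end R p}.
Variable g : ceG X.
Local Notation P := (@even_sec R p X).
Local Notation D := (@ceDN R p X).

(** The action on N is specified through its embedding, so the group laws are applied in M. This is
    enough, since the fibre of S|_N at n is the fibre of S at [ce_i n]. *)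
Lemma ce_act_linv (n : ceN X) : ce_act g (ce_i (ce_actN (linv g) n)) = ce_i n.
Proof.
have [_ act1 actM] := ce_actP X.
by rewrite ce_actNP -actM lmulgV act1.
Qed.

Lemma g_act_comb a u v : g_act g (comb a u v) = comb a (g_act g u) (g_act g v).
Proof.
have [lin _ _ _ _] := ce_actSP X.
apply: secP => n; rewrite /g_act /act_sec /ce_actSN.
(* [ce_actS] is constrained only at targets of the form [ce_act g x]; abstracting the target point
   lets the equality of points transport the law between fibres. *)
have {}lin x y : y = ce_act g x -> linear_op (@ce_actS R p X g x y) by move=> ->; exact: lin.
exact: (lin _ _ (esym (ce_act_linv n))).
Qed.

Lemma g_act_even u : P u -> P (g_act g u).
Proof.
move=> [su eu]; split; first exact: (@ceDN_equiv R p X g u su).1.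
move=> n; rewrite /g_act /act_sec /ce_actSN /ce_epsN.
have eq x y w : y = ce_act g x ->
    ce_eps (@ce_actS R p X g x y w) = @ce_actS R p X g x y (ce_eps w).
  by move=> ->; rewrite ce_eps_equiv.
rewrite (eq _ _ _ (esym (ce_act_linv n))); congr ce_actS; exact: eu.
Qed.

Lemma g_act_eigenspace l u : Defs.eigenspace P D l u -> Defs.eigenspace P D l (g_act g u).
Proof.
move=> [Pu /secP Du]; split; first exact: g_act_even.
move=> n; rewrite (@ceDN_equiv R p X g u Pu.1).2 Du.
exact: (congr1 (fun f => f n) (linear_sec_scale g_act_comb _ u)).
Qed.

End action.

Lemma lspan_sub (R : realType) (X : Type) (E : bundle R X) (P Q : set (sec E)) u :
  P `<=` Q -> lspan P u -> lspan Q u.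
Proof.
move=> PQ; elim=> {u} [u /PQ|| a u v _ ? _ ?]; first exact: lspan_in.
  exact: lspan_0.
exact: lspan_comb.
Qed.

Theorem proposition4p4 (R : realType) (p : nat) (p_gt0 : (0 < p)%N)
    (p_even : ~~ odd p) (X : cylindrical_end R p)
    (theta : R -> R -> R -> R) (rho : R -> cumulative R R)
    (thetaP : forall l, specDNp X l -> forall nu,
       is_theta (qplus (cst 0) (ce_a X) `|l|) nu (theta `|l| nu))
    (rhoP : forall l, specDNp X l ->
       is_spectral_function (theta `|l|) (rho `|l|))
    (g : ceG X) (eta_def : eta_DNp_defined g)
    (a' : R) (a'_gt : ce_a X < a') :
  cusp_DNp_defined (cst 0) theta rho g a' /\
  cusp_DNp (cst 0) theta rho g a' = eta_DNp g.
Proof.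
have cN := @compact_ceN R p X.
have vP := ce_volNP X; have hP := ce_hNP X.
have sub u : lspan (@even_sec R p X) u -> lspan (@smooth_sec R _ _ (ceSN X)) u.
  by apply: lspan_sub => v [].
apply: cusp_contribution_eq_eta => //.
- by move=> a u v w /sub Lu /sub Lv /sub Lw; exact: (inner_comb cN vP hP).
- by move=> u v /sub Lu /sub Lv; exact: (inner_conjc cN vP hP).
- by move=> u /sub Lu; exact: (inner_eq0 cN vP hP).
- move=> u v [su _] [sv _]; have [_ _ _ sa] := ceDN_dirac X.
  by apply: sa => //; exact: outside_compactT.
(* The norm bound for D_N on all smooth sections restricts to the even ones. *)
- have [_ [K K0 KP]] := ceDN_inv X.
  by exists K => // u [su _]; exact: KP.
- exact: g_act_comb.
- exact: g_act_eigenspace.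
Qed.
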